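(* Let $n\ge 1$, let $\alpha\in\mathbb{R}\setminus\pi\mathbb{Z}$, and let $\psi\in L^2(\mathbb{R}^n)$ be non-zero. Then $\psi$ is wavelet admissible, i.e. $$\int_{\mathbb{R}_0^n}\int_{\mathbb{R}^n}\left|\langle\psi_{a,b,\alpha},\psi\rangle_{L^2(\mathbb{R}^n)}\right|^2\frac{db\,da}{|a|_p^2}<\infty,$$ if and only if $$C_{\psi,\alpha}:=\int_{\mathbb{R}_0^n}\left|\left(\mathfrak{F}_\alpha\left\{e^{-\frac{i}{2}\|\cdot\|^2\cot\alpha}\psi(\cdot)\right\}\right)(u)\right|^2\frac{1}{|u|_p}\,du<\infty.$$
   Context: For $x,y\in\mathbb{R}^n$: $\|x\|$ is the Euclidean norm, $\langle x,y\rangle$ the Euclidean inner product, $|x|_p=|x_1x_2\cdots x_n|$, and $\mathbb{R}_0^n=\{x\in\mathbb{R}^n:|x|_p\ne 0\}$. For $y\in\mathbb{R}^n_0$, $\frac{x}{y}=(x_1/y_1,\dots,x_n/y_n)$. $\langle f,g\rangle_{L^2(\mathbb{R}^n)}=\int_{\mathbb{R}^n} f\overline{g}$. For $\alpha\in\mathbb{R}\setminus\pi\mathbb{Z}$ let $C_\alpha=\left(\frac{1-i\cot\alpha}{2\pi}\right)^{n/2}$ (principal branch) and $K_\alpha(t,\xi)=C_\alpha e^{\frac{i}{2}(\|t\|^2+\|\xi\|^2)\cot\alpha-i\langle t,\xi\rangle\csc\alpha}$. The fractional Fourier transform (FrFT) of $f\in L^1(\mathbb{R}^n)$ is $(\mathfrak{F}_\alpha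 f)(\xi)=\int_{\mathbb{R}^n}f(t)K_\alpha(t,\xi)\,dt$. For $f\in L^2(\mathbb{R}^n)$, $\mathfrak{F}_\alpha f\in L^2(\mathbb{R}^n)$ is the $L^2$-limit of $\mathfrak{F}_\alpha f_k$ for any sequence $f_k\in L^1\cap L^2$ converging to $f$ in $L^2(\mathbb{R}^n)$. For $\psi\in L^2(\mathbb{R}^n)$, $a\in\mathbb{R}^n_0$, $b\in\mathbb{R}^n$: $\psi_{a,b,\alpha}(t)=\frac{1}{\sqrt{|a|_p}}\psi\left(\frac{t-b}{a}\right)e^{-\frac{i}{2}(\|t\|^2-\|b\|^2)\cot\alpha}$. *)

(* Defs.v *)
From HB Require Import structures.
From mathcomp Require Import all_boot all_order all_algebra.
From mathcomp Require Import all_classical all_reals all_analysis.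
From mathcomp Require Import complex.

Set Implicit Arguments.
Unset Strict Implicit.
Unset Printing Implicit Defensive.

Import Order.TTheory GRing.Theory Num.Theory.
Import numFieldTopology.Exports numFieldNormedType.Exports.
Import ComplexField.Normc.

Local Open Scope classical_set_scope.
Local Open Scope ring_scope.
Local Open Scope complex_scope.

(* [lebesgue_measure] lives on [measurableTypeR R] (the Borel sets of R), hence
   the points of R^n are tuples over this type; [coord] reads coordinates in R,
   where the ring structure is. *)
Notation Rn R n := (n.-tuple (measurableTypeR R)).

Section euclidean_space.
Context {R : realType} {n : nat}.
Implicit Types x y : Rn R n.

Definition coord x (i : 'I_n) : R := tnth x i.

Definition inner x y : R := \sum_(i < n) coord x i * coord y i.

Definition enorm x : R := Num.sqrt (\sum_(i < n) coord x i ^+ 2).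

Definition absprod x : R := `| \prod_(i < n) coord x i |.

Definition Rn0 : set (Rn R n) := [set x | absprod x != 0].

Definition subv x y : Rn R n := [tuple coord x i - coord y i | i < n].

Definition divv x y : Rn R n := [tuple coord x i / coord y i | i < n].

End euclidean_space.

(* n-dimensional Lebesgue measure, on the Borel sets: the n-fold product of
   [lebesgue_measure], transported along (x, t) |-> x :: t. *)
Section lebesgue_measure_n.
Context {R : realType}.

Definition consn n (p : measurableTypeR R * Rn R n) : Rn R n.+1 :=
  [tuple of p.1 :: p.2].

Fixpoint lebn n : set (Rn R n) -> \bar R :=
  match n with
  | 0%N => dirac [tuple]
  | m.+1 => pushforward (lebesgue_measure \x @lebn m)%E (@consn m)
  end.

Lemma measurable_consn n : measurable_fun setT (@consn n).
Proof. exact: measurable_cons. Qed.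

Let unconsn n (t : Rn R n.+1) : measurableTypeR R * Rn R n :=
  (thead t, [tuple of behead t]).

Let measurable_unconsn n : measurable_fun setT (@unconsn n).
Proof.
apply/measurable_fun_pairP; split => /=.
- exact: measurable_tnth.
- exact: measurable_behead.
Qed.

Let consnK n : cancel (@consn n) (@unconsn n).
Proof. by move=> [x t]; rewrite /unconsn theadE; congr pair; exact/val_inj. Qed.

Section lebnS.
Context n (m : {sigma_finite_measure set (Rn R n) -> \bar R}).

Let lebnS := pushforward (lebesgue_measure \x m)%E (@consn n).

Let lebnS_measure : {measure set (Rn R n.+1) -> \bar R} :=
  measure_function_pushforward__canonical__measure_function_Measure
    (lebesgue_measure \x m)%E (@measurable_consn n).

HB.instance Definition _ := isMeasure.Build _ _ _ lebnS
  (measure0 lebnS_measure) (@measure_ge0 _ _ _ lebnS_measure)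
  (@measure_semi_sigma_additive _ _ _ lebnS_measure).

Let lebnS_sigma_finite : sigma_finite setT lebnS.
Proof.
have [F FT Foo] := sigma_finiteT (@lebesgue_measure R).
have [G GT Goo] := sigma_finiteT m.
have [f _ fbij] : exists2 f : nat -> nat * nat, True & forall p, exists k, f k = p.
  exists (fun k => odflt (0, 0)%N (unpickle k)) => // p.
  by exists (pickle p); rewrite pickleK.
exists (fun k => @unconsn n @^-1` (F (f k).1 `*` G (f k).2)).
  apply/seteqP; split => // t _.
  have [i _ Fi] : (\bigcup_i F i) (unconsn t).1 by rewrite -FT.
  have [j _ Gj] : (\bigcup_j G j) (unconsn t).2 by rewrite -GT.
  by have [k fk] := fbij (i, j); exists k => //; rewrite /preimage/= fk.
move=> k; have [mF Flt] := Foo (f k).1; have [mG Glt] := Goo (f k).2; split.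
  rewrite -[X in measurable X]setTI; apply: measurable_unconsn => //.
  exact: measurableX.
rewrite /lebnS /pushforward -comp_preimage.
rewrite (_ : @unconsn n \o @consn n = id); last exact/funext/consnK.
rewrite preimage_id product_measure1E// lte_mul_pinfty//.
by rewrite ge0_fin_numE.
Qed.

HB.instance Definition _ := @Measure_isSigmaFinite.Build _ _ _ lebnS
  lebnS_sigma_finite.

Definition lebnS_sfm : {sigma_finite_measure set (Rn R n.+1) -> \bar R} := lebnS.

End lebnS.

Let lebn_sfm n :
  exists m : {sigma_finite_measure set (Rn R n) -> \bar R}, @lebn n = m.
Proof.
elim: n => [|n [m /= ->]]; last by exists (lebnS_sfm m).
by exists (dirac [tuple] : {sigma_finite_measure set (Rn R 0) -> \bar R}).
Qed.

Let lebn0 n : @lebn n set0 = 0%E.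
Proof. by have [m ->] := lebn_sfm n. Qed.

Let lebn_ge0 n A : (0 <= @lebn n A)%E.
Proof. by have [m ->] := lebn_sfm n. Qed.

Let lebn_semi_sigma_additive n : semi_sigma_additive (@lebn n).
Proof. by have [m ->] := lebn_sfm n; exact: measure_semi_sigma_additive. Qed.

HB.instance Definition _ n := isMeasure.Build _ _ _ (@lebn n)
  (@lebn0 n) (@lebn_ge0 n) (@lebn_semi_sigma_additive n).

Let lebn_sigma_finite n : sigma_finite setT (@lebn n).
Proof. by have [m ->] := lebn_sfm n; exact: sigma_finiteT. Qed.

HB.instance Definition _ n := @Measure_isSigmaFinite.Build _ _ _ (@lebn n)
  (@lebn_sigma_finite n).

Lemma lebn_box n (A : 'I_n -> set (measurableTypeR R)) :
  (forall i, measurable (A i)) ->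
  @lebn n [set x | forall i, A i (tnth x i)] =
  (\prod_(i < n) lebesgue_measure (A i))%E.
Proof.
elim: n A => [|n IH] A mA.
  by rewrite big_ord0 /= diracE mem_set//= => -[].
rewrite big_ord_recl -IH// /= /pushforward.
rewrite [X in (_ \x _)%E X](_ : _ = A ord0 `*`
    [set x | forall i, A (lift ord0 i) (tnth x i)]).
  rewrite product_measure1E//.
  rewrite (_ : [set x | _] = \bigcap_(i in [set: 'I_n])
    ((@tnth n (measurableTypeR R))^~ i @^-1` A (lift ord0 i))).
    apply: fin_bigcap_measurable => // i _.
    by rewrite -[X in measurable X]setTI; exact: measurable_tnth.
  by apply/seteqP; split => x /= h i; [move=> _; exact: h|exact: h].
apply/seteqP; split => [[x t] /= h|[x t] /= [h0 h] i].
- split; first exact: (h ord0).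
  by move=> i; have := h (lift ord0 i); rewrite tnthS.
- by case: (unliftP ord0 i) => [j|] ->; rewrite ?tnthS.
Qed.

End lebesgue_measure_n.
Arguments lebn R n _ : clear implicits.

Section complex_analysis.
Context {R : realType}.
Implicit Types z : R[i].

Definition expi (theta : R) : R[i] := cos theta +i* sin theta.

(* principal argument, in ]-pi, pi] *)
Definition carg z : R :=
  let s := acos (complex.Re z / normc z) in
  if 0 <= complex.Im z then s else - s.

(* principal branch of z ^ s for z != 0 *)
Definition cpow z (s : R) : R[i] := (normc z `^ s)%:C * expi (s * carg z).

Context {n : nat}.
Implicit Types f g : Rn R n -> R[i].

Definition cintegral f : R[i] :=
  (\int[lebn R n]_x complex.Re (f x)) +i* (\int[lebn R n]_x complex.Im (f x)).

Definition cLnorm (p : \bar R) f : \bar R :=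
  'N[lebn R n]_p [(fun x => (normc (f x))%:E)].

Definition cLp (p : \bar R) f : Prop :=
  [/\ measurable_fun setT (fun x => complex.Re (f x)),
      measurable_fun setT (fun x => complex.Im (f x)) &
      (cLnorm p f < +oo)%E].

Definition L2_cvg (f_ : nat -> Rn R n -> R[i]) f : Prop :=
  cLnorm 2%:E (fun x => f_ k x - f x) @[k --> \oo] --> 0%E.

Definition L2_inner f g : R[i] := cintegral (fun x => f x * (g x)^*).

End complex_analysis.

Section fractional_Fourier.
Context {R : realType} {n : nat} (alpha : R).
Implicit Types (x t xi a b : Rn R n) (f g psi : Rn R n -> R[i]).

Definition cot (x : R) : R := cos x / sin x.
Definition csc (x : R) : R := (sin x)^-1.

Definition Calpha : R[i] :=
  cpow ((1 -i* cot alpha) / (2 * pi)%:C) (n%:R / 2).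

Definition Kalpha t xi : R[i] :=
  Calpha * expi ((enorm t ^+ 2 + enorm xi ^+ 2) * cot alpha / 2
                 - inner t xi * csc alpha).

Definition frft1 f xi : R[i] := cintegral (fun t => f t * Kalpha t xi).

Definition is_frft2 f g : Prop :=
  cLp 2%:E g /\
  forall f_ : nat -> Rn R n -> R[i],
    (forall k, cLp 1%:E (f_ k) /\ cLp 2%:E (f_ k)) ->
    L2_cvg f_ f -> L2_cvg (fun k => frft1 (f_ k)) g.

(* [is_frft2 f g] determines g up to equality almost everywhere; [frft2 f] is
   an arbitrary representative of that class. *)
Definition frft2 f : Rn R n -> R[i] := xget (fun=> 0) [set g | is_frft2 f g].

Definition chirp t : R[i] := expi (- (enorm t ^+ 2 * cot alpha / 2)).

Definition wavelet psi a b t : R[i] :=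
  (Num.sqrt (absprod a))^-1%:C * psi (divv (subv t b) a)
  * expi (- ((enorm t ^+ 2 - enorm b ^+ 2) * cot alpha / 2)).

Definition wavelet_admissible psi : Prop :=
  (\int[lebn R n]_(a in Rn0) \int[lebn R n]_b
     (normc (L2_inner (wavelet psi a b) psi) ^+ 2 / absprod a ^+ 2)%:E
   < +oo)%E.

Definition Cpsi psi : \bar R :=
  (\int[lebn R n]_(u in Rn0)
     (normc (frft2 (fun t => (chirp t * psi t)%R) u) ^+ 2 / absprod u)%:E)%E.

End fractional_Fourier.

(* Main.v *)
From HB Require Import structures.
Require Import Defs.
From mathcomp Require Import all_boot all_order all_algebra.
From mathcomp Require Import all_classical all_reals all_analysis.
From mathcomp Require Import complex measurable_realfun ring lra.
Set Implicit Arguments.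
Unset Strict Implicit.
Unset Printing Implicit Defensive.
Import Order.TTheory GRing.Theory Num.Theory.
Import numFieldNormedType.Exports.
Import ComplexField.Normc.
Import Defs.

(** Write [Phi] and [Psi] for the transforms of the chirped function
    [chirp psi] and of [psi] under the unimodular kernel
    [expi ((|x|^2 + |xi|^2) cot alpha / 2 - <x, xi> csc alpha)], that is, the
    fractional Fourier transform without its constant [Calpha].  The wavelet
    [wavelet psi a b] is obtained from [chirp psi] by a dilation by [a], a
    translation by [b] and multiplications by chirps, all of which the transform
    carries to explicit operations ([transform_wavelet_lift]).  Parseval's
    formula therefore turns the coefficient of [psi] against [wavelet psi a b]
    into a constant times [|a|^(1/2)] times the transform, at the point [b], of
    the function [xi |-> e^(-i |a xi|^2 cot alpha / 2) Phi (a xi) conj (Psi xi)]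
    ([wavelet_coefficient]).  Plancherel's formula in [b], Tonelli's theorem and
    the substitution [u = a xi], under which [da / |a|] becomes [du / |u|], give

       admissibility integral = Q * |psi|_2^2, with Q = \int |Phi u|^2 / |u| du

    ([admissible_integralE]), while [Cpsi = |Calpha|^2 Q] ([CpsiE]).  As the
    squared norm of [psi] is finite and nonzero, both are finite together.

    For fixed [a] the function to which Plancherel's formula is applied is a
    product of two square-integrable functions: it is integrable, and its
    square-integrability is precisely what is at stake.  The formula is hence
    established on all of L^1, as an equality in [0, +oo]
    ([plancherel_kernel]), and only afterwards extended to L^2.

    On the line, the squared norm of a transform is determined by the Gram
    function of its kernel ([eq_sqint_transform_gram]).  Regularizing the
    Fourier kernel by a sinc amounts to averaging the function over short
    intervals; both kernels have explicit Gram functions, proportional to the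
    length of the intersection of two intervals ([sqint_transform_sinc]).  When
    the intervals shrink, Lebesgue's differentiation theorem and Fatou's lemma
    give the two inequalities ([plancherel_fourier_line]).  Products of kernels
    give all dimensions ([plancherel_kernel_prod]), and chirps are harmless
    ([plancherel_kernel_modulation]).  The constant in front is carried along as
    an unknown positive number; it cancels at the end. *)

Local Open Scope classical_set_scope.
Local Open Scope ring_scope.
Local Open Scope complex_scope.

Local Notation Re := complex.Re.
Local Notation Im := complex.Im.

(** * Complex-valued functions: measurability and integration *)

Section complex_numbers.
Context {R : realType}.
Implicit Types (z w : R[i]) (x y : R).

Lemma ReD z w : Re (z + w) = Re z + Re w. Proof. by case: z w => [a b] [c d]. Qed.
Lemma ImD z w : Im (z + w) = Im z + Im w. Proof. by case: z w => [a b] [c d]. Qed.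
Lemma ReN z : Re (- z) = - Re z. Proof. by case: z. Qed.
Lemma ImN z : Im (- z) = - Im z. Proof. by case: z. Qed.
Lemma ReM z w : Re (z * w) = Re z * Re w - Im z * Im w.
Proof. by case: z w => [a b] [c d]. Qed.
Lemma ImM z w : Im (z * w) = Re z * Im w + Im z * Re w.
Proof. by case: z w => [a b] [c d]. Qed.
Lemma ReJ z : Re (conjc z) = Re z. Proof. by case: z. Qed.
Lemma ImJ z : Im (conjc z) = - Im z. Proof. by case: z. Qed.

Definition ReImE := (ReD, ImD, ReN, ImN, ReM, ImM, ReJ, ImJ).

Lemma complex_ext z w : Re z = Re w -> Im z = Im w -> z = w.
Proof. by case: z w => [a b] [c d] /= -> ->. Qed.

Lemma normc_sqr z : normc z ^+ 2 = Re z ^+ 2 + Im z ^+ 2.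
Proof. by case: z => a b /=; rewrite sqr_sqrtr// addr_ge0// sqr_ge0. Qed.

Lemma normcE z : normc z = Num.sqrt (Re z ^+ 2 + Im z ^+ 2).
Proof. by case: z. Qed.

Lemma normc_ge0 z : 0 <= normc z.
Proof. by case: z => a b /=; exact: sqrtr_ge0. Qed.

Lemma Re_le_normc z : `|Re z| <= normc z.
Proof.
rewrite normcE -(sqrtr_sqr (Re z)) ler_wsqrtr// lerDl; exact: sqr_ge0.
Qed.

Lemma Im_le_normc z : `|Im z| <= normc z.
Proof.
rewrite normcE -(sqrtr_sqr (Im z)) ler_wsqrtr// lerDr; exact: sqr_ge0.
Qed.

Lemma normc_le_ReIm z : normc z <= `|Re z| + `|Im z|.
Proof.
rewrite normcE -[leRHS]ger0_norm ?addr_ge0// -sqrtr_sqr ler_wsqrtr//.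
rewrite sqrrD !real_normK ?num_real// -addrA lerD2l lerDr.
by rewrite mulrn_wge0// mulr_ge0.
Qed.

Lemma normcJ z : normc (conjc z) = normc z.
Proof. by rewrite !normcE ReJ ImJ sqrrN. Qed.

Lemma normc_opp z : normc (- z) = normc z.
Proof. by rewrite !normcE ReN ImN !sqrrN. Qed.

Lemma normc_real x : normc x%:C = `|x|.
Proof. by rewrite /= expr0n/= addr0 sqrtr_sqr. Qed.

Lemma normc_mul z w : normc (z * w) = normc z * normc w.
Proof. exact: normcM. Qed.

Lemma normc_add z w : normc (z + w) <= normc z + normc w.
Proof. exact: le_normcD. Qed.

Lemma normc_dist z w : `|normc z - normc w| <= normc (z - w).
Proof.
rewrite ler_norml; apply/andP; split.
- rewrite lerNl opprB lerBlDr -(normc_opp (z - w)) opprB.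
  by apply: le_trans (normc_add _ _); rewrite subrK.
- by rewrite lerBlDr; apply: le_trans (normc_add _ _); rewrite subrK.
Qed.

Lemma normc_add_sqr z w :
  normc (z + w) ^+ 2 <= 2 * normc z ^+ 2 + 2 * normc w ^+ 2.
Proof.
rewrite !normc_sqr !ReImE -subr_ge0.
have -> : 2 * (Re z ^+ 2 + Im z ^+ 2) + 2 * (Re w ^+ 2 + Im w ^+ 2) -
  ((Re z + Re w) ^+ 2 + (Im z + Im w) ^+ 2) =
  (Re z - Re w) ^+ 2 + (Im z - Im w) ^+ 2 by ring.
by rewrite addr_ge0// sqr_ge0.
Qed.

Lemma normc_eq0 z : (normc z == 0) = (z == 0).
Proof. by apply/eqP/eqP => [/eq0_normc//|->]; rewrite normc0. Qed.

Lemma mulc_conj z : z * conjc z = (normc z ^+ 2)%:C.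
Proof.
apply: complex_ext; rewrite normc_sqr !ReImE /=; ring.
Qed.

Lemma normc_expi x : normc (expi x) = 1.
Proof. by rewrite normcE /= cos2Dsin2 sqrtr1. Qed.

Lemma expi0 : expi 0 = 1 :> R[i].
Proof. by rewrite /expi cos0 sin0. Qed.

Lemma expiD x y : expi (x + y) = expi x * expi y.
Proof. by apply: complex_ext; rewrite !ReImE /= ?cosD ?sinD //; ring. Qed.

Lemma expiN x : expi (- x) = conjc (expi x).
Proof. by apply: complex_ext; rewrite !ReImE /= ?cosN ?sinN. Qed.

End complex_numbers.

Section complex_measurability.
Context {d} {T : measurableType d} {R : realType}.
Implicit Types (f g : T -> R[i]) (u : T -> R).

Definition cmeasurable f :=
  measurable_fun setT (fun x => Re (f x)) /\
  measurable_fun setT (fun x => Im (f x)).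

Lemma cmeasurable_cst (z : R[i]) : cmeasurable (fun=> z).
Proof. by split; exact: measurable_cst. Qed.

Lemma cmeasurableD f g :
  cmeasurable f -> cmeasurable g -> cmeasurable (fun x => f x + g x).
Proof.
move=> [rf imf] [rg ig]; split.
- by under eq_fun do rewrite ReD; exact: measurable_funD.
- by under eq_fun do rewrite ImD; exact: measurable_funD.
Qed.

Lemma cmeasurableN f : cmeasurable f -> cmeasurable (fun x => - f x).
Proof.
move=> [rf imf]; split.
- by under eq_fun do rewrite ReN; exact: measurableT_comp.
- by under eq_fun do rewrite ImN; exact: measurableT_comp.
Qed.

Lemma cmeasurableB f g :
  cmeasurable f -> cmeasurable g -> cmeasurable (fun x => f x - g x).
Proof. by move=> mf mg; apply: cmeasurableD => //; exact: cmeasurableN. Qed.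

Lemma cmeasurableM f g :
  cmeasurable f -> cmeasurable g -> cmeasurable (fun x => f x * g x).
Proof.
move=> [rf imf] [rg ig]; split.
- under eq_fun do rewrite ReM.
  by apply: measurable_funB; exact: measurable_funM.
- under eq_fun do rewrite ImM.
  by apply: measurable_funD; exact: measurable_funM.
Qed.

Lemma cmeasurableJ f : cmeasurable f -> cmeasurable (fun x => conjc (f x)).
Proof.
move=> [rf imf]; split.
- by under eq_fun do rewrite ReJ.
- by under eq_fun do rewrite ImJ; exact: measurableT_comp.
Qed.

Lemma cmeasurable_real u :
  measurable_fun setT u -> cmeasurable (fun x => (u x)%:C).
Proof. by move=> mu; split => //; exact: measurable_cst. Qed.

Lemma cmeasurable_expi u :
  measurable_fun setT u -> cmeasurable (fun x => expi (u x)).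
Proof.
move=> mu; split.
- apply: measurableT_comp => //; apply: continuous_measurable_fun.
  exact: continuous_cos.
- apply: measurableT_comp => //; apply: continuous_measurable_fun.
  exact: continuous_sin.
Qed.

Lemma measurable_normc f :
  cmeasurable f -> measurable_fun setT (fun x => normc (f x)).
Proof.
move=> [rf imf]; under eq_fun do rewrite normcE.
apply: (measurableT_comp (continuous_measurable_fun (@sqrt_continuous R))).
by apply: measurable_funD; exact: measurable_funX.
Qed.

Lemma measurable_normc_sqr f :
  cmeasurable f -> measurable_fun setT (fun x => normc (f x) ^+ 2).
Proof. by move=> mf; apply: measurable_funX; exact: measurable_normc. Qed.

End complex_measurability.

Lemma cmeasurable_comp d1 d2 (T1 : measurableType d1) (T2 : measurableType d2)
    (R : realType) (f : T2 -> R[i]) (g : T1 -> T2) :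
  cmeasurable f -> measurable_fun setT g -> cmeasurable (fun x => f (g x)).
Proof.
move=> [rf imf] mg; split.
- exact: (measurableT_comp rf mg).
- exact: (measurableT_comp imf mg).
Qed.

Section complex_integral.
Context {d} {T : measurableType d} {R : realType}
  (mu : {measure set T -> \bar R}).
Implicit Types (f g : T -> R[i]) (u : T -> R).

Definition cint f : R[i] :=
  (\int[mu]_x Re (f x)) +i* (\int[mu]_x Im (f x)).

Definition cintegrable f :=
  cmeasurable f /\ (\int[mu]_x (normc (f x))%:E < +oo)%E.

Definition sqint f : \bar R := (\int[mu]_x (normc (f x) ^+ 2)%:E)%E.

Lemma sqint_ge0 f : (0 <= sqint f)%E.
Proof. by apply: integral_ge0 => x _; rewrite lee_fin sqr_ge0. Qed.

Lemma le_cintegrable f u : cmeasurable f -> measurable_fun setT u ->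
  (forall x, normc (f x) <= u x) -> (\int[mu]_x (u x)%:E < +oo)%E ->
  cintegrable f.
Proof.
move=> mf mu_ fu iu; split => //; apply: le_lt_trans iu.
apply: ge0_le_integral => //.
- by move=> x _; rewrite lee_fin normc_ge0.
- exact/measurable_EFinP/measurable_normc.
- exact/measurable_EFinP.
- by move=> x _; rewrite lee_fin.
Qed.

Lemma integrable_normc f : cintegrable f ->
  mu.-integrable setT (EFin \o (fun x => normc (f x))).
Proof.
move=> [mf fi]; apply/integrableP; split.
  exact/measurable_EFinP/measurable_normc.
by under eq_integral do rewrite /= ger0_norm ?normc_ge0//.
Qed.

Lemma integrable_Re f : cintegrable f ->
  mu.-integrable setT (EFin \o (fun x => Re (f x))).
Proof.
move=> fi; apply: le_integrable (integrable_normc fi) => //.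
  by apply/measurable_EFinP; case: fi => -[].
by move=> x _ /=; rewrite lee_fin (ger0_norm (normc_ge0 _)) Re_le_normc.
Qed.

Lemma integrable_Im f : cintegrable f ->
  mu.-integrable setT (EFin \o (fun x => Im (f x))).
Proof.
move=> fi; apply: le_integrable (integrable_normc fi) => //.
  by apply/measurable_EFinP; case: fi => -[].
by move=> x _ /=; rewrite lee_fin (ger0_norm (normc_ge0 _)) Im_le_normc.
Qed.

Lemma cintegrable_ReIm f :
  mu.-integrable setT (EFin \o (fun x => Re (f x))) ->
  mu.-integrable setT (EFin \o (fun x => Im (f x))) -> cintegrable f.
Proof.
move=> rf imf.
have mr : measurable_fun setT (fun x => Re (f x)).
  by apply/measurable_EFinP; exact: measurable_int rf.
have mi : measurable_fun setT (fun x => Im (f x)).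
  by apply/measurable_EFinP; exact: measurable_int imf.
apply: (@le_cintegrable _ (fun x => `|Re (f x)| + `|Im (f x)|)) => //.
- by apply: measurable_funD; exact: measurableT_comp.
- by move=> x; exact: normc_le_ReIm.
- under eq_integral do rewrite EFinD.
  rewrite ge0_integralD//=; [|by apply/measurable_EFinP; exact: measurableT_comp..].
  move/integrableP : rf => [_ rf]; move/integrableP : imf => [_ imf].
  exact: lte_add_pinfty.
Qed.

Lemma cintegrableD f g :
  cintegrable f -> cintegrable g -> cintegrable (fun x => f x + g x).
Proof.
move=> fi gi; apply: cintegrable_ReIm.
- rewrite /comp; under eq_fun do rewrite ReD EFinD.
  by apply: integrableD => //; exact: integrable_Re.
- rewrite /comp; under eq_fun do rewrite ImD EFinD.
  by apply: integrableD => //; exact: integrable_Im.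
Qed.

Lemma cintegrableZ (c : R[i]) f :
  cintegrable f -> cintegrable (fun x => c * f x).
Proof.
move=> [mf fi]; split; first by apply: cmeasurableM => //; exact: cmeasurable_cst.
under eq_integral do rewrite normc_mul EFinM.
rewrite ge0_integralZl//=.
- by rewrite lte_mul_pinfty// lee_fin normc_ge0.
- exact/measurable_EFinP/measurable_normc.
- by move=> x _; rewrite lee_fin normc_ge0.
- by rewrite lee_fin normc_ge0.
Qed.

Lemma cintD f g : cintegrable f -> cintegrable g ->
  cint (fun x => f x + g x) = cint f + cint g.
Proof.
move=> fi gi; apply: complex_ext => /=.
- under eq_Rintegral do rewrite ReD.
  by rewrite RintegralD//; exact: integrable_Re.
- under eq_Rintegral do rewrite ImD.
  by rewrite RintegralD//; exact: integrable_Im.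
Qed.

Lemma cintZ (c : R[i]) f : cintegrable f ->
  cint (fun x => c * f x) = c * cint f.
Proof.
move=> fi; have [rf imf] := (integrable_Re fi, integrable_Im fi).
have Zi (k : R) h : mu.-integrable setT (EFin \o h) ->
  mu.-integrable setT (EFin \o (fun x => k * h x)).
  by move=> hi; apply: eq_integrable (integrableZl _ k hi).
apply: complex_ext => /=; rewrite !ReImE /=.
- under eq_Rintegral do rewrite ReM.
  by rewrite RintegralB ?RintegralZl//; exact: Zi.
- under eq_Rintegral do rewrite ImM.
  by rewrite RintegralD ?RintegralZl//; exact: Zi.
Qed.

Lemma cintegrableN f : cintegrable f -> cintegrable (fun x => - f x).
Proof.
move=> /(cintegrableZ (-1)); congr cintegrable.
by apply/funext => x; rewrite mulN1r.
Qed.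

Lemma cintN f : cintegrable f -> cint (fun x => - f x) = - cint f.
Proof.
move=> fi; rewrite -mulN1r -cintZ//; congr cint.
by apply/funext => x; rewrite mulN1r.
Qed.

Lemma cintegrableB f g :
  cintegrable f -> cintegrable g -> cintegrable (fun x => f x - g x).
Proof. by move=> fi gi; apply: cintegrableD => //; exact: cintegrableN. Qed.

Lemma cintB f g : cintegrable f -> cintegrable g ->
  cint (fun x => f x - g x) = cint f - cint g.
Proof. by move=> fi gi; rewrite cintD ?cintN//; exact: cintegrableN. Qed.

Lemma cintegrableJ f : cintegrable f -> cintegrable (fun x => conjc (f x)).
Proof.
move=> [mf fi]; split; first exact: cmeasurableJ.
by under eq_integral do rewrite normcJ.
Qed.

Lemma cintJ f : cintegrable f -> cint (fun x => conjc (f x)) = conjc (cint f).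
Proof.
move=> fi; apply: complex_ext => /=.
- by under eq_Rintegral do rewrite ReJ.
- under eq_Rintegral do rewrite ImJ -mulN1r.
  by rewrite RintegralZl// ?mulN1r//; exact: integrable_Im.
Qed.

Lemma eq_cint f g : f =1 g -> cint f = cint g.
Proof. by move=> /funext ->. Qed.

Lemma cint_real u : cint (fun x => (u x)%:C) = (\int[mu]_x u x)%:C.
Proof. by apply: complex_ext => //=; rewrite Rintegral_cst// mul0r. Qed.

(** Multiplying by a unimodular constant makes the integral a nonnegative
    real, which is then the integral of a real part. *)
Lemma normc_cint f : cintegrable f ->
  ((normc (cint f))%:E <= \int[mu]_x (normc (f x))%:E)%E.
Proof.
move=> fi; set z := cint f.
have [z0|z0] := eqVneq z 0.
  by rewrite z0 normc0; apply: integral_ge0 => x _; rewrite lee_fin normc_ge0.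
have nz0 : normc z != 0 by rewrite normc_eq0.
pose c : R[i] := (normc z)^-1%:C * conjc z.
have nc : normc c = 1.
  by rewrite normc_mul normc_real normcJ ger0_norm ?invr_ge0 ?normc_ge0// mulVf.
have cz : c * z = (normc z)%:C.
  rewrite /c -mulrA [conjc _ * _]mulrC mulc_conj -rmorphM/=.
  by rewrite expr2 mulrA mulVf// mul1r.
have cE : \int[mu]_x Re (c * f x) = normc z.
  by have := cintZ c fi; rewrite -/z cz => /(congr1 (@complex.Re R)).
have cfi := cintegrableZ c fi.
rewrite -(ger0_norm (normc_ge0 z)) -cE.
apply: (@le_trans _ _ (\int[mu]_x `|Re (c * f x)|)%:E).
  by rewrite lee_fin; apply: le_normr_Rintegral => //; exact: integrable_Re.
rewrite /Rintegral fineK; last first.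
  by apply: integrable_fin_num => //; apply: integrable_norm; exact: integrable_Re.
apply: ge0_le_integral => //.
- apply/measurable_EFinP; apply: measurableT_comp => //.
  by case: cfi => -[].
- by apply/measurable_EFinP/measurable_normc; case: fi.
- by move=> x _; rewrite lee_fin (le_trans (Re_le_normc _))// normc_mul nc mul1r.
Qed.

Lemma ae_eq_cint f g : cmeasurable f -> cmeasurable g ->
  {ae mu, forall x, f x = g x} -> cint f = cint g.
Proof.
move=> [rf imf] [rg ig] fg; apply: complex_ext => /=; rewrite /Rintegral; congr fine.
- apply: ae_eq_integral => //; [exact/measurable_EFinP|exact/measurable_EFinP|].
  by apply: filterS fg => x -> _.
- apply: ae_eq_integral => //; [exact/measurable_EFinP|exact/measurable_EFinP|].
  by apply: filterS fg => x -> _.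
Qed.

Lemma measurable_sqint_integrand f : cmeasurable f ->
  measurable_fun setT (fun x => (normc (f x) ^+ 2)%:E).
Proof. by move=> mf; exact/measurable_EFinP/measurable_normc_sqr. Qed.

Lemma le_integral_normc_mul f g : cmeasurable f -> cmeasurable g ->
  (\int[mu]_x (normc (f x * g x))%:E <=
   (2^-1)%:E * (sqint f + sqint g))%E.
Proof.
move=> mf mg; have mf2 := measurable_sqint_integrand mf.
have mg2 := measurable_sqint_integrand mg.
rewrite -ge0_integralD//; [|by move=> x _; rewrite lee_fin sqr_ge0..].
rewrite -ge0_integralZl//; last 2 first.
- exact: emeasurable_funD.
- by move=> x _; rewrite lee_fin addr_ge0// sqr_ge0.
apply: ge0_le_integral => //.
- by move=> x _; rewrite lee_fin normc_ge0.
- exact/measurable_EFinP/measurable_normc/cmeasurableM.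
- by apply: measurable_funeM; exact: emeasurable_funD.
- move=> x _; rewrite -EFinD -EFinM lee_fin normc_mul.
  set a := normc _; set b := normc _.
  have : 0 <= (a - b) ^+ 2 by exact: sqr_ge0.
  by rewrite sqrrB; lra.
Qed.

Lemma cintegrable_mul f g : cmeasurable f -> cmeasurable g ->
  (sqint f < +oo)%E -> (sqint g < +oo)%E -> cintegrable (fun x => f x * g x).
Proof.
move=> mf mg fi gi; split; first exact: cmeasurableM.
apply: le_lt_trans (le_integral_normc_mul mf mg) _.
by rewrite lte_mul_pinfty ?lee_fin//; exact: lte_add_pinfty.
Qed.

Lemma sqintZ (c : R[i]) f : cmeasurable f ->
  sqint (fun x => c * f x) = ((normc c ^+ 2)%:E * sqint f)%E.
Proof.
move=> mf; rewrite -ge0_integralZl ?lee_fin ?sqr_ge0//.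
- by apply: eq_integral => x _; rewrite normc_mul exprMn EFinM.
- exact: measurable_sqint_integrand.
- by move=> x _; rewrite lee_fin sqr_ge0.
Qed.

Lemma sqintJ f : sqint (fun x => conjc (f x)) = sqint f.
Proof. by apply: eq_integral => x _; rewrite normcJ. Qed.

End complex_integral.

Section cauchy_schwarz.
Context {d} {T : measurableType d} {R : realType} (mu : {measure set T -> \bar R}).

(** A positive bound [G] stands for the squared norm of [g]; this excludes the
    indeterminate product of [+oo] and [0]. *)
Lemma cauchy_schwarz (f g : T -> R[i]) (G : R) :
  cmeasurable f -> cmeasurable g -> 0 < G -> (sqint mu g <= G%:E)%E ->
  ((normc (cint mu (fun x => f x * g x)) ^+ 2)%:E <= sqint mu f * G%:E)%E.
Proof.
move=> mf mg G0 gG.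
case FE : (sqint mu f) => [F| |]; last 2 first.
- by rewrite gt0_mulye ?leey// lte_fin.
- by have := sqint_ge0 mu f; rewrite FE.
rewrite -EFinM lee_fin; set b := normc _.
have b0 : 0 <= b by exact: normc_ge0.
have [->|bn0] := eqVneq b 0.
  by rewrite expr0n/= mulr_ge0 ?(ltW G0)// -lee_fin -FE sqint_ge0.
have bgt0 : 0 < b by rewrite lt_neqAle eq_sym bn0.
have fgi : cintegrable mu (fun x => f x * g x).
  apply: cintegrable_mul => //; first by rewrite FE ltry.
  exact: le_lt_trans gG (ltry _).
(* the inequality [2 b <= t F + G / t] is optimal at [t = G / b] *)
pose t := Num.sqrt (G / b).
have t0 : 0 < t by rewrite sqrtr_gt0 divr_gt0.
have tt : t ^+ 2 = G / b by rewrite sqr_sqrtr// divr_ge0// ltW.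
have mtf : cmeasurable (fun x => t%:C * f x).
  by apply: cmeasurableM => //; exact: cmeasurable_cst.
have mtg : cmeasurable (fun x => t^-1%:C * g x).
  by apply: cmeasurableM => //; exact: cmeasurable_cst.
have : (b%:E <= (2^-1)%:E * ((t ^+ 2)%:E * F%:E + (t^-1 ^+ 2)%:E * G%:E))%E.
  apply: (le_trans (normc_cint fgi)).
  have sqt (x : R) : x ^+ 2 = normc x%:C ^+ 2.
    by rewrite normc_real real_normK ?num_real.
  pose tf x := t%:C * f x; pose tg x := t^-1%:C * g x.
  apply: (@le_trans _ _ ((2^-1)%:E * (sqint mu tf + sqint mu tg))%E); last first.
    rewrite lee_wpmul2l ?lee_fin// !sqintZ// -(sqt t) -(sqt t^-1) FE leeD2l//.
    by rewrite lee_wpmul2l ?lee_fin ?sqr_ge0.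
  apply: le_trans (le_integral_normc_mul mu mtf mtg).
  apply: ge0_le_integral => //.
  - by move=> x _; rewrite lee_fin normc_ge0.
  - by apply/measurable_EFinP/measurable_normc/cmeasurableM.
  - by apply/measurable_EFinP/measurable_normc/cmeasurableM.
  - move=> x _; rewrite lee_fin [X in _ <= normc X](_ : _ = f x * g x)//.
    rewrite mulrACA -rmorphM/= mulfV ?gt_eqF// mul1r//.
rewrite -[leRHS]/((2^-1 * (t ^+ 2 * F + t^-1 ^+ 2 * G))%:E) lee_fin exprVn tt => H1.
have {}H1 : b <= 2^-1 * (G / b * F + b).
  by apply: le_trans H1 _; rewrite invf_div divfK// gt_eqF.
have : 2^-1 * (G / b * F + b) * b = 2^-1 * (G * F + b ^+ 2) by field.
have := ler_wpM2r b0 H1; rewrite -expr2 => H2 H3; rewrite H3 in H2.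
by rewrite mulrC; lra.
Qed.

End cauchy_schwarz.

Section complex_fubini.
Context {d1 d2} {T1 : measurableType d1} {T2 : measurableType d2} {R : realType}.
Context (m1 : {sigma_finite_measure set T1 -> \bar R}).
Context (m2 : {sigma_finite_measure set T2 -> \bar R}).
Implicit Types f : T1 * T2 -> R[i].

Lemma ge0_measurable_integral1 (u : T1 * T2 -> \bar R) :
  measurable_fun setT u -> (forall z, 0 <= u z)%E ->
  measurable_fun setT (fun x => \int[m2]_y u (x, y))%E.
Proof. exact: measurable_fun_fubini_tonelli_F. Qed.

Lemma ge0_measurable_integral2 (u : T1 * T2 -> \bar R) :
  measurable_fun setT u -> (forall z, 0 <= u z)%E ->
  measurable_fun setT (fun y => \int[m1]_x u (x, y))%E.
Proof. exact: measurable_fun_fubini_tonelli_G. Qed.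

Lemma measurable_Rintegral_param (u : T1 * T2 -> R) : measurable_fun setT u ->
  measurable_fun setT (fun x => \int[m2]_y u (x, y)).
Proof.
rewrite /Rintegral.
move=> mu; have meu : measurable_fun setT (EFin \o u) by exact/measurable_EFinP.
apply: (measurableT_comp (measurable_realfun.fine_measurable measurableT)).
under eq_fun do rewrite integralE.
have mp : measurable_fun setT (EFin \o u)^\+%E by exact: measurable_funepos.
have mn : measurable_fun setT (EFin \o u)^\-%E by exact: measurable_funeneg.
apply: emeasurable_funB.
- rewrite [X in measurable_fun _ X](_ : _ = fubini_F m2 (EFin \o u)^\+%E); last first.
    by apply/funext => x; apply: eq_integral => y _; rewrite !funeposE.
  exact: measurable_fun_fubini_tonelli_F.
- rewrite [X in measurable_fun _ X](_ : _ = fubini_F m2 (EFin \o u)^\-%E); last first.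
    by apply/funext => x; apply: eq_integral => y _; rewrite !funenegE.
  exact: measurable_fun_fubini_tonelli_F.
Qed.

Lemma cmeasurable_cint f : cmeasurable f ->
  cmeasurable (fun x => cint m2 (fun y => f (x, y))).
Proof.
move=> [rf imf]; split => /=.
- exact: (measurable_Rintegral_param rf).
- exact: (measurable_Rintegral_param imf).
Qed.

Lemma cintegrable_ae_slice f : cintegrable (m1 \x m2)%E f ->
  {ae m1, forall x, cintegrable m2 (fun y => f (x, y))}.
Proof.
move=> fi.
have := integrable_ae measurableT (integrable_fubini_F (integrable_normc fi)).
apply: filterS => x /(_ I) xf; split.
  by apply: cmeasurable_comp (proj1 fi) _; exact: pair1_measurable.
by move: xf; rewrite /fubini_F /= ge0_fin_numE//; apply: integral_ge0 => y _; rewrite lee_fin normc_ge0.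
Qed.

Lemma cint_fubini f : cintegrable (m1 \x m2)%E f ->
  cint (m1 \x m2)%E f = cint m1 (fun x => cint m2 (fun y => f (x, y))).
Proof.
move=> fi; apply: complex_ext => /=.
- rewrite /Rintegral -(integral12_prod_meas1 (integrable_Re fi)); congr fine.
  have := integrable_ae measurableT (integrable_fubini_F (integrable_Re fi)).
  move=> aefin; apply: ae_eq_integral => //.
  + exact: measurable_int (integrable_fubini_F (integrable_Re fi)).
  + apply/measurable_EFinP; apply: (measurable_Rintegral_param (u := fun z => Re (f z))).
    by case: fi => -[].
  + by apply: filterS aefin => x /(_ I) xf _ /=; rewrite /fubini_F fineK.
- rewrite /Rintegral -(integral12_prod_meas1 (integrable_Im fi)); congr fine.
  have := integrable_ae measurableT (integrable_fubini_F (integrable_Im fi)).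
  move=> aefin; apply: ae_eq_integral => //.
  + exact: measurable_int (integrable_fubini_F (integrable_Im fi)).
  + apply/measurable_EFinP; apply: (measurable_Rintegral_param (u := fun z => Im (f z))).
    by case: fi => -[].
  + by apply: filterS aefin => x /(_ I) xf _ /=; rewrite /fubini_F fineK.
Qed.

Lemma cintegrable_cint f : cintegrable (m1 \x m2)%E f ->
  cintegrable m1 (fun x => cint m2 (fun y => f (x, y))).
Proof.
move=> fi; split; first exact: cmeasurable_cint (proj1 fi).
apply: le_lt_trans (proj2 fi).
have mf : measurable_fun setT (fun z => (normc (f z))%:E).
  by apply/measurable_EFinP/measurable_normc; case: fi.
rewrite (fubini_tonelli1 _ mf); last by move=> z; rewrite lee_fin normc_ge0.
apply: ae_ge0_le_integral => //.
- by move=> x _; rewrite lee_fin normc_ge0.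
- by apply/measurable_EFinP/measurable_normc/cmeasurable_cint; case: fi.
- by move=> x _; apply: integral_ge0 => y _; rewrite lee_fin normc_ge0.
- by apply: measurable_fun_fubini_tonelli_F => // z; rewrite lee_fin normc_ge0.
- by apply: filterS (cintegrable_ae_slice fi) => x xi _; exact: normc_cint.
Qed.

Lemma cintegrable_prod (f : T1 -> R[i]) (g : T2 -> R[i]) :
  cintegrable m1 f -> cintegrable m2 g ->
  cintegrable (m1 \x m2)%E (fun z => f z.1 * g z.2).
Proof.
move=> [mf fi] [mg gi].
have mfg : cmeasurable (fun z : T1 * T2 => f z.1 * g z.2).
  by apply: cmeasurableM; [exact: cmeasurable_comp mf measurable_fst|
                           exact: cmeasurable_comp mg measurable_snd].
split => //.
rewrite fubini_tonelli1/=; last 2 first.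
- exact/measurable_EFinP/measurable_normc.
- by move=> z; rewrite lee_fin normc_ge0.
rewrite /fubini_F/=.
under eq_integral => x _.
  under eq_integral => y _ do rewrite normc_mul EFinM.
  rewrite ge0_integralZl//=; last 3 first.
  - exact/measurable_EFinP/measurable_normc.
  - by move=> y _; rewrite lee_fin normc_ge0.
  - by rewrite lee_fin normc_ge0.
  over.
have f0 : (0 <= \int[m1]_x (normc (f x))%:E)%E.
  by apply: integral_ge0 => x _; rewrite lee_fin normc_ge0.
have g0 : (0 <= \int[m2]_y (normc (g y))%:E)%E.
  by apply: integral_ge0 => y _; rewrite lee_fin normc_ge0.
rewrite ge0_integralZr//=; first by rewrite lte_mul_pinfty// ge0_fin_numE.
- exact/measurable_EFinP/measurable_normc.
- by move=> y _; rewrite lee_fin normc_ge0.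
Qed.

End complex_fubini.

Section complex_fubini_swap.
Context {d1 d2} {T1 : measurableType d1} {T2 : measurableType d2} {R : realType}.
Context (m1 : {sigma_finite_measure set T1 -> \bar R}).
Context (m2 : {sigma_finite_measure set T2 -> \bar R}).
Implicit Types f : T1 * T2 -> R[i].

Lemma cintegrable_swap f : cintegrable (m1 \x m2)%E f ->
  cintegrable (m2 \x m1)%E (fun z => f (z.2, z.1)).
Proof.
move=> [mf fi].
have mf' : cmeasurable (fun z : T2 * T1 => f (z.2, z.1)).
  by apply: cmeasurable_comp mf _; exact: measurable_swap.
split => //; apply: le_lt_trans fi.
rewrite fubini_tonelli1/=; last 2 first.
- exact/measurable_EFinP/measurable_normc.
- by move=> z; rewrite lee_fin normc_ge0.
rewrite fubini_tonelli2//=.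
- exact/measurable_EFinP/measurable_normc.
- by move=> z; rewrite lee_fin normc_ge0.
Qed.

Lemma cint_fubini_swap f : cintegrable (m1 \x m2)%E f ->
  cint m1 (fun x => cint m2 (fun y => f (x, y))) =
  cint m2 (fun y => cint m1 (fun x => f (x, y))).
Proof.
move=> fi; rewrite -cint_fubini//.
have fi' := cintegrable_swap fi.
rewrite -(cint_fubini fi').
have swap u : (m1 \x m2)%E.-integrable setT (EFin \o u) ->
   (m2 \x m1)%E.-integrable setT (EFin \o (fun z => u (z.2, z.1))) ->
   \int[(m1 \x m2)%E]_z u z = \int[(m2 \x m1)%E]_z u (z.2, z.1).
  move=> ui ui'; rewrite /Rintegral; congr fine.
  rewrite -(integral21_prod_meas1 ui) -(integral12_prod_meas1 ui').
  by [].
apply: complex_ext => /=; apply: swap.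
- exact: integrable_Re.
- exact: (integrable_Re fi').
- exact: integrable_Im.
- exact: (integrable_Im fi').
Qed.

End complex_fubini_swap.

Section product_measure.
Context {d1 d2} {T1 : measurableType d1} {T2 : measurableType d2} {R : realType}.
Context (m1 : {sigma_finite_measure set T1 -> \bar R}).
Context (m2 : {sigma_finite_measure set T2 -> \bar R}).

(** A name for the product measure under which it is registered as
    sigma-finite, so that products can be iterated. *)
Definition prodm : set (T1 * T2) -> \bar R := (m1 \x m2)%E.

HB.instance Definition _ := Measure.copy prodm (m1 \x m2)%E.

Let prodm_sigma_finite : sigma_finite setT prodm.
Proof.
have /sigma_finiteP[F [TF ndF Foo]] := sigma_finiteT m1.
have /sigma_finiteP[G [TG ndG Goo]] := sigma_finiteT m2.
exists (fun n => F n `*` G n).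
  apply/seteqP; split => // -[x y] _.
  have [i _ Fi] : (\bigcup_n F n) x by rewrite -TF.
  have [j _ Gj] : (\bigcup_n G n) y by rewrite -TG.
  exists (maxn i j) => //; split => /=.
  - by move: x Fi; exact/subsetPset/ndF/leq_maxl.
  - by move: y Gj; exact/subsetPset/ndG/leq_maxr.
move=> k; have [mF Fk] := Foo k; have [mG Gk] := Goo k.
split; first exact: measurableX.
by rewrite /prodm product_measure1E// lte_mul_pinfty// ge0_fin_numE.
Qed.

HB.instance Definition _ := @Measure_isSigmaFinite.Build _ _ _ prodm
  prodm_sigma_finite.

Lemma integral_prodm (f : T1 * T2 -> \bar R) : measurable_fun setT f ->
  (forall z, 0 <= f z)%E ->
  (\int[prodm]_z f z = \int[m1]_x \int[m2]_y f (x, y))%E.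
Proof. exact: fubini_tonelli1. Qed.

End product_measure.

(** * Integral transforms that are isometries up to a constant *)

Section transform.
Context {d1 d2} {T1 : measurableType d1} {T2 : measurableType d2} {R : realType}.
Context (m1 : {sigma_finite_measure set T1 -> \bar R}).
Context (m2 : {sigma_finite_measure set T2 -> \bar R}).
Implicit Types (k : T1 -> T2 -> R[i]) (w : T1 -> R[i]).

Definition transform k w (y : T2) : R[i] := cint m1 (fun x => w x * k x y).

Definition kernel_measurable k :=
  cmeasurable (fun z : T1 * T2 => k z.1 z.2).

(** Plancherel's formula on all of L^1, as an identity between possibly infinite
    quantities.  The value +oo makes the property stable under products of
    kernels, since the slices of an integrable function need not be
    square-integrable. *)
Definition plancherel_kernel k (c : R) :=
  [/\ kernel_measurable k,
      forall x y, normc (k x y) = 1 &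
      forall w, cintegrable m1 w ->
        sqint m2 (transform k w) = (c%:E * sqint m1 w)%E].

Lemma kernel_measurable1 k y : kernel_measurable k ->
  cmeasurable (fun x => k x y).
Proof.
by move=> mk; apply: (cmeasurable_comp mk (g := fun x => (x, y))); exact: measurable_pair2.
Qed.

Lemma kernel_measurable2 k x : kernel_measurable k -> cmeasurable (k x).
Proof.
by move=> mk; apply: (cmeasurable_comp mk (g := fun y => (x, y))); exact: pair1_measurable.
Qed.

Lemma cintegrable_transform k w y : kernel_measurable k ->
  (forall x y, normc (k x y) <= 1) -> cintegrable m1 w ->
  cintegrable m1 (fun x => w x * k x y).
Proof.
move=> mk k1 [mw wi]; apply: le_cintegrable wi.
- by apply: cmeasurableM => //; exact: kernel_measurable1.
- exact: measurable_normc.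
- by move=> x; rewrite normc_mul ler_piMr// normc_ge0.
Qed.

Lemma cmeasurable_transform k w : kernel_measurable k -> cmeasurable w ->
  cmeasurable (transform k w).
Proof.
move=> mk mw; apply: (cmeasurable_cint m1 (f := fun z : T2 * T1 => w z.2 * k z.2 z.1)).
apply: cmeasurableM.
- exact: cmeasurable_comp mw measurable_snd.
- by apply: (cmeasurable_comp mk (g := fun z : T2 * T1 => (z.2, z.1))); exact: measurable_swap.
Qed.

Lemma transformD k w v y : kernel_measurable k ->
  (forall x y, normc (k x y) <= 1) -> cintegrable m1 w -> cintegrable m1 v ->
  transform k (fun x => w x + v x) y = transform k w y + transform k v y.
Proof.
move=> mk k1 wi vi; rewrite -cintD; [|exact: cintegrable_transform..].
by apply: eq_cint => x; rewrite mulrDl.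
Qed.

Lemma transformB k w v y : kernel_measurable k ->
  (forall x y, normc (k x y) <= 1) -> cintegrable m1 w -> cintegrable m1 v ->
  transform k (fun x => w x - v x) y = transform k w y - transform k v y.
Proof.
move=> mk k1 wi vi; rewrite -cintB; [|exact: cintegrable_transform..].
by apply: eq_cint => x; rewrite mulrBl.
Qed.

(** The squared norm of a transform only depends on the Gram function
    [G x x' = \int k x y * conjc (k x' y) dy] of the kernel: expand the square and
    integrate over [y] first. *)
Lemma sqint_transform_gram k (M : R) w : kernel_measurable k ->
  (forall x y, normc (k x y) <= 1) ->
  (forall x, (sqint m2 (k x) <= M%:E)%E) -> cintegrable m1 w ->
  let G p := w p.1 * conjc (w p.2) * cint m2 (fun y => k p.1 y * conjc (k p.2 y)) in
  cintegrable (m1 \x m1)%E G /\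
  sqint m2 (transform k w) = (Re (cint (m1 \x m1)%E G))%:E.
Proof.
move=> mk k1 kM wi G.
have mw := proj1 wi.
pose m11 : {sigma_finite_measure set (T1 * T1)%type -> \bar R} := prodm m1 m1.
pose ww (p : T1 * T1) := w p.1 * conjc (w p.2).
have wwi : cintegrable m11 ww.
  by apply: (cintegrable_prod wi (g := fun x => conjc (w x))); exact: cintegrableJ.
pose H (z : T2 * (T1 * T1)) := ww z.2 * (k z.2.1 z.1 * conjc (k z.2.2 z.1)).
have mH : cmeasurable H.
  apply: cmeasurableM; first exact: cmeasurable_comp (proj1 wwi) measurable_snd.
  apply: cmeasurableM.
  - apply: (cmeasurable_comp mk (g := fun z : T2 * (T1 * T1) => (z.2.1, z.1))).
    apply/measurable_fun_pairP; split => //=.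
    + exact: (measurableT_comp measurable_fst measurable_snd).
    + exact: measurable_fst.
  - apply: cmeasurableJ.
    apply: (cmeasurable_comp mk (g := fun z : T2 * (T1 * T1) => (z.2.2, z.1))).
    apply/measurable_fun_pairP; split => //=.
    + exact: (measurableT_comp measurable_snd measurable_snd).
    + exact: measurable_fst.
have M0 : 0 <= M by rewrite -lee_fin (le_trans _ (kM point))// sqint_ge0.
have mkx x := kernel_measurable2 x mk.
have Hi : cintegrable (m2 \x m11)%E H.
  split => //.
  rewrite fubini_tonelli2/=; last 2 first.
  - exact/measurable_EFinP/measurable_normc.
  - by move=> z; rewrite lee_fin normc_ge0.
  rewrite /fubini_G.
  apply: (@le_lt_trans _ _ (\int[m11]_p (M%:E * (normc (ww p))%:E))%E).
    apply: ge0_le_integral => //.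
    - by move=> p _; apply: integral_ge0 => y _; rewrite lee_fin normc_ge0.
    - apply: (ge0_measurable_integral2 m2 (u := fun z => (normc (H z))%:E)).
        exact/measurable_EFinP/measurable_normc.
      by move=> z; rewrite lee_fin normc_ge0.
    - apply: measurable_funeM.
      by apply/measurable_EFinP/measurable_normc; case: wwi.
    move=> p _; rewrite muleC.
    under eq_integral do rewrite /H/= normc_mul EFinM.
    rewrite ge0_integralZl//=; last 3 first.
    - exact/measurable_EFinP/measurable_normc/cmeasurableM/cmeasurableJ.
    - by move=> y _; rewrite lee_fin normc_ge0.
    - by rewrite lee_fin normc_ge0.
    rewrite lee_wpmul2l ?lee_fin ?normc_ge0//.
    apply: le_trans (le_integral_normc_mul _ (mkx _) (cmeasurableJ (mkx _))) _.
    rewrite sqintJ; apply: (@le_trans _ _ ((2^-1)%:E * (M%:E + M%:E))%E).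
      by rewrite lee_wpmul2l ?lee_fin// leeD//; exact: kM.
    by rewrite -EFinD -EFinM lee_fin; lra.
  rewrite ge0_integralZl//=.
  - by rewrite lte_mul_pinfty//; case: wwi.
  - by apply/measurable_EFinP/measurable_normc; case: wwi.
  - by move=> p _; rewrite lee_fin normc_ge0.
have HE y : cint m11 (fun p => H (y, p)) =
    (normc (transform k w y) ^+ 2)%:C.
  have i1 := cintegrable_transform y mk k1 wi.
  have i2 := cintegrableJ i1.
  rewrite -mulc_conj /transform -cintJ//.
  have := cint_fubini (cintegrable_prod i1 i2).
  rewrite (_ : cint _ _ = cint m11 (fun p => H (y, p))); last first.
    by apply: eq_cint => p; rewrite /H /ww/= rmorphM/=; ring.
  move=> ->/=.
  under eq_cint => x do rewrite cintZ//.
  rewrite mulrC -cintZ//; apply: eq_cint => x; exact: mulrC.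
have GE : (fun p => cint m2 (fun y => H (y, p))) = G.
  apply/funext => p; rewrite /G -cintZ//.
  apply: cintegrable_mul => //; first exact: cmeasurableJ.
  - exact: le_lt_trans (kM _) (ltry _).
  - by rewrite sqintJ; exact: le_lt_trans (kM _) (ltry _).
split; first by rewrite -GE; exact: (cintegrable_cint (cintegrable_swap Hi)).
have := cint_fubini_swap Hi.
under eq_cint => y do rewrite HE.
rewrite cint_real GE.
move=> <- /=; rewrite /Rintegral fineK//.
have := integrable_Re (cintegrable_cint Hi).
move/(integrable_fin_num measurableT); congr (_ \is a fin_num).
apply: eq_integral => y _; congr EFin.
exact: (congr1 (@complex.Re R) (HE y)).
Qed.

End transform.

(** By the previous lemma; an oscillating kernel can be traded for one whose
    transform is understood. *)
Lemma eq_sqint_transform_gram d1 d2 d3 (T1 : measurableType d1)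
    (T2 : measurableType d2) (T3 : measurableType d3) (R : realType)
    (m1 : {sigma_finite_measure set T1 -> \bar R})
    (m2 : {sigma_finite_measure set T2 -> \bar R})
    (m3 : {sigma_finite_measure set T3 -> \bar R})
    (k : T1 -> T2 -> R[i]) (h : T1 -> T3 -> R[i]) (c M : R) (w : T1 -> R[i]) :
  kernel_measurable k -> kernel_measurable h ->
  (forall x y, normc (k x y) <= 1) -> (forall x y, normc (h x y) <= 1) ->
  (forall x, (sqint m2 (k x) <= M%:E)%E) ->
  (forall x, (sqint m3 (h x) <= M%:E)%E) ->
  (forall x x', cint m2 (fun y => k x y * conjc (k x' y)) =
    c%:C * cint m3 (fun y => h x y * conjc (h x' y))) ->
  cintegrable m1 w ->
  sqint m2 (transform m1 k w) = (c%:E * sqint m3 (transform m1 h w))%E.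
Proof.
move=> mk mh k1 h1 kM hM kh wi.
have [_ ->] := sqint_transform_gram mk k1 kM wi.
have [hi ->] := sqint_transform_gram mh h1 hM wi.
rewrite -EFinM; congr EFin.
under eq_cint => p do rewrite kh mulrCA.
by rewrite cintZ// ReM /= mul0r subr0.
Qed.

Section modulation.
Context {d1 d2} {T1 : measurableType d1} {T2 : measurableType d2} {R : realType}.
Context (m1 : {sigma_finite_measure set T1 -> \bar R}).
Context (m2 : {sigma_finite_measure set T2 -> \bar R}).

(** Factors of modulus 1 change neither of the two norms.  Chirps are such
    factors, and they make the Fourier kernel fractional. *)
Lemma plancherel_kernel_modulation (k : T1 -> T2 -> R[i]) (c : R)
    (a : T1 -> R) (b : T2 -> R) :
  measurable_fun setT a -> measurable_fun setT b ->
  plancherel_kernel m1 m2 k c ->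
  plancherel_kernel m1 m2 (fun x y => expi (a x) * k x y * expi (b y)) c.
Proof.
move=> ma mb [mk k1 kP]; split.
- apply: cmeasurableM.
    apply: cmeasurableM mk; apply: cmeasurable_expi.
    exact: measurableT_comp ma measurable_fst.
  by apply: cmeasurable_expi; exact: measurableT_comp mb measurable_snd.
- by move=> x y; rewrite !normc_mul !normc_expi k1 !mul1r.
move=> w [mw wi]; pose v x := expi (a x) * w x.
have vi : cintegrable m1 v.
  split; first by apply: cmeasurableM => //; exact: cmeasurable_expi.
  by under eq_integral do rewrite normc_mul normc_expi mul1r.
have -> : sqint m1 w = sqint m1 v.
  by apply: eq_integral => x _; rewrite normc_mul normc_expi mul1r.
have TE y : transform m1 (fun x y => expi (a x) * k x y * expi (b y)) w y =
    expi (b y) * transform m1 k v y.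
  rewrite /transform -cintZ; last first.
    by apply: cintegrable_transform => // x z; rewrite k1.
  by apply: eq_cint => x; rewrite /v; ring.
rewrite -(kP _ vi); apply: eq_integral => y _.
by rewrite TE normc_mul normc_expi mul1r.
Qed.

End modulation.

Section product_kernel.
Context {d1 d2 e1 e2} {T1 : measurableType d1} {T2 : measurableType d2}
  {S1 : measurableType e1} {S2 : measurableType e2} {R : realType}.
Context (m1 : {sigma_finite_measure set T1 -> \bar R})
  (m2 : {sigma_finite_measure set T2 -> \bar R})
  (n1 : {sigma_finite_measure set S1 -> \bar R})
  (n2 : {sigma_finite_measure set S2 -> \bar R}).
Implicit Types (k : T1 -> S1 -> R[i]) (h : T2 -> S2 -> R[i]).

(** Fubini in the first variable turns the transform of [w] into the second
    transform of a function [W s], for each fixed [s]; Tonelli then allows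
    the two one-variable formulas to be used one after the other. *)
Lemma plancherel_kernel_prod k h (a b : R) : 0 <= a -> 0 <= b ->
  plancherel_kernel m1 n1 k a -> plancherel_kernel m2 n2 h b ->
  plancherel_kernel (prodm m1 m2) (prodm n1 n2)
    (fun p q => k p.1 q.1 * h p.2 q.2) (a * b).
Proof.
move=> a0 b0 [mk k1 kP] [mh h1 hP]; split.
- apply: cmeasurableM.
  + apply: (cmeasurable_comp mk (g := fun z => (z.1.1, z.2.1))).
    apply/measurable_fun_pairP; split => //=.
    * exact: (measurableT_comp measurable_fst measurable_fst).
    * exact: (measurableT_comp measurable_fst measurable_snd).
  + apply: (cmeasurable_comp mh (g := fun z => (z.1.2, z.2.2))).
    apply/measurable_fun_pairP; split => //=.
    * exact: (measurableT_comp measurable_snd measurable_fst).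
    * exact: (measurableT_comp measurable_snd measurable_snd).
- by move=> x y; rewrite normc_mul k1 h1 mulr1.
move=> w wi.
have mw := proj1 wi.
have k1' x y : normc (k x y) <= 1 by rewrite k1.
pose W s y := transform m1 k (fun x => w (x, y)) s.
have mW : cmeasurable (fun z : S1 * T2 => W z.1 z.2).
  apply: (cmeasurable_cint m1 (f := fun z : (S1 * T2) * T1 => w (z.2, z.1.2) * k z.2 z.1.1)).
  apply: cmeasurableM.
  - apply: (cmeasurable_comp mw (g := fun z : (S1 * T2) * T1 => (z.2, z.1.2))).
    apply/measurable_fun_pairP; split => //=; first exact: measurable_snd.
    exact: (measurableT_comp measurable_snd measurable_fst).
  - apply: (cmeasurable_comp mk (g := fun z : (S1 * T2) * T1 => (z.2, z.1.1))).
    apply/measurable_fun_pairP; split => //=; first exact: measurable_snd.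
    exact: (measurableT_comp measurable_fst measurable_fst).
have wki s : cintegrable (m2 \x m1)%E (fun z => w (z.2, z.1) * k z.2 s).
  have [mw' wi'] := cintegrable_swap wi.
  apply: le_cintegrable wi'.
  - apply: cmeasurableM => //.
    by apply: (cmeasurable_comp (kernel_measurable1 s mk)); exact: measurable_snd.
  - exact: measurable_normc.
  - by move=> z; rewrite normc_mul k1 mulr1.
have Wi s : cintegrable m2 (W s) by exact: cintegrable_cint (wki s).
have slice : {ae m2, forall y, cintegrable m1 (fun x => w (x, y))}.
  exact: cintegrable_ae_slice (cintegrable_swap wi).
have TE s t : transform (prodm m1 m2) (fun p q => k p.1 q.1 * h p.2 q.2) w (s, t) =
    transform m2 h (W s) t.
  rewrite /transform/=.
  have wkhi : cintegrable (m2 \x m1)%E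
      (fun z => w (z.2, z.1) * (k z.2 s * h z.1 t)).
    apply: le_cintegrable (proj2 (wki s)).
    - rewrite (_ : (fun z => _) = fun z => w (z.2, z.1) * k z.2 s * h z.1 t).
        apply: cmeasurableM; first by case: (wki s).
        by apply: (cmeasurable_comp (kernel_measurable1 t mh)); exact: measurable_fst.
      by apply/funext => z; rewrite mulrA.
    - by apply: measurable_normc; case: (wki s).
    - by move=> z; rewrite !normc_mul h1 mulr1.
  have := cint_fubini (cintegrable_swap wkhi).
  rewrite (_ : cint _ _ = cint (prodm m1 m2) (fun x => w x * (k x.1 s * h x.2 t))); last first.
    by apply: eq_cint => -[x y].
  move=> ->.
  rewrite (cint_fubini_swap (cintegrable_swap wkhi)) /=.
  apply: ae_eq_cint.
  - exact: (cmeasurable_cint m1 (proj1 wkhi)).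
  - by apply: cmeasurableM (proj1 (Wi s)) _; exact: kernel_measurable1.
  - apply: filterS slice => y wy.
    rewrite [RHS]mulrC -cintZ; last exact: cintegrable_transform.
    by apply: eq_cint => x; ring.
have mT : cmeasurable (fun z : S1 * S2 => transform m2 h (W z.1) z.2).
  apply: (cmeasurable_cint m2 (f := fun z : (S1 * S2) * T2 => W z.1.1 z.2 * h z.2 z.1.2)).
  apply: cmeasurableM.
  - apply: (cmeasurable_comp mW (g := fun z : (S1 * S2) * T2 => (z.1.1, z.2))).
    apply/measurable_fun_pairP; split => //=; last exact: measurable_snd.
    exact: (measurableT_comp measurable_fst measurable_fst).
  - apply: (cmeasurable_comp mh (g := fun z : (S1 * S2) * T2 => (z.2, z.1.2))).
    apply/measurable_fun_pairP; split => //=; first exact: measurable_snd.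
    exact: (measurableT_comp measurable_snd measurable_fst).
have -> : sqint (prodm n1 n2) (transform (prodm m1 m2)
     (fun p q => k p.1 q.1 * h p.2 q.2) w) =
   (\int[n1]_s sqint n2 (transform m2 h (W s)))%E.
  rewrite /sqint (_ : (fun x => _) = fun z : S1 * S2 =>
     (normc (transform m2 h (W z.1) z.2) ^+ 2)%:E); last first.
    by apply/funext => -[s t]; rewrite TE.
  rewrite [LHS]fubini_tonelli1//.
  - exact: measurable_sqint_integrand.
  - by move=> z; rewrite lee_fin sqr_ge0.
under eq_integral do rewrite hP//.
have mW2 : measurable_fun setT (fun z : S1 * T2 => (normc (W z.1 z.2) ^+ 2)%:E).
  exact: measurable_sqint_integrand.
rewrite ge0_integralZl//; last 2 first.
- apply: (ge0_measurable_integral1 m2 mW2).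
  by move=> z; rewrite lee_fin sqr_ge0.
- by move=> s _; exact: sqint_ge0.
have mw2 : measurable_fun setT (fun z : T1 * T2 => (normc (w z) ^+ 2)%:E).
  exact: measurable_sqint_integrand.
rewrite mulrC EFinM -muleA; congr (_ * _)%E.
rewrite [LHS](fubini_tonelli (fun z : S1 * T2 => (normc (W z.1 z.2) ^+ 2)%:E))//; last first.
  by move=> z; rewrite lee_fin sqr_ge0.
rewrite [sqint (prodm m1 m2) w]fubini_tonelli2//; last first.
  by move=> z; rewrite lee_fin sqr_ge0.
have mslice : measurable_fun setT (fun y => \int[m1]_x (normc (w (x, y)) ^+ 2)%:E)%E.
  by apply: (ge0_measurable_integral2 m1 mw2) => z; rewrite lee_fin sqr_ge0.
rewrite /fubini_G -ge0_integralZl//; last first.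
  by move=> y _; apply: integral_ge0 => x _; rewrite lee_fin sqr_ge0.
apply: ge0_ae_eq_integral => //.
- by apply: (ge0_measurable_integral2 n1 mW2) => z; rewrite lee_fin sqr_ge0.
- exact: measurable_funeM.
- by move=> y _; apply: integral_ge0 => x _; rewrite lee_fin sqr_ge0.
- by move=> y _; rewrite mule_ge0// integral_ge0// => x _; rewrite lee_fin sqr_ge0.
have E : {ae m2, forall y, sqint n1 (transform m1 k (fun x => w (x, y))) =
    (a%:E * sqint m1 (fun x => w (x, y)))%E}.
  by apply: filterS slice => y wy; exact: (kP _ wy).
by apply: filterS E => y yE _; exact: yE.
Qed.

End product_kernel.

(** * Changes of variables *)

(** The formula [phiE] for nonnegative functions is all that is assumed of
    [phi]: affine maps, dilations and the identification of R^(n+1) with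
    R x R^n have it in common. *)
Section change_of_variables.
Context {d1 d2} {T1 : measurableType d1} {T2 : measurableType d2} {R : realType}.
Context (mu : {measure set T1 -> \bar R}) (nu : {measure set T2 -> \bar R}).
Context (phi : T1 -> T2) (c : R).
Context (mphi : measurable_fun setT phi).
Context (phiE : forall f : T2 -> \bar R, measurable_fun setT f ->
  (forall x, 0 <= f x)%E ->
  (\int[mu]_x f (phi x) = c%:E * \int[nu]_x f x)%E).

Lemma sqint_comp (f : T2 -> R[i]) : cmeasurable f ->
  sqint mu (fun x => f (phi x)) = (c%:E * sqint nu f)%E.
Proof.
move=> mf; apply: (phiE (f := fun x => (normc (f x) ^+ 2)%:E)).
- exact: measurable_sqint_integrand.
- by move=> x; rewrite lee_fin sqr_ge0.
Qed.

Lemma cintegrable_comp (f : T2 -> R[i]) : cintegrable nu f ->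
  cintegrable mu (fun x => f (phi x)).
Proof.
move=> [mf fi]; split; first exact: cmeasurable_comp mf mphi.
rewrite (phiE (f := fun x => (normc (f x))%:E)).
- have [c0|c0] := leP 0 c; first by rewrite lte_mul_pinfty// lee_fin.
  apply: le_lt_trans (ltry 0); rewrite mule_le0_ge0//; last first.
    by apply: integral_ge0 => x _; rewrite lee_fin normc_ge0.
  by rewrite lee_fin ltW.
- exact/measurable_EFinP/measurable_normc.
- by move=> x; rewrite lee_fin normc_ge0.
Qed.

Let Rintegral_comp (u : T2 -> R) : nu.-integrable setT (EFin \o u) ->
  \int[mu]_x u (phi x) = c * \int[nu]_x u x.
Proof.
move=> ui; have mu' := measurable_int nu ui.
rewrite /Rintegral integralE [in RHS]integralE.
have pE : (\int[mu]_x (fun x => (u (phi x))%:E)^\+ x =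
           c%:E * \int[nu]_x (EFin \o u)^\+ x)%E.
  rewrite -(phiE (measurable_funepos mu')); last by move=> x; exact: funepos_ge0.
  by apply: eq_integral => x _; rewrite !funeposE.
have nE : (\int[mu]_x (fun x => (u (phi x))%:E)^\- x =
           c%:E * \int[nu]_x (EFin \o u)^\- x)%E.
  rewrite -(phiE (measurable_funeneg mu')); last by move=> x; exact: funeneg_ge0.
  by apply: eq_integral => x _; rewrite !funenegE.
have pf := integrable_pos_fin_num measurableT ui; have nf := integrable_neg_fin_num measurableT ui.
rewrite pE nE -muleBr//; last first.
  by rewrite fin_num_adde_defl// fin_numN.
by rewrite fineM// fin_numB; apply/andP; split.
Qed.

Lemma cint_comp (f : T2 -> R[i]) : cintegrable nu f ->
  cint mu (fun x => f (phi x)) = c%:C * cint nu f.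
Proof.
move=> fi; apply: complex_ext; rewrite !ReImE /= !mul0r ?subr0 ?addr0.
- exact: (Rintegral_comp (integrable_Re fi)).
- exact: (Rintegral_comp (integrable_Im fi)).
Qed.

End change_of_variables.

Lemma measurable_invr {R : realType} : measurable_fun setT (@GRing.inv R).
Proof.
rewrite -(setUv [set 0 : R]); apply/measurable_funU.
- exact: measurable_set1.
- by apply: measurableC; exact: measurable_set1.
split; first exact: measurable_fun_set1.
apply: open_continuous_measurable_fun.
  rewrite openC; exact: closed_eq.
by move=> x; rewrite inE => /= /eqP x0; exact: inv_continuous.
Qed.

Section affine_line.
Context {R : realType}.
Local Notation T := (measurableTypeR R).
Local Notation leb := (@lebesgue_measure R).

Definition affine (a b : R) (x : T) : T := (x - b) / a.

Lemma measurable_affine (a b : R) : measurable_fun setT (affine a b).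
Proof.
apply: (measurable_funM (f := fun x : R => x - b) (g := fun=> a^-1)) => //.
exact: (measurable_funB (f := fun x : R => x) (g := fun=> b)).
Qed.

Let pushaff (a b : R) : {measure set T -> \bar R} :=
  measure_function_pushforward__canonical__measure_function_Measure leb
    (measurable_affine a b).

(** The image of Lebesgue measure, divided by [`|a|], gives half-open intervals
    their length.  For negative [a] the preimage of such an interval is closed
    at the other end. *)
Lemma lebesgue_measure_affine (a b : R) (A : set T) : a != 0 -> measurable A ->
  leb (affine a b @^-1` A) = (`|a|%:E * leb A)%E.
Proof.
move=> a0 mA.
have na0 : 0 <= `|a|^-1 by rewrite invr_ge0.
have -> : (leb A = `|a|^-1%:E * leb (affine a b @^-1` A))%E.
  suff -> : leb A = mscale (NngNum na0) (pushaff a b) A by [].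
  apply: lebesgue_measure_unique => // X [[u v] /= _ <-].
  rewrite /mscale/= /pushforward.
  have [agt0|alt0] : 0 < a \/ a < 0 by case/lt_total/orP: a0; [right|left].
  - rewrite (_ : affine a b @^-1` _ = `]a * u + b, a * v + b]%classic); last first.
      apply/seteqP; split => x; rewrite /= !in_itv/= /affine.
        by rewrite ltr_pdivlMr// ler_pdivrMr// ltrBrDr lerBlDr ![_ * a]mulrC.
      by rewrite ltr_pdivlMr// ler_pdivrMr// ltrBrDr lerBlDr ![_ * a]mulrC.
    rewrite !lebesgue_measure_itv/= !lte_fin ltrD2r ltr_pM2l//.
    case: ifPn => // _; last by rewrite mule0.
    by rewrite -!EFinB -EFinM gtr0_norm//; congr EFin; field.
  - rewrite (_ : affine a b @^-1` _ = `[a * v + b, a * u + b[%classic); last first.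
      apply/seteqP; split => x; rewrite /= !in_itv/= /affine.
        by rewrite ltr_ndivlMr// ler_ndivrMr// ltrBlDr lerBrDr ![_ * a]mulrC andbC.
      by rewrite ltr_ndivlMr// ler_ndivrMr// ltrBlDr lerBrDr ![_ * a]mulrC andbC.
    rewrite !lebesgue_measure_itv/= !lte_fin ltrD2r ltr_nM2l//.
    case: ifPn => // _; last by rewrite mule0.
    by rewrite -!EFinB -EFinM ltr0_norm//; congr EFin; field.
by rewrite muleA -EFinM mulfV ?mul1e// normr_eq0.
Qed.

Lemma ge0_integral_affine (a b : R) (f : T -> \bar R) : a != 0 ->
  measurable_fun setT f -> (forall x, 0 <= f x)%E ->
  (\int[leb]_x f (affine a b x) = `|a|%:E * \int[leb]_x f x)%E.
Proof.
move=> a0 mf f0.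
have -> : (\int[leb]_x f (affine a b x) = \int[pushaff a b]_x f x)%E.
  by rewrite [RHS](ge0_integral_pushforward (measurable_affine a b)).
have na : 0 <= `|a| by [].
rewrite (_ : (`|a|%:E * _)%E = \int[mscale (NngNum na) leb]_x f x)%E; last first.
  by rewrite ge0_integral_mscale.
by apply: eq_measure_integral => A mA _; exact: lebesgue_measure_affine.
Qed.

End affine_line.

(** * Plancherel's formula on the real line *)

Section cosine_integral.
Context {R : realType}.
Local Notation T := (measurableTypeR R).
Local Notation leb := (@lebesgue_measure R).

Lemma normr_sin_le (t : R) : `|sin t| <= `|t|.
Proof.
wlog t0 : t / 0 < t.
  move=> H; have [->|] := eqVneq t 0; first by rewrite sin0 normr0.
  case/lt_total/orP => tlt; last exact: H.
  by rewrite -normrN -sinN -(normrN t); apply: H; rewrite oppr_gt0.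
have [c _] := @MVT R sin cos 0 t t0 (fun x _ => is_derive_sin x)
  (continuous_subspaceT (@continuous_sin R)).
rewrite sin0 !subr0 => ->; rewrite normrM ler_piMl//.
by rewrite ler_norml cos_geN1 cos_le1.
Qed.

Lemma onem_cos (t : R) : 1 - cos t = 2 * sin (t / 2) ^+ 2.
Proof.
have {1}-> : t = (t / 2) *+ 2 by rewrite -mulr_natr divfK.
rewrite cos_mulr2n sin2cos2 -mulr_natr; ring.
Qed.

(** An unnormalized Fejer kernel: as a function of [x] it has a mass proportional
    to [`|z|], which is how absolute values, hence lengths of intersections of
    intervals, come out of oscillatory integrals. *)
Definition cosk (z x : R) : R := (1 - cos (z * x)) / x ^+ 2.

Lemma cosk_ge0 z x : 0 <= cosk z x.
Proof. by rewrite divr_ge0 ?sqr_ge0// subr_ge0 cos_le1. Qed.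

(** The right-hand side is, up to the factor, the derivative of the arctangent.
    The factor is [1 / 2 + 2], from the bounds [x ^ 2 / 2] and [2] for
    [1 - cos x]. *)
Lemma cosk1_le (x : R) : cosk 1 x <= 5 / 2 * (1 + x ^+ 2)^-1.
Proof.
rewrite /cosk mul1r; have [->|x0] := eqVneq x 0.
  by rewrite cos0 subrr mul0r mulr_ge0// ?invr_ge0 ?addr_ge0 ?sqr_ge0//; lra.
have x2 : 0 < x ^+ 2 by rewrite exprn_even_gt0//= x0.
have x21 : 0 < 1 + x ^+ 2 by rewrite addr_gt0.
rewrite ler_pdivrMr// mulrAC ler_pdivlMr//.
have h1 : 1 - cos x <= 2^-1 * x ^+ 2.
  rewrite onem_cos.
  have : sin (x / 2) ^+ 2 <= (x / 2) ^+ 2.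
    rewrite -(real_normK (num_real (sin _))) -(real_normK (num_real (x / 2))).
    by rewrite lerXn2r ?nnegrE// normr_sin_le.
  rewrite exprMn exprVn; lra.
have h2 : (1 - cos x) * x ^+ 2 <= 2 * x ^+ 2.
  by rewrite ler_pM2r//; have := cos_geN1 x; lra.
rewrite mulrDr mulr1; lra.
Qed.

Lemma measurable_cosk z : measurable_fun setT (cosk z).
Proof.
apply: measurable_funM.
  apply: measurable_funB => //.
  apply: (measurableT_comp (continuous_measurable_fun (@continuous_cos R))).
  exact: (measurable_funM (f := fun=> z)).
apply: (measurableT_comp measurable_invr).
exact: measurable_funX.
Qed.

(** This is pi. *)
Definition kappa : R := \int[leb]_x cosk 1 x.

Lemma cosk1_lty : (\int[leb]_x (cosk 1 x)%:E < +oo)%E.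
Proof.
apply: (@le_lt_trans _ _ (\int[leb]_x ((5 / 2)%:E * ((oneDsqr x)^-1)%:E))%E).
  apply: ge0_le_integral => //.
  - by move=> x _; rewrite lee_fin cosk_ge0.
  - by apply/measurable_EFinP; exact: measurable_cosk.
  - apply: measurable_funeM; apply/measurable_EFinP.
    exact: (continuous_measurable_fun continuous_oneDsqrV).
  - by move=> x _; rewrite -EFinM lee_fin; exact: cosk1_le.
rewrite ge0_integralZl//; last first.
  apply/measurable_EFinP.
  exact: (continuous_measurable_fun continuous_oneDsqrV).
rewrite ge0_symfun_integralT; last 3 first.
- by move=> x; rewrite invr_ge0 (le_trans _ (oneDsqr_ge1 x)).
- exact: continuous_oneDsqrV.
- by move=> x; rewrite /= /oneDsqr sqrrN.
by rewrite -set_itvcy integral0y_oneDsqr -!EFinM ltry.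
Qed.

Lemma integral_cosk1 : (\int[leb]_x (cosk 1 x)%:E = kappa%:E)%E.
Proof.
rewrite /kappa /Rintegral fineK// ge0_fin_numE ?cosk1_lty//.
by apply: integral_ge0 => x _; rewrite lee_fin cosk_ge0.
Qed.

Lemma kappa_gt0 : 0 < kappa.
Proof.
rewrite lt_neqAle; apply/andP; split; last first.
  by rewrite -lee_fin -integral_cosk1 integral_ge0// => x _; rewrite lee_fin cosk_ge0.
apply/eqP => k0.
have : (\int[leb]_x `|(cosk 1 x)%:E| = 0)%E.
  under eq_integral do rewrite gee0_abs ?lee_fin ?cosk_ge0//.
  by rewrite integral_cosk1 -k0.
move=> /(ae_eq_integral_abs leb measurableT) -[].
  by apply/measurable_EFinP; exact: measurable_cosk.
move=> N [mN N0 sub].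
(* the integrand does not vanish on ]0, 1] *)
have sN : `]0, 1]%classic `<=` N.
  move=> x /=; rewrite in_itv/= => /andP[x0 x1]; apply: sub => /= /(_ I) /eqP.
  rewrite eqe /cosk mul1r mulf_eq0 invr_eq0 expf_eq0/= (gt_eqF x0) orbF.
  rewrite onem_cos mulf_eq0 pnatr_eq0/= expf_eq0/= gt_eqF//.
  apply: sin_gt0_pi; apply/andP; split; first by rewrite divr_gt0.
  by have := pi_ge2 R; lra.
have : (leb `]0%R, 1%R]%classic <= leb N)%E by apply: le_measure; rewrite ?inE.
by rewrite N0 lebesgue_measure_itv/= lte_fin ltr01 -EFinB lee_fin subr0 ler10.
Qed.

Lemma integral_cosk z : (\int[leb]_x (cosk z x)%:E = (kappa * `|z|)%:E)%E.
Proof.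
have [->|z0] := eqVneq z 0.
  rewrite normr0 mulr0; under eq_integral do rewrite /cosk mul0r cos0 subrr mul0r.
  by rewrite integral0.
have E x : (cosk z x)%:E = ((z ^+ 2)%:E * (cosk 1 (affine z^-1 0 x))%:E)%E.
  rewrite -EFinM /cosk /affine subr0 invrK mul1r [x * z]mulrC exprMn; congr EFin.
  have [->|x0] := eqVneq x 0; first by rewrite !(mulr0, expr0n)/= invr0 !mulr0.
  by field; rewrite z0 x0.
under eq_integral do rewrite E.
rewrite ge0_integralZl ?lee_fin ?sqr_ge0//; last 2 first.
- apply/measurable_EFinP/(measurableT_comp (measurable_cosk 1)).
  exact: measurable_affine.
- by move=> x _; rewrite lee_fin cosk_ge0.
rewrite (ge0_integral_affine 0 (f := fun x => (cosk 1 x)%:E)) ?invr_eq0//; last 2 first.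
- by apply/measurable_EFinP; exact: measurable_cosk.
- by move=> x; rewrite lee_fin cosk_ge0.
rewrite integral_cosk1 -!EFinM; congr EFin.
rewrite normfV -(real_normK (num_real z)).
by field; rewrite normr_eq0.
Qed.

Lemma integrable_cosk z : leb.-integrable setT (EFin \o cosk z).
Proof.
apply/integrableP; split; first (by apply/measurable_EFinP; exact: measurable_cosk).
under eq_integral do rewrite /= ger0_norm ?cosk_ge0//.
by rewrite integral_cosk ltry.
Qed.

End cosine_integral.

Section sinc_kernel.
Context {R : realType} (s r : R).
Context (s0 : s != 0) (r0 : 0 < r).
Local Notation T := (measurableTypeR R).
Local Notation leb := (@lebesgue_measure R).

Definition fourier_kernel (x xi : T) : R[i] := expi (- (s * (x * xi))).

Definition sinc (xi : T) : R := sin (r * s * xi) / (r * s * xi).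

(** The transform with this kernel is the Fourier transform of the mean of a
    function over intervals of radius [r]. *)
Definition sinc_kernel (x xi : T) : R[i] := (sinc xi)%:C * fourier_kernel x xi.

Definition ball_kernel (x y : T) : R[i] := (\1_(ball (x : R) r) (y : R))%:C.

(** Length of the intersection of two intervals of radius [r] with centers at
    distance [`|d|], in the form in which the three kernels of [sinc_sqr_cos]
    produce it. *)
Definition overlap (d : R) : R :=
  - `|d| + 2^-1 * `|2 * r + d| + 2^-1 * `|2 * r - d|.

Lemma measurable_mulT : measurable_fun setT (fun z : T * T => z.1 * z.2 : R).
Proof.
exact: (measurable_funM (f := fun z : T * T => z.1 : R) (g := fun z : T * T => z.2 : R)
  measurable_fst measurable_snd).
Qed.

Lemma fourier_kernel_measurable : kernel_measurable fourier_kernel.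
Proof.
apply: cmeasurable_expi; apply: measurableT_comp => //.
by apply: measurable_funM => //; exact: measurable_mulT.
Qed.

Lemma measurable_sinc : measurable_fun setT sinc.
Proof.
have m1 : measurable_fun [set: T] (fun xi : T => r * s * xi : R).
  exact: (measurable_funM (f := fun=> r * s)).
apply: measurable_funM.
  exact: (measurableT_comp (continuous_measurable_fun (@continuous_sin R)) m1).
exact: (measurableT_comp measurable_invr m1).
Qed.

Lemma sinc_kernel_measurable : kernel_measurable sinc_kernel.
Proof.
apply: cmeasurableM fourier_kernel_measurable.
apply: cmeasurable_real; apply: (measurableT_comp measurable_sinc).
exact: measurable_snd.
Qed.

Lemma ball_kernel_measurable : kernel_measurable ball_kernel.
Proof.
apply: cmeasurable_real.
rewrite (_ : (fun z => _) = (fun z : T * T => if `|z.1 - z.2 : R| < r then 1 else 0 : R)).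
  apply: measurable_fun_ifT => //.
  apply: (@measurable_fun_ltr _ _ _ _ (fun z : T * T => `|z.1 - z.2 : R|) (fun=> r)) => //.
  apply: measurableT_comp => //.
  exact: (measurable_funB (f := fun z : T * T => z.1 : R) (g := fun z : T * T => z.2 : R)
    measurable_fst measurable_snd).
apply/funext => -[x y] /=; rewrite indicE.
by case: ifPn => [xy|/negP xy]; [rewrite mem_set|rewrite memNset].
Qed.

Lemma normc_fourier_kernel x xi : normc (fourier_kernel x xi) = 1.
Proof. exact: normc_expi. Qed.

Lemma sinc_le1 xi : `|sinc xi| <= 1.
Proof.
rewrite /sinc; have [->|n0] := eqVneq (r * s * xi) 0.
  by rewrite sin0 mul0r normr0.
by rewrite normrM normfV ler_pdivrMr ?normr_gt0// mul1r normr_sin_le.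
Qed.

Lemma normc_sinc_kernel x xi : normc (sinc_kernel x xi) <= 1.
Proof. by rewrite normc_mul normc_fourier_kernel mulr1 normc_real sinc_le1. Qed.

Lemma normc_ball_kernel x xi : normc (ball_kernel x xi) <= 1.
Proof. by rewrite normc_real indicE; case: (_ \in _); rewrite ?normr1 ?normr0. Qed.

(** Product-to-sum formulas turn [sinc ^ 2] times a cosine into a combination of
    the kernels [cosk]; the conventions [x / 0 = 0] make the identity hold at
    the origin too. *)
Lemma sinc_sqr_cos (d xi : R) : sinc xi ^+ 2 * cos (s * d * xi) =
  (2 * (r * s) ^+ 2)^-1 * (- cosk (s * d) xi
     + 2^-1 * cosk (s * (2 * r + d)) xi + 2^-1 * cosk (s * (2 * r - d)) xi).
Proof.
rewrite /sinc /cosk; have [->|xi0] := eqVneq xi 0.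
  by rewrite !(mulr0, expr0n)/= invr0 !(mulr0, expr0n, mul0r, oppr0, addr0).
have -> : s * (2 * r + d) * xi = (r * s * xi) *+ 2 + s * d * xi.
  by rewrite -mulr_natr; ring.
have -> : s * (2 * r - d) * xi = (r * s * xi) *+ 2 - s * d * xi.
  by rewrite -mulr_natr; ring.
rewrite cosD cosB cos_mulr2n cos2sin2.
move: (sin (r * s * xi)) (cos (s * d * xi)) => S C.
move: (sin (_ *+ 2) * sin _) => uv.
transitivity ((2 * (r * s) ^+ 2)^-1 * (2 * S ^+ 2 * C / xi ^+ 2)).
  by rewrite !exprMn exprVn; field; rewrite s0 xi0 gt_eqF.
by congr (_ * _); field.
Qed.

Lemma integral_sinc_sqr_cos (d : R) :
  leb.-integrable setT (EFin \o (fun xi : T => sinc xi ^+ 2 * cos (s * d * xi))) /\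
  \int[leb]_(xi in setT) (sinc xi ^+ 2 * cos (s * d * xi)) =
    kappa / (2 * r ^+ 2 * `|s|) * overlap d.
Proof.
pose h (xi : T) := - cosk (s * d) xi
     + 2^-1 * cosk (s * (2 * r + d)) xi + 2^-1 * cosk (s * (2 * r - d)) xi.
have iZ (c z : R) : leb.-integrable setT (EFin \o (fun xi : T => c * cosk z xi)).
  by apply: eq_integrable (integrableZl measurableT c (integrable_cosk z)).
have iN z : leb.-integrable setT (EFin \o (fun xi : T => - cosk z xi)).
  rewrite (_ : (fun xi : T => _) = (fun xi => -1 * cosk z xi)); first exact: iZ.
  by apply/funext => xi; rewrite mulN1r.
have i2 : leb.-integrable setT (EFin \o (fun xi : T => - cosk (s * d) xi
     + 2^-1 * cosk (s * (2 * r + d)) xi)).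
  by apply: eq_integrable (integrableD measurableT (iN _) (iZ _ _)).
have ih : leb.-integrable setT (EFin \o h).
  by apply: eq_integrable (integrableD measurableT i2 (iZ _ _)).
have E : (fun xi : T => sinc xi ^+ 2 * cos (s * d * xi)) =
    (fun xi => (2 * (r * s) ^+ 2)^-1 * h xi).
  by apply/funext => xi; exact: sinc_sqr_cos.
have Rc z : \int[leb]_x cosk z x = kappa * `|z|.
  by rewrite /Rintegral integral_cosk.
rewrite E; split.
  by apply: eq_integrable (integrableZl measurableT _ ih).
rewrite RintegralZl// RintegralD// RintegralD//.
rewrite !RintegralZl//; [|exact: integrable_cosk..].
rewrite (_ : \int[leb]_x (- cosk (s * d) x) = - (kappa * `|s * d|)); last first.
  under eq_Rintegral do rewrite -mulN1r.
  by rewrite RintegralZl// ?Rc ?mulN1r//; exact: integrable_cosk.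
rewrite !Rc !normrM /overlap exprMn -[s ^+ 2]real_normK ?num_real//.
by field; rewrite normr_eq0 s0 gt_eqF.
Qed.

Lemma integral_sinc_sqr :
  (\int[leb]_xi (sinc xi ^+ 2)%:E = (kappa / (2 * r ^+ 2 * `|s|) * overlap 0)%:E)%E.
Proof.
have [i0 <-] := integral_sinc_sqr_cos 0.
rewrite /Rintegral fineK; last exact: (integrable_fin_num measurableT i0).
by apply: eq_integral => xi _; rewrite mulr0 mul0r cos0 mulr1.
Qed.

Lemma overlap_lt d : `|d| <= 2 * r -> overlap d = 2 * r - `|d|.
Proof.
rewrite ler_norml => /andP[d1 d2]; rewrite /overlap.
by rewrite (@ger0_norm _ (2 * r + d)) ?(@ger0_norm _ (2 * r - d)); lra.
Qed.

Lemma overlap_ge d : 2 * r <= `|d| -> overlap d = 0.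
Proof.
have := r0; rewrite /overlap ler_normr => rp /orP[] dr.
- rewrite (@ger0_norm _ d) ?(@ger0_norm _ (2 * r + d)) ?(@ler0_norm _ (2 * r - d)); lra.
- rewrite (@ler0_norm _ d) ?(@ler0_norm _ (2 * r + d)) ?(@ger0_norm _ (2 * r - d)); lra.
Qed.

Lemma lebesgue_measure_ballI (x x' : R) :
  leb (ball x r `&` ball x' r) = (overlap (x - x'))%:E.
Proof.
wlog xx' : x x' / x <= x'.
  move=> H; have [/H//|/ltW/H] := leP x x'.
  rewrite setIC => ->; congr EFin.
  by rewrite -[x' - x]opprB /overlap normrN opprK addrAC.
rewrite !ball_itv (_ : _ `&` _ = `]x' - r, x + r[%classic); last first.
  apply/seteqP; split => y; rewrite /= !in_itv/=.
    by move=> [/andP[_ ->] /andP[-> _]].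
  by move=> /andP[y1 y2]; split; apply/andP; split; lra.
rewrite lebesgue_measure_itv/= lte_fin.
have nd : `|x - x'| = x' - x by rewrite ler0_norm ?opprB// subr_le0.
case: ltP => h.
- by rewrite overlap_lt nd ?EFinB -?EFinB; [congr EFin; lra|lra].
- by rewrite overlap_ge// nd; lra.
Qed.

Lemma cint_ball_kernel (x x' : R) :
  cint leb (fun y => ball_kernel x y * conjc (ball_kernel x' y)) =
  (overlap (x - x'))%:C.
Proof.
rewrite (_ : (fun y => _) = (fun y : T => (\1_(ball x r `&` ball x' r) (y : R))%:C)).
  rewrite cint_real; congr (_%:C); rewrite /Rintegral integral_indic ?setIT//.
    exact: (congr1 fine (lebesgue_measure_ballI x x')).
  by apply: measurableI; exact: measurable_ball.
apply/funext => y; rewrite /ball_kernel indicI /=.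
by apply: complex_ext; rewrite !ReImE /=; ring.
Qed.

Lemma cint_sinc_kernel (x x' : R) :
  cint leb (fun xi => sinc_kernel x xi * conjc (sinc_kernel x' xi)) =
  (kappa / (2 * r ^+ 2 * `|s|) * overlap (x - x'))%:C.
Proof.
set d := x - x'.
pose f (xi : T) := (sinc xi ^+ 2)%:C * expi (- (s * d * xi)).
have -> : (fun xi => sinc_kernel x xi * conjc (sinc_kernel x' xi)) = f.
  apply/funext => xi; rewrite /f /sinc_kernel /fourier_kernel.
  have -> : expi (- (s * d * xi)) = expi (- (s * (x * xi))) * conjc (expi (- (s * (x' * xi)))).
    by rewrite -expiN -expiD; congr expi; rewrite /d; ring.
  by apply: complex_ext; rewrite !ReImE /=; ring.
have m1 : measurable_fun [set: T] (fun xi : T => s * d * xi : R).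
  exact: (measurable_funM (f := fun=> s * d)).
have mf : cmeasurable f.
  apply: cmeasurableM.
    by apply: cmeasurable_real; apply: measurable_funX; exact: measurable_sinc.
  by apply: cmeasurable_expi; exact: measurableT_comp.
have fi : cintegrable leb f.
  split => //; under eq_integral do rewrite normc_mul normc_expi mulr1 normc_real ger0_norm ?sqr_ge0//.
  by rewrite integral_sinc_sqr ltry.
(* a reflection conjugates the integrand, so that its integral is real *)
have fN xi : f (affine (-1) 0 xi) = conjc (f xi).
  rewrite /f /affine subr0 invrN1 mulrN1 /sinc !mulrN sinN invrN mulrNN opprK.
  by apply: complex_ext; rewrite !ReImE /= ?cosN ?sinN ?expr0n; ring.
have N10 : (-1 : R) != 0 by rewrite oppr_eq0 oner_eq0.
have := cint_comp
  (fun g mg g0 => ge0_integral_affine (f := g) 0 N10 mg g0) fi.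
rewrite normrN1 mul1r; under eq_cint do rewrite fN.
rewrite cintJ// => Ef.
apply: complex_ext.
- have [_ <-] := integral_sinc_sqr_cos d; apply: eq_Rintegral => xi _.
  by rewrite /f ReM /= cosN mul0r subr0.
- have := congr1 (@complex.Im R) Ef; rewrite ImJ => h.
  by rewrite [RHS](_ : _ = 0)//; lra.
Qed.

(** Both Gram functions are multiples of [overlap (x - x')]. *)
Lemma sqint_transform_sinc (w : T -> R[i]) : cintegrable leb w ->
  sqint leb (transform leb sinc_kernel w) =
  ((kappa / (2 * r ^+ 2 * `|s|))%:E * sqint leb (transform leb ball_kernel w))%E.
Proof.
move=> wi.
have sK (x : T) : sqint leb (sinc_kernel x) = (kappa / (2 * r ^+ 2 * `|s|) * overlap 0)%:E.
  rewrite -integral_sinc_sqr; apply: eq_integral => xi _.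
  by rewrite normc_mul normc_fourier_kernel mulr1 normc_real real_normK ?num_real.
have sB (x : T) : sqint leb (ball_kernel x) = (overlap 0)%:E.
  have <- : leb (ball (x : R) r `&` ball (x : R) r) = (overlap 0)%:E.
    by rewrite lebesgue_measure_ballI subrr.
  rewrite setIid -[in RHS](setIT (ball (x : R) r)) -integral_indic//; last exact: measurable_ball.
  apply: eq_integral => y _; rewrite normc_real indicE.
  by case: (_ \in _); rewrite ?normr1 ?normr0 ?expr1n ?expr0n.
apply: (eq_sqint_transform_gram
   (M := Num.max (kappa / (2 * r ^+ 2 * `|s|) * overlap 0) (overlap 0))) => //.
- exact: sinc_kernel_measurable.
- exact: ball_kernel_measurable.
- exact: normc_sinc_kernel.
- exact: normc_ball_kernel.
- by move=> x; rewrite sK lee_fin le_max lexx.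
- by move=> x; rewrite sB lee_fin le_max lexx orbT.
- by move=> x x'; rewrite cint_sinc_kernel cint_ball_kernel rmorphM.
Qed.

End sinc_kernel.

(** The form of Fatou's lemma used below: a uniform bound on the integrals
    passes to an almost everywhere limit. *)
Lemma fatou_bound d (T : measurableType d) (R : realType)
    (mu : {measure set T -> \bar R}) (f : nat -> T -> R) (g : T -> R) (M : \bar R) :
  (forall k, measurable_fun setT (f k)) -> (forall k x, 0 <= f k x) ->
  measurable_fun setT g -> (forall x, 0 <= g x) ->
  {ae mu, forall x, f k x @[k --> \oo] --> g x} ->
  (forall k, \int[mu]_x (f k x)%:E <= M)%E ->
  (\int[mu]_x (g x)%:E <= M)%E.
Proof.
move=> mf f0 mg g0 fg fM.
have mef k : measurable_fun setT (EFin \o f k) by exact/measurable_EFinP.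
apply: (@le_trans _ _ (\int[mu]_x limn_einf (fun k => (f k x)%:E))%E).
  apply: ae_ge0_le_integral => //.
  - by move=> x _; rewrite lee_fin.
  - exact/measurable_EFinP.
  - move=> x _; rewrite limn_einf_lim.
    apply: lime_ge; first exact: is_cvg_einfs.
    by near=> k; apply: le_ereal_inf_tmp => _ [j _ <-]; rewrite lee_fin.
  - rewrite (_ : (fun x => _) = (fun x => - limn_esup (fun k => - (f k x)%:E))%E).
      apply: measurableT_comp => //; apply: measurable_fun_limn_esup => k.
      rewrite (_ : (fun x => _) = -%E \o (EFin \o f k))//.
      exact: measurableT_comp.
    apply/funext => x; rewrite -limn_einfN; congr limn_einf.
    by apply/funext => k; rewrite /comp oppeK.
  - apply: filterS fg => x fx _.
    have /cvg_limn_einf_sup [-> _] : (f k x)%:E @[k --> \oo] --> (g x)%:E.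
      by apply: cvg_EFin => //; exact: nearW.
    by [].
apply: le_trans (fatou mu measurableT mef _) _.
  by move=> k x _; rewrite lee_fin.
rewrite limn_einf_lim; apply: lime_le; first exact: is_cvg_einfs.
by near=> k; apply: le_trans (ereal_inf_lbound _) (fM k); exists k => //=.
Unshelve. all: end_near. Qed.

Section fourier_line.
Context {R : realType} (s : R) (s0 : s != 0).
Local Notation T := (measurableTypeR R).
Local Notation leb := (@lebesgue_measure R).
Local Notation kf := (fourier_kernel s).
Implicit Type w : T -> R[i].

Lemma ball_indicC (r : R) (x y : T) :
  \1_(ball (x : R) r) (y : R) = \1_(ball (y : R) r) (x : R) :> R.
Proof.
rewrite !indicE; congr (_%:R); congr nat_of_bool.
by apply/idP/idP; rewrite !inE; exact: ball_sym.
Qed.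

Lemma sqint_ball_kernel (r : R) (y : T) : 0 < r ->
  sqint leb (ball_kernel r ^~ y) = (r *+ 2)%:E.
Proof.
move=> r0; rewrite -(lebesgue_measure_ball y (ltW r0)).
rewrite -[in RHS](setIT (ball (y : R) r)) -integral_indic//; last exact: measurable_ball.
apply: eq_integral => x _; rewrite normc_real ball_indicC indicE.
by case: (_ \in _); rewrite ?normr1 ?normr0 ?expr1n ?expr0n.
Qed.

(** Jensen's inequality for means over intervals of radius [r]. *)
Lemma sqint_transform_ball_le (r : R) w : 0 < r -> cintegrable leb w ->
  (((r *+ 2) ^- 2)%:E * sqint leb (transform leb (ball_kernel r) w) <=
   sqint leb w)%E.
Proof.
move=> r0 wi; have mw := proj1 wi.
have r2 : 0 < r *+ 2 by rewrite mulrn_wgt0.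
have mb := ball_kernel_measurable r.
pose u (z : T * T) : \bar R := (normc (w z.1 * ball_kernel r z.1 z.2) ^+ 2)%:E.
have mu : measurable_fun setT u.
  apply: (measurable_sqint_integrand (f := fun z => w z.1 * ball_kernel r z.1 z.2)).
  by apply: cmeasurableM mb; exact: cmeasurable_comp mw measurable_fst.
have u0 z : (0 <= u z)%E by rewrite lee_fin sqr_ge0.
have bb (x y : T) : ball_kernel r x y * ball_kernel r x y = ball_kernel r x y.
  rewrite /ball_kernel indicE; case: (_ \in _); by apply: complex_ext; rewrite !ReImE/=; ring.
have B (y : T) : ((normc (transform leb (ball_kernel r) w y) ^+ 2)%:E <=
    (r *+ 2)%:E * \int[leb]_x u (x, y))%E.
  have mby : cmeasurable (ball_kernel r ^~ y) by exact: kernel_measurable1.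
  have := cauchy_schwarz (mu := leb) (f := fun x => w x * ball_kernel r x y)
    (cmeasurableM mw mby) mby r2 _.
  rewrite sqint_ball_kernel// => /(_ (lexx _)).
  rewrite muleC (_ : cint _ _ = transform leb (ball_kernel r) w y)//.
  by apply: eq_cint => x; rewrite -mulrA bb.
have mt := cmeasurable_transform leb mb mw.
have muy : measurable_fun setT (fun y => \int[leb]_x u (x, y))%E.
  exact: (ge0_measurable_integral2 leb mu).
apply: (@le_trans _ _ (((r *+ 2) ^- 2)%:E * \int[leb]_y ((r *+ 2)%:E * \int[leb]_x u (x, y)))%E).
  rewrite lee_wpmul2l ?lee_fin ?invr_ge0 ?sqr_ge0//.
  apply: ge0_le_integral => //.
  - by move=> y _; rewrite lee_fin sqr_ge0.
  - exact: measurable_sqint_integrand.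
  - exact: measurable_funeM.
rewrite ge0_integralZl ?lee_fin ?(ltW r2)//; last first.
  by move=> y _; apply: integral_ge0.
rewrite -(fubini_tonelli u)//.
have E x : (\int[leb]_y u (x, y) = (r *+ 2)%:E * (normc (w x) ^+ 2)%:E)%E.
  rewrite /u/=; under eq_integral do rewrite normc_mul exprMn EFinM.
  rewrite ge0_integralZl ?lee_fin ?sqr_ge0//.
  - rewrite muleC; congr (_ * _)%E; rewrite -(sqint_ball_kernel x r0).
    by apply: eq_integral => y _; rewrite /ball_kernel ball_indicC.
  - by apply: measurable_sqint_integrand; exact: kernel_measurable2.
  - by move=> y _; rewrite lee_fin sqr_ge0.
under eq_integral do rewrite E.
rewrite ge0_integralZl ?lee_fin ?(ltW r2)//; last 2 first.
- exact: measurable_sqint_integrand.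
- by move=> x _; rewrite lee_fin sqr_ge0.
rewrite !muleA -!EFinM (_ : _ * _ * _ = 1) ?mul1e//.
by field; rewrite gt_eqF.
Qed.

Local Notation rad := (@harmonic R).

(** Lebesgue's differentiation theorem, along the radii [1 / (k + 1)]. *)
Lemma ball_mean_cvg (u : T -> R) : leb.-integrable setT (EFin \o u) ->
  {ae leb, forall y : T, (rad k *+ 2)^-1 *
    \int[leb]_x (u x * \1_(ball (x : R) (rad k)) (y : R)) @[k --> \oo] --> u y}.
Proof.
move=> ui.
have uloc : locally_integrable setT (u : R -> R).
  by apply: open_integrable_locally => //; exact: openT.
have ns (x : R) : nicely_shrinking x (fun k => ball x (rad k)).
  split; first by move=> k; exact: measurable_ball.
  exists (1, fun k => PosNum (harmonic_gt0 k)); split.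
  - exact: ltr01.
  - exact: cvg_harmonic.
  - by move=> k.
  - by move=> k; rewrite mul1e.
have ld : {ae leb, forall y : T, lebesgue_pt (u : R -> R) (y : R)}.
  exact: lebesgue_differentiation uloc.
case: ld => N [mN N0 sub]; exists N; split => // y /= ny; apply: sub => /=.
apply: contra_not ny.
move=> /(nice_lebesgue_differentiation ns uloc).
move=> /fine_cvg.
apply: cvg_trans; apply: near_eq_cvg; near=> k => /=.
have rk : 0 < rad k by exact: harmonic_gt0.
rewrite lebesgue_measure_ball ?ltW//.
have uB : leb.-integrable (ball (y : R) (rad k)) (EFin \o u).
  by apply: integrableS ui => //; exact: measurable_ball.
rewrite inver gt_eqF ?mulrn_wgt0// fineM//; last first.
  by apply: integrable_fin_num => //; exact: measurable_ball.
congr (_ * _); rewrite /= -/(Rintegral _ _ _) Rintegral_mkcond.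
apply: eq_Rintegral => x _; rewrite patchE ball_indicC indicE.
by case: ifPn => _; rewrite ?mulr1 ?mulr0.
Unshelve. all: end_near. Qed.

Lemma sinc_cvg (xi : T) : (xi : R) != 0 -> sinc s (rad k) xi @[k --> \oo] --> (1 : R).
Proof.
move=> xi0.
have bnd (t : R) : t != 0 -> 1 - t ^+ 2 / 2 <= sin t / t <= 1.
  wlog t0 : t / 0 < t.
    move=> H n0; case/lt_total/orP: (n0) => tlt; last exact: H.
    rewrite -[sin t / t]mulrNN -invrN -sinN -[t ^+ 2]sqrrN.
    by apply: H; rewrite ?oppr_gt0 ?oppr_eq0.
  move=> tn0.
  have [c] := @MVT R sin cos 0 t t0 (fun x _ => is_derive_sin x)
    (continuous_subspaceT (@continuous_sin R)).
  rewrite in_itv/= sin0 !subr0 => /andP[c0 ct] ->.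
  rewrite mulfK ?gt_eqF// cos_le1 andbT.
  have : 1 - cos c <= c ^+ 2 / 2.
    rewrite onem_cos.
    have : sin (c / 2) ^+ 2 <= (c / 2) ^+ 2.
      rewrite -(real_normK (num_real (sin _))) -(real_normK (num_real (c / 2))).
      by rewrite lerXn2r ?nnegrE// normr_sin_le.
    by rewrite exprMn exprVn; lra.
  have : c ^+ 2 <= t ^+ 2 by rewrite lerXn2r ?nnegrE// ltW.
  by lra.
apply: (@squeeze_cvgr _ _ _ _ (fun k => 1 - (rad k * s * xi) ^+ 2 / 2) (fun=> 1)).
- near=> k; apply: bnd; rewrite !mulf_neq0// gt_eqF//; exact: harmonic_gt0.
- rewrite -[X in _ --> X]subr0 -[X in _ --> _ - X](mul0r (2^-1 : R)).
  apply: cvgB; first exact: cvg_cst.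
  apply: cvgM; last exact: cvg_cst.
  have h : rad k * s * xi @[k --> \oo] --> (0 : R).
    rewrite -[X in _ --> X](mul0r (xi : R)); apply: cvgM; last exact: cvg_cst.
    rewrite -[X in _ --> X](mul0r s); apply: cvgM; last exact: cvg_cst.
    exact: cvg_harmonic.
  rewrite -[X in _ --> X](mul0r (0 : R)).
  under eq_fun do rewrite expr2.
  exact: cvgM.
- exact: cvg_cst.
Unshelve. all: end_near. Qed.

(** This is [2 pi / |s|]. *)
Definition fourier_const : R := 2 * kappa / `|s|.

Lemma fourier_const_gt0 : 0 < fourier_const.
Proof. by rewrite divr_gt0 ?normr_gt0// mulr_gt0// kappa_gt0. Qed.

(** Convolving with a shrinking interval multiplies the Fourier transform by
    [sinc], for which the Gram functions are explicit; Fatou's lemma removes the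
    regularization on either side, one for each inequality. *)
Lemma plancherel_fourier_line : plancherel_kernel leb leb kf fourier_const.
Proof.
split.
- exact: fourier_kernel_measurable.
- exact: normc_fourier_kernel.
move=> w wi; have mw := proj1 wi.
have mk := fourier_kernel_measurable s.
have mF := cmeasurable_transform leb mk mw.
have C0 := fourier_const_gt0.
have rk k : 0 < rad k by exact: harmonic_gt0.
have sincE k xi : transform leb (sinc_kernel s (rad k)) w xi =
    (sinc s (rad k) xi)%:C * transform leb kf w xi.
  rewrite -cintZ; last by apply: cintegrable_transform => // x y; rewrite normc_fourier_kernel.
  by apply: eq_cint => x; rewrite /sinc_kernel mulrCA.
have mS k := cmeasurable_transform leb (sinc_kernel_measurable s (rad k)) mw.
have mB k := cmeasurable_transform leb (ball_kernel_measurable (rad k)) mw.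
have SB k : sqint leb (transform leb (sinc_kernel s (rad k)) w) =
   (fourier_const%:E * (((rad k *+ 2) ^- 2)%:E *
       sqint leb (transform leb (ball_kernel (rad k)) w)))%E.
  rewrite sqint_transform_sinc// muleA -EFinM; congr (_%:E * _)%E.
  by rewrite /fourier_const; field; rewrite normr_eq0 s0 gt_eqF.
apply/eqP; rewrite eq_le; apply/andP; split.
- apply: (@fatou_bound _ _ _ leb (fun k xi => normc (transform leb (sinc_kernel s (rad k)) w xi) ^+ 2)).
  + by move=> k; exact: measurable_normc_sqr.
  + by move=> k x; exact: sqr_ge0.
  + exact: measurable_normc_sqr.
  + by move=> x; exact: sqr_ge0.
  + have : {ae leb, forall xi : T, (xi : R) != 0}.
      exists [set 0]; split; first exact: measurable_set1.
        exact: lebesgue_measure_set1.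
      by move=> x /= /negP; rewrite negbK => /eqP.
    apply: filterS => xi xi0; pose N : R := normc (transform leb kf w xi) ^+ 2.
    have h : sinc s (rad k) xi * sinc s (rad k) xi * N @[k --> \oo] --> 1 * 1 * N.
      by apply: cvgM; [apply: cvgM; exact: sinc_cvg|exact: cvg_cst].
    rewrite !mul1r in h; apply: cvg_trans h; apply: near_eq_cvg; near=> k.
    by rewrite sincE normc_mul exprMn normc_real real_normK ?num_real// expr2.
  + move=> k; rewrite -/(sqint _ _) SB lee_wpmul2l ?lee_fin ?(ltW C0)//.
    exact: sqint_transform_ball_le.
- suff : (sqint leb w <= fourier_const^-1%:E * sqint leb (transform leb kf w))%E.
    by rewrite lee_pdivlMl.
  apply: (@fatou_bound _ _ _ leb (fun k y => normc (((rad k *+ 2)^-1)%:C *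
      transform leb (ball_kernel (rad k)) w y) ^+ 2)).
  + move=> k; apply: measurable_normc_sqr; apply: cmeasurableM (mB k).
    exact: cmeasurable_cst.
  + by move=> k x; exact: sqr_ge0.
  + exact: measurable_normc_sqr.
  + by move=> x; exact: sqr_ge0.
  + have rE k (y : T) : Re (transform leb (ball_kernel (rad k)) w y) =
        \int[leb]_x (Re (w x) * \1_(ball (x : R) (rad k)) (y : R)).
      by apply: eq_Rintegral => x _; rewrite ReM /= mulr0 subr0.
    have iE k (y : T) : Im (transform leb (ball_kernel (rad k)) w y) =
        \int[leb]_x (Im (w x) * \1_(ball (x : R) (rad k)) (y : R)).
      by apply: eq_Rintegral => x _; rewrite ImM /= mulr0 add0r.
    have := ball_mean_cvg (integrable_Re wi); have := ball_mean_cvg (integrable_Im wi).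
    apply: filterS2 => y iy ry.
    set a := fun k => _ * Rintegral _ _ _ in ry; set b := fun k => _ * Rintegral _ _ _ in iy.
    have h : a k * a k + b k * b k @[k --> \oo] -->
        Re (w y) * Re (w y) + Im (w y) * Im (w y) by apply: cvgD; exact: cvgM.
    rewrite normc_sqr !expr2; apply: cvg_trans h; apply: near_eq_cvg; near=> k.
    by rewrite normc_sqr !ReImE rE iE /= !mul0r subr0 addr0 !expr2.
  + move=> k; have := sqintZ leb ((rad k *+ 2)^-1)%:C (mB k).
    rewrite {1}/sqint => ->.
    have -> : normc ((rad k *+ 2)^-1)%:C ^+ 2 = (rad k *+ 2) ^- 2.
      by rewrite normc_real real_normK ?num_real// exprVn.
    rewrite lee_pdivlMl// -SB.
    apply: ge0_le_integral => //.
    * by move=> x _; rewrite lee_fin sqr_ge0.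
    * exact: measurable_sqint_integrand.
    * exact: measurable_sqint_integrand.
    move=> xi _; rewrite sincE normc_mul exprMn lee_fin ler_piMl ?sqr_ge0//.
    rewrite expr_le1// ?normc_ge0// normc_real; exact: sinc_le1.
Unshelve. all: end_near. Qed.

End fourier_line.

(** * Square-integrable functions: convergence and completeness *)

Section null_sequences.
Context {R : realType}.
Implicit Types u v w : nat -> \bar R.

Lemma squeeze_null u v w : (forall n, 0 <= u n)%E ->
  (forall n, u n <= 2%:E * v n + 2%:E * w n)%E ->
  v n @[n --> \oo] --> 0%E -> w n @[n --> \oo] --> 0%E ->
  u n @[n --> \oo] --> 0%E.
Proof.
move=> u0 uvw v0 w0.
apply: (@squeeze_cvge _ _ _ _ (fun=> 0%E) _ (fun n => 2%:E * v n + 2%:E * w n)%E).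
- by apply: nearW => n; rewrite u0 uvw.
- exact: cvg_cst.
- have -> : (0 = 2%:E * 0 + 2%:E * 0 :> \bar R)%E by rewrite !mule0 adde0.
  by apply: cvgeD; [rewrite !mule0|exact: cvgeZl|exact: cvgeZl].
Qed.

Lemma null_eventually_le u (e : R) : u n @[n --> \oo] --> 0%E -> 0 < e ->
  exists N, forall n, (N <= n)%N -> (u n <= e%:E)%E.
Proof.
move=> u0 e0; have /(u0 _) [N _ NP] : nbhs (0%E : \bar R) [set x | (x <= e%:E)%E].
  by apply: filterS (lt_nbhsl (_ : (0 < e%:E)%E)) => [x /ltW|]; rewrite ?lte_fin.
by exists N => n Nn; exact: NP.
Qed.

Lemma null_eventuallyP u : (forall n, 0 <= u n)%E ->
  (forall e : R, 0 < e -> exists N, forall n, (N <= n)%N -> (u n <= e%:E)%E) ->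
  u n @[n --> \oo] --> 0%E.
Proof.
move=> u0 H; apply/fine_cvgP; split.
  have [N NP] := H 1 ltr01; exists N => // n /= Nn.
  by rewrite ge0_fin_numE//; exact: le_lt_trans (NP _ Nn) (ltry _).
apply/cvgrPdist_le => e e0; have [N NP] := H e e0.
exists N => // n /= Nn; rewrite sub0r normrN /comp.
have un := NP _ Nn; rewrite ger0_norm ?fine_ge0//.
by rewrite -lee_fin fineK// ge0_fin_numE//; exact: le_lt_trans un (ltry _).
Qed.

End null_sequences.

Lemma normc_cvg0 {R : realType} (z : nat -> R[i]) (c : R[i]) :
  Re (z n) @[n --> \oo] --> Re c -> Im (z n) @[n --> \oo] --> Im c ->
  normc (z n - c) @[n --> \oo] --> (0 : R).
Proof.
move=> rz iz.
have dist0 (u : nat -> R) l : u n @[n --> \oo] --> l ->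
    `|u n - l| @[n --> \oo] --> (0 : R).
  move=> ul; have t : `|u n - l| @[n --> \oo] --> `|l - l|.
    by apply: cvg_norm; apply: cvgB => //; exact: cvg_cst.
  by rewrite subrr normr0 in t.
have t : `|Re (z n) - Re c| + `|Im (z n) - Im c| @[n --> \oo] --> (0 + 0 : R).
  by apply: cvgD; exact: dist0.
rewrite addr0 in t.
apply: (@squeeze_cvgr _ _ _ _ (fun=> 0) _ _ _ _ (cvg_cst _) t).
apply: nearW => n; rewrite normc_ge0 andTb.
by apply: le_trans (normc_le_ReIm _) _; rewrite !ReImE.
Qed.

Section square_integrable.
Context {d} {T : measurableType d} {R : realType} (mu : {measure set T -> \bar R}).
Implicit Types (f g h : T -> R[i]) (u v : nat -> T -> R[i]).

Definition sq_integrable f := cmeasurable f /\ (sqint mu f < +oo)%E.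

Definition sq_cvg u f := sqint mu (fun x => (u n x - f x)%R) @[n --> \oo] --> 0%E.

Lemma sqintD_le f g : cmeasurable f -> cmeasurable g ->
  (sqint mu (fun x => (f x + g x)%R) <= 2%:E * sqint mu f + 2%:E * sqint mu g)%E.
Proof.
move=> mf mg; have mf2 := measurable_sqint_integrand mf.
have mg2 := measurable_sqint_integrand mg.
rewrite -!ge0_integralZl//; [|by move=> x _; rewrite lee_fin sqr_ge0..].
rewrite -ge0_integralD//; last 4 first.
- by move=> x _; rewrite lee_fin mulr_ge0 ?sqr_ge0.
- exact: measurable_funeM.
- by move=> x _; rewrite lee_fin mulr_ge0 ?sqr_ge0.
- exact: measurable_funeM.
apply: ge0_le_integral => //.
- by move=> x _; rewrite lee_fin sqr_ge0.
- by apply: measurable_sqint_integrand; exact: cmeasurableD.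
- by apply: emeasurable_funD; exact: measurable_funeM.
- by move=> x _; rewrite -!EFinM -EFinD lee_fin normc_add_sqr.
Qed.

Lemma sqintN f : sqint mu (fun x => - f x) = sqint mu f.
Proof. by apply: eq_integral => x _; rewrite normc_opp. Qed.

Lemma sqintC f g : sqint mu (fun x => (f x - g x)%R) = sqint mu (fun x => (g x - f x)%R).
Proof. by rewrite -sqintN; congr sqint; apply/funext => x; rewrite opprB. Qed.

Lemma sqint_triangle f g h : cmeasurable f -> cmeasurable g -> cmeasurable h ->
  (sqint mu (fun x => (f x - h x)%R) <= 2%:E * sqint mu (fun x => (f x - g x)%R)
    + 2%:E * sqint mu (fun x => (g x - h x)%R))%E.
Proof.
move=> mf mg mh.
rewrite (_ : (fun x => f x - h x) = (fun x => (f x - g x) + (g x - h x))).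
  by apply: sqintD_le; exact: cmeasurableB.
by apply/funext => x; rewrite addrA subrK.
Qed.

Lemma sq_integrableD f g : sq_integrable f -> sq_integrable g ->
  sq_integrable (fun x => f x + g x).
Proof.
move=> [mf fi] [mg gi]; split; first exact: cmeasurableD.
apply: le_lt_trans (sqintD_le mf mg) _.
by apply: lte_add_pinfty; rewrite lte_mul_pinfty.
Qed.

Lemma sq_integrableN f : sq_integrable f -> sq_integrable (fun x => - f x).
Proof. by move=> [mf fi]; split; [exact: cmeasurableN|rewrite sqintN]. Qed.

Lemma sq_integrableB f g : sq_integrable f -> sq_integrable g ->
  sq_integrable (fun x => f x - g x).
Proof. by move=> ? ?; apply: sq_integrableD => //; exact: sq_integrableN. Qed.

Lemma sq_integrableM f g : sq_integrable f -> sq_integrable g ->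
  cintegrable mu (fun x => f x * conjc (g x)).
Proof.
move=> [mf fi] [mg gi].
by apply: cintegrable_mul; rewrite ?sqintJ//; exact: cmeasurableJ.
Qed.

Lemma sqint0_ae f : cmeasurable f -> sqint mu f = 0%E ->
  {ae mu, forall x, f x = 0}.
Proof.
move=> mf f0.
have : (\int[mu]_x `|(normc (f x) ^+ 2)%:E| = 0)%E.
  by rewrite -[RHS]f0; apply: eq_integral => x _; rewrite gee0_abs// lee_fin sqr_ge0.
move=> /(ae_eq_integral_abs mu measurableT (measurable_sqint_integrand mf)).
apply: filterS => x /(_ I) /eqP; rewrite eqe sqrf_eq0 => nf.
by apply/eqP; rewrite -normc_eq0.
Qed.

(** Split the difference into the products of [u - f] with [h], of [f] with
    [v - h], and of [u - f] with [v - h], and apply the Cauchy-Schwarz inequality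
    to the first two. *)
Lemma sq_cvg_inner u v f h :
  (forall n, sq_integrable (u n)) -> (forall n, sq_integrable (v n)) ->
  sq_integrable f -> sq_integrable h -> sq_cvg u f -> sq_cvg v h ->
  normc (cint mu (fun x => u n x * conjc (v n x)) -
         cint mu (fun x => f x * conjc (h x))) @[n --> \oo] --> (0 : R).
Proof.
move=> ui vi fi hi ff hh.
have cs0 (z : nat -> T -> R[i]) y : (forall n, sq_integrable (z n)) ->
    sq_integrable y -> sqint mu (z n) @[n --> \oo] --> 0%E ->
    normc (cint mu (fun x => z n x * conjc (y x))) @[n --> \oo] --> (0 : R).
  move=> zi yi z0; have [my ylt] := yi.
  pose G := fine (sqint mu y) + 1.
  have yfin : sqint mu y \is a fin_num by rewrite ge0_fin_numE// sqint_ge0.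
  have G0 : 0 < G by rewrite ltr_pwDr// fine_ge0// sqint_ge0.
  have yG : (sqint mu (fun x => conjc (y x)) <= G%:E)%E.
    by rewrite sqintJ EFinD fineK// leeDl.
  apply/cvgr0Pnorm_le => e e0.
  have eG : 0 < e ^+ 2 / G by rewrite divr_gt0// exprn_gt0.
  have [N NP] := null_eventually_le z0 eG.
  exists N => // n /= Nn; rewrite ger0_norm ?normc_ge0//.
  rewrite -(@ler_pXn2r _ 2) ?nnegrE ?normc_ge0 ?(ltW e0)//.
  have := cauchy_schwarz (proj1 (zi n)) (cmeasurableJ my) G0 yG.
  rewrite -lee_fin => /le_trans; apply.
  have := NP _ Nn => /(lee_wpmul2r (_ : 0 <= G%:E)%E) h1.
  apply: le_trans (h1 _) _; first by rewrite lee_fin ltW.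
  by rewrite -EFinM divfK// gt_eqF.
pose df n x := u n x - f x; pose dh n x := v n x - h x.
have dfi n : sq_integrable (df n) by exact: sq_integrableB.
have dhi n : sq_integrable (dh n) by exact: sq_integrableB.
have t1 := cs0 df h dfi hi ff.
have t2 : normc (cint mu (fun x => f x * conjc (dh n x))) @[n --> \oo] --> (0 : R).
  have := cs0 dh f dhi fi hh; apply: cvg_trans; apply: near_eq_cvg; near=> n.
  rewrite -normcJ -cintJ; last exact: sq_integrableM.
  congr normc; apply: eq_cint => x.
  by apply: complex_ext; rewrite !ReImE; ring.
have t3 : normc (cint mu (fun x => df n x * conjc (dh n x))) @[n --> \oo] --> (0 : R).
  apply/cvgr0Pnorm_le => e e0.
  have [N1 N1P] := null_eventually_le ff e0.
  have [N2 N2P] := null_eventually_le hh e0.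
  exists (maxn N1 N2) => // n /=; rewrite geq_max => /andP[n1 n2].
  rewrite ger0_norm ?normc_ge0// -lee_fin.
  apply: le_trans (normc_cint (sq_integrableM (dfi n) (dhi n))) _.
  apply: le_trans (le_integral_normc_mul mu (proj1 (dfi n)) (cmeasurableJ (proj1 (dhi n)))) _.
  rewrite sqintJ; apply: (@le_trans _ _ ((2^-1)%:E * (e%:E + e%:E))%E).
    by rewrite lee_wpmul2l ?lee_fin// leeD// ?N1P ?N2P.
  by rewrite -EFinD -EFinM lee_fin; lra.
have t : normc (cint mu (fun x => df n x * conjc (h x))) +
    normc (cint mu (fun x => f x * conjc (dh n x))) +
    normc (cint mu (fun x => df n x * conjc (dh n x))) @[n --> \oo] --> (0 + 0 + 0 : R).
  by apply: cvgD t3; exact: cvgD t1 t2.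
rewrite !addr0 in t.
apply: (@squeeze_cvgr _ _ _ _ (fun=> 0) _ _ _ _ (cvg_cst _) t).
apply: nearW => n; rewrite normc_ge0 andTb.
have -> : cint mu (fun x => u n x * conjc (v n x)) - cint mu (fun x => f x * conjc (h x)) =
   cint mu (fun x => df n x * conjc (h x)) + cint mu (fun x => f x * conjc (dh n x)) +
   cint mu (fun x => df n x * conjc (dh n x)).
  rewrite -cintB; [|exact: sq_integrableM..].
  rewrite -!cintD; [|apply: cintegrableD|..]; try exact: sq_integrableM.
  apply: eq_cint => x; rewrite /df /dh.
  by apply: complex_ext; rewrite !ReImE; ring.
apply: le_trans (normc_add _ _) _; rewrite lerD2r; exact: normc_add.
Unshelve. all: end_near. Qed.

End square_integrable.

Section truncation.
Context {d} {T : measurableType d} {R : realType}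
  (mu : {sigma_finite_measure set T -> \bar R}).

(** Cut off along an exhaustion by sets of finite measure. *)
Lemma sq_integrable_truncation (f : T -> R[i]) : sq_integrable mu f ->
  exists u : nat -> T -> R[i],
    (forall n, cintegrable mu (u n) /\ sq_integrable mu (u n)) /\ sq_cvg mu u f.
Proof.
move=> [mf fi].
have /sigma_finiteP[F [FT ndF Ffin]] := sigma_finiteT mu.
pose I n (x : T) : R[i] := (\1_(F n) x)%:C.
have mI n : cmeasurable (I n).
  by apply: cmeasurable_real; apply: measurable_indic; case: (Ffin n).
have nI n x : normc (I n x) <= 1.
  by rewrite normc_real indicE; case: (_ \in _); rewrite ?normr1 ?normr0.
have Ii n : (sqint mu (I n) < +oo)%E.
  rewrite (_ : sqint mu (I n) = mu (F n)); first by case: (Ffin n).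
  rewrite -[F n in RHS]setIT -integral_indic//; last by case: (Ffin n).
  apply: eq_integral => x _; rewrite normc_real indicE.
  by case: (_ \in _); rewrite ?normr1 ?normr0 ?expr1n ?expr0n.
exists (fun n x => f x * I n x); split.
  move=> n; split; first exact: cintegrable_mul.
  split; first exact: cmeasurableM.
  apply: le_lt_trans fi; apply: ge0_le_integral => //.
  - by move=> x _; rewrite lee_fin sqr_ge0.
  - by apply: measurable_sqint_integrand; exact: cmeasurableM.
  - exact: measurable_sqint_integrand.
  - move=> x _; rewrite lee_fin normc_mul exprMn ler_piMr ?sqr_ge0//.
    by rewrite expr_le1// normc_ge0.
have mfI n : cmeasurable (fun x => f x * I n x - f x).
  by apply: cmeasurableB => //; exact: cmeasurableM.
have sqi : mu.-integrable setT (fun x => (normc (f x) ^+ 2)%:E).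
  apply/integrableP; split; first exact: measurable_sqint_integrand.
  by under eq_integral do rewrite gee0_abs ?lee_fin ?sqr_ge0//.
have [||||_ _] := @dominated_convergence _ _ _ mu _ measurableT
  (fun n x => (normc (f x * I n x - f x) ^+ 2)%:E) (cst 0%E) _ _ _ _ sqi.
- by move=> n; exact: measurable_sqint_integrand.
- exact: measurable_cst.
- apply: aeW => x _; have [k _ Fk] : (\bigcup_n F n) x by rewrite -FT.
  apply: cvg_near_cst; exists k => // n /= kn.
  have Fn : x \in F n by rewrite inE; move: x Fk; exact/subsetPset/ndF.
  by rewrite /I indicE Fn mulr1 subrr normc0 expr0n.
- apply: aeW => x n _; rewrite gee0_abs ?lee_fin ?sqr_ge0//.
  rewrite -[X in _ - X](mulr1 (f x)) -mulrBr normc_mul exprMn ler_piMr ?sqr_ge0//.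
  rewrite expr_le1 ?normc_ge0//.
  have [->|->] : I n x = 1 \/ I n x = 0.
  - by rewrite /I indicE; case: (_ \in _); [left|right].
  - by rewrite subrr normc0.
  - by rewrite sub0r normc_opp normc1.
by rewrite /= integral0.
Qed.

End truncation.

Section completeness.
Context {d} {T : measurableType d} {R : realType} (mu : {measure set T -> \bar R}).
Implicit Types (g : T -> R[i]) (u v : nat -> T -> R[i]).

(** A sequence whose increments are summable fast enough converges almost
    everywhere: the weights [4 ^ k] keep the integral of the weighted series of
    squared increments finite, and where that series is finite the increments
    decrease geometrically. *)
Lemma fast_sq_cauchy_cvg_ae v : (forall k, sq_integrable mu (v k)) ->
  (forall k, (sqint mu (fun x => (v k.+1 x - v k x)%R) <= (8 ^- k)%:E)%E) ->
  exists2 g, cmeasurable g &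
    {ae mu, forall x, normc (v k x - g x) @[k --> \oo] --> (0 : R)}.
Proof.
move=> vi vd.
pose D k x := v k.+1 x - v k x.
have mD k : cmeasurable (D k) by exact: cmeasurableB (proj1 (vi k.+1)) (proj1 (vi k)).
pose W k x : \bar R := ((4 ^+ k * normc (D k x) ^+ 2)%:E).
have mW k : measurable_fun setT (W k).
  by apply/measurable_EFinP; apply: measurable_funM => //; exact: measurable_normc_sqr.
have W0 k x : (0 <= W k x)%E by rewrite lee_fin; apply: mulr_ge0; [exact: exprn_ge0|exact: sqr_ge0].
pose S x : \bar R := (\sum_(0 <= k <oo) W k x)%E.
have mS : measurable_fun setT S.
  by apply: (ge0_emeasurable_sum (P := xpredT)) => // k x _ _; exact: W0.
have Slt : (\int[mu]_x S x < +oo)%E.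
  rewrite integral_nneseries//.
  apply: (@le_lt_trans _ _ (\sum_(0 <= k <oo) (2 / (2 ^ k.+1)%:R : R)%:E)%E); last first.
    exact: le_lt_trans (epsilon_trick0 _ _) (ltry _).
  apply: lee_nneseries => k _; first by move=> _; exact: integral_ge0.
  under eq_integral do rewrite /W EFinM.
  rewrite ge0_integralZl//; last 2 first.
  - exact: measurable_sqint_integrand.
  - by move=> x _; rewrite lee_fin sqr_ge0.
  apply: (@le_trans _ _ ((4 ^+ k)%:E * (8 ^- k)%:E)%E).
    by rewrite lee_wpmul2l ?lee_fin ?exprn_ge0//; exact: vd.
  rewrite -EFinM lee_fin natrX exprS invfM mulrA mulfV// mul1r -!exprVn -exprMn.
  by rewrite (_ : 4 * 8^-1 = 2^-1 :> R)//; field.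
have Sfin : {ae mu, forall x, S x \is a fin_num}.
  have : mu.-integrable setT S.
    apply/integrableP; split => //.
    by under eq_integral do rewrite gee0_abs ?nneseries_ge0//.
  by move/(integrable_ae measurableT); apply: filterS => x; apply.
pose A := [set x | (S x < +oo)%E].
have mA : measurable A.
  by rewrite -[A]setTI; apply: emeasurable_fun_infty_o.
(* where the weighted series is finite, the sequence converges *)
have cvgA (p : R[i] -> R) x : (forall y z, p (y - z) = p y - p z) ->
    (forall z, `|p z| <= normc z) -> A x -> cvgn (fun k => p (v k x)).
  move=> pB pn Ax; have Sx0 : (0 <= S x)%E by apply: nneseries_ge0 => k _ _; exact: W0.
  have Sx : S x \is a fin_num by rewrite ge0_fin_numE.
  set M := fine (S x); have M0 : 0 <= M by exact: fine_ge0.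
  have bound k : `|p (D k x)| <= Num.sqrt M * 2^-1 ^+ k.
    apply: le_trans (pn _) _.
    have W_le : 4 ^+ k * normc (D k x) ^+ 2 <= M.
      rewrite -lee_fin fineK//; apply: le_trans (nneseries_lim_ge k.+1 _); last first.
        by move=> n _ _; exact: W0.
      by rewrite big_nat_recr//= leeDr// sume_ge0.
    rewrite -(@ler_pXn2r _ 2) ?nnegrE ?normc_ge0 ?mulr_ge0 ?sqrtr_ge0 ?exprn_ge0//.
    rewrite exprMn sqr_sqrtr// -exprM mulnC exprM exprVn.
    rewrite (_ : 2 ^- 2 = 4^-1 :> R); last by rewrite -natrX.
    by rewrite exprVn ler_pdivlMr ?exprn_gt0// mulrC.
  have cs : cvgn (series (fun k => p (D k x))).
    apply: normed_cvg; apply: (@series_le_cvg _ _ (geometric (Num.sqrt M) 2^-1)) => //.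
    - by move=> k; exact: normr_ge0.
    - by move=> k /=; rewrite mulr_ge0 ?sqrtr_ge0// exprn_ge0.
    - apply: is_cvg_geometric_series; rewrite ger0_norm//.
      by rewrite invf_lt1// ltr1n.
  have -> : (fun k => p (v k x)) = (fun k => p (v 0%N x) + series (fun k => p (D k x)) k).
    apply/funext => k; rewrite (eq_sum_telescope (fun k => p (v k x))).
    congr (_ + _); rewrite /series/=; apply: eq_bigr => i _.
    by rewrite /telescope /D pB.
  by apply: is_cvgD => //; exact: is_cvg_cst.
have ReB y z : Re (y - z) = Re y - Re z :> R by rewrite !ReImE.
have ImB y z : Im (y - z) = Im y - Im z :> R by rewrite !ReImE.
pose g x : R[i] := limn (fun k => \1_A x * Re (v k x)) +i*
                   limn (fun k => \1_A x * Im (v k x)).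
have cvg1A (p : R[i] -> R) x : (forall y z, p (y - z) = p y - p z) ->
    (forall z, `|p z| <= normc z) -> cvgn (fun k => \1_A x * p (v k x)).
  move=> pB pn; rewrite indicE; have [/set_mem Ax|_] := boolP (x \in A).
    by under eq_fun do rewrite mul1r; exact: cvgA.
  by under eq_fun do rewrite mul0r; exact: is_cvg_cst.
have mp k : measurable_fun setT (fun x => \1_A x * Re (v k x)) /\
            measurable_fun setT (fun x => \1_A x * Im (v k x)).
  by have [[mr mi] _] := vi k; split; apply: measurable_funM => //; exact: measurable_indic.
exists g.
  split.
  - apply: (@measurable_fun_cvg _ _ _ _ (fun k x => \1_A x * Re (v k x))).
      by move=> k; case: (mp k).
    by move=> x _; exact: (cvg1A _ x ReB (@Re_le_normc R)).
  - apply: (@measurable_fun_cvg _ _ _ _ (fun k x => \1_A x * Im (v k x))).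
      by move=> k; case: (mp k).
    by move=> x _; exact: (cvg1A _ x ImB (@Im_le_normc R)).
apply: filterS Sfin => x xfin.
have Ax : A x by rewrite /A /= -ge0_fin_numE// nneseries_ge0.
have rc := cvg1A _ x ReB (@Re_le_normc R).
have ic := cvg1A _ x ImB (@Im_le_normc R).
have A1 : \1_A x = 1 :> R by rewrite indicE mem_set.
have E (p : R[i] -> R) : (fun k => \1_A x * p (v k x)) = (fun k => p (v k x)).
  by apply/funext => k; rewrite A1 mul1r.
apply: normc_cvg0; rewrite /g /= E; [rewrite E in rc; exact: rc|rewrite E in ic; exact: ic].
Qed.

(** Riesz-Fischer: extract a subsequence to which the previous lemma applies;
    Fatou's lemma turns almost everywhere convergence into convergence in mean. *)
Lemma sq_complete u : (forall n, sq_integrable mu (u n)) ->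
  (forall e : R, 0 < e -> exists N, forall n m, (N <= n)%N -> (N <= m)%N ->
     (sqint mu (fun x => (u n x - u m x)%R) <= e%:E)%E) ->
  exists2 g, sq_integrable mu g & sq_cvg mu u g.
Proof.
move=> ui cauchy.
have [N NP] : exists N : nat -> nat, forall k n m, (N k <= n)%N -> (N k <= m)%N ->
    (sqint mu (fun x => (u n x - u m x)%R) <= (8 ^- k)%:E)%E.
  have ex k : exists N, forall n m, (N <= n)%N -> (N <= m)%N ->
      (sqint mu (fun x => (u n x - u m x)%R) <= (8 ^- k)%:E)%E.
    by apply: cauchy; rewrite invr_gt0 exprn_gt0.
  by exists (fun k => projT1 (cid (ex k))) => k; exact: projT2 (cid (ex k)).
pose phi k := (k + \sum_(i < k.+1) N i)%N.
have phi_ge k : (k <= phi k)%N by exact: leq_addr.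
have phiN k : (N k <= phi k)%N.
  by rewrite /phi big_ord_recr/= addnA leq_addl.
have phiS k : (phi k <= phi k.+1)%N.
  by rewrite /phi [in leqRHS]big_ord_recr/= addSn leqW// leq_add2l leq_addr.
have [g mg vg] := @fast_sq_cauchy_cvg_ae (fun k => u (phi k)) (fun k => ui _)
  (fun k => NP k _ _ (leq_trans (phiN k) (phiS k)) (phiN k)).
have close e : 0 < e -> exists M, forall n, (M <= n)%N ->
    (sqint mu (fun x => (u n x - g x)%R) <= e%:E)%E.
  move=> e0; have [M MP] := cauchy e e0; exists M => n Mn.
  have mun := proj1 (ui n).
  apply: (@fatou_bound _ _ _ mu (fun k x => normc (u n x - u (phi (k + M)%N) x) ^+ 2)).
  - by move=> k; apply: measurable_normc_sqr; exact: cmeasurableB mun (proj1 (ui _)).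
  - by move=> k x; exact: sqr_ge0.
  - by apply: measurable_normc_sqr; exact: cmeasurableB.
  - by move=> x; exact: sqr_ge0.
  - apply: filterS vg => x vx.
    have {}vx : normc (u (phi (k + M)%N) x - g x) @[k --> \oo] --> (0 : R).
      by rewrite -(cvg_shiftn M (fun k => normc (u (phi k) x - g x))) in vx.
    set z := fun k => normc (u n x - u (phi (k + M)%N) x); set c := normc _.
    have zc : z k @[k --> \oo] --> c.
      apply/cvgrPdist_le => e1 e1gt0.
      move/cvgr0Pnorm_le : vx => /(_ _ e1gt0); apply: filterS => k.
      rewrite ger0_norm ?normc_ge0//; apply: le_trans.
      apply: le_trans (normc_dist _ _) _.
      by rewrite opprB [X in normc X](_ : _ = u (phi (k + M)%N) x - g x)//; ring.
    have : z k * z k @[k --> \oo] --> c * c by exact: cvgM.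
    by apply: cvg_trans; apply: near_eq_cvg; near=> k; rewrite expr2.
  - move=> k; apply: MP => //; exact: leq_trans (leq_addl _ _) (phi_ge _).
exists g.
  have [M MP] := close 1 ltr01.
  have -> : g = fun x => u M x - (u M x - g x) by apply/funext => x; rewrite opprB addrC subrK.
  have mM := proj1 (ui M).
  apply: sq_integrableB => //; split; first exact: cmeasurableB.
  exact: le_lt_trans (MP M (leqnn _)) (ltry _).
by apply: null_eventuallyP => // n; exact: sqint_ge0.
Unshelve. all: end_near. Qed.

End completeness.

(** * Extension of an isometric transform to square-integrable functions *)

Lemma Re_inner_polar d (T : measurableType d) (R : realType)
    (mu : {measure set T -> \bar R}) (f g : T -> R[i]) :
  sq_integrable mu f -> sq_integrable mu g ->
  Re (cint mu (fun x => f x * conjc (g x))) =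
  4^-1 * (fine (sqint mu (fun x => f x + g x)) - fine (sqint mu (fun x => f x - g x))).
Proof.
move=> fi gi.
have sqR h : sq_integrable mu h ->
    mu.-integrable setT (EFin \o (fun x => normc (h x) ^+ 2)).
  move=> [mh hi]; apply/integrableP; split.
    exact: measurable_sqint_integrand.
  by under eq_integral do rewrite gee0_abs ?lee_fin ?sqr_ge0//.
rewrite -[RHS]/(4^-1 * (\int[mu]_x (normc (f x + g x) ^+ 2) -
                       \int[mu]_x (normc (f x - g x) ^+ 2))).
have ip := sqR _ (sq_integrableD fi gi); have im := sqR _ (sq_integrableB fi gi).
rewrite -RintegralB// -RintegralZl//; last first.
  by apply: eq_integrable (integrableB measurableT ip im).
by apply: eq_Rintegral => x _; rewrite !normc_sqr !ReImE; field.
Qed.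

Section extension.
Context {d1 d2} {T1 : measurableType d1} {T2 : measurableType d2} {R : realType}.
Context (m1 : {sigma_finite_measure set T1 -> \bar R}).
Context (m2 : {sigma_finite_measure set T2 -> \bar R}).
Context (k : T1 -> T2 -> R[i]) (c : R) (P : plancherel_kernel m1 m2 k c).
Context (c0 : 0 < c).
Implicit Types (f g : T1 -> R[i]) (u v : nat -> T1 -> R[i]).
Local Notation T := (transform m1 k).

Let mk : kernel_measurable k. Proof. by case: P. Qed.
Let k1 x y : normc (k x y) <= 1. Proof. by case: P => _ ->. Qed.
Let kP f : cintegrable m1 f -> sqint m2 (T f) = (c%:E * sqint m1 f)%E.
Proof. by case: P => _ _; apply. Qed.

Definition integrable12 f := cintegrable m1 f /\ sq_integrable m1 f.

Lemma sq_integrable_transform f : integrable12 f -> sq_integrable m2 (T f).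
Proof.
move=> [fi [mf f2]]; split; first exact: cmeasurable_transform.
by rewrite kP// lte_mul_pinfty// lee_fin ltW.
Qed.

(** [g] is the transform of the square-integrable function [f], witnessed by one
    approximating sequence. *)
Definition is_transform2 f (g : T2 -> R[i]) := sq_integrable m2 g /\
  exists u, [/\ forall n, integrable12 (u n), sq_cvg m1 u f &
    sq_cvg m2 (fun n => T (u n)) g].

(** The transform being an isometry up to a constant, the transforms of an
    approximating sequence form a Cauchy sequence, and those of two approximating
    sequences stay close. *)
Lemma transform2_exists f : sq_integrable m1 f ->
  exists2 g, sq_integrable m2 g & forall u, (forall n, integrable12 (u n)) ->
    sq_cvg m1 u f -> sq_cvg m2 (fun n => T (u n)) g.
Proof.
move=> fi; have [u [ui uf]] := sq_integrable_truncation fi.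
have TB v w n m : integrable12 (v n) -> integrable12 (w m) ->
    sqint m2 (fun y => T (v n) y - T (w m) y) =
    (c%:E * sqint m1 (fun x => (v n x - w m x)%R))%E.
  move=> [vi _] [wi _]; rewrite -kP; last exact: cintegrableB.
  by congr sqint; apply/funext => y; rewrite transformB.
have [g gi Tg] : exists2 g, sq_integrable m2 g & sq_cvg m2 (fun n => T (u n)) g.
  apply: sq_complete => [n|e e0]; first exact: sq_integrable_transform.
  have e4 : 0 < e / (4 * c) by rewrite divr_gt0// mulr_gt0.
  have [N NP] := null_eventually_le uf e4; exists N => n m Nn Nm.
  rewrite TB// -lee_pdivlMl//.
  have mu n' := proj1 (proj1 (ui n')).
  apply: le_trans (sqint_triangle m1 (mu n) (proj1 fi) (mu m)) _.
  rewrite (sqintC m1 f).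
  apply: (@le_trans _ _ (2%:E * (e / (4 * c))%:E + 2%:E * (e / (4 * c))%:E)%E).
    by apply: leeD; rewrite lee_wpmul2l ?lee_fin// NP.
  rewrite -!EFinM -EFinD lee_fin.
  rewrite le_eqVlt; apply/orP; left; apply/eqP; field.
  by rewrite gt_eqF.
exists g; first exact: gi.
move=> v vi vf.
have mu n := proj1 (proj1 (ui n)); have mv n := proj1 (proj1 (vi n)).
have mT n := cmeasurable_transform m1 mk (mu n).
have mTv n := cmeasurable_transform m1 mk (mv n).
have vu : sqint m2 (fun y => T (v n) y - T (u n) y) @[n --> \oo] --> 0%E.
  have vu1 : sqint m1 (fun x => v n x - u n x) @[n --> \oo] --> 0%E.
    apply: squeeze_null vf uf => n; first exact: sqint_ge0.
    apply: le_trans (sqint_triangle m1 (mv n) (proj1 fi) (mu n)) _.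
    by rewrite (sqintC m1 f).
  rewrite (_ : (fun n => _) = (fun n => c%:E * sqint m1 (fun x => (v n x - u n x)%R))%E).
    by rewrite -[X in _ --> X](mule0 c%:E); apply: cvgeZl.
  by apply/funext => n; rewrite TB.
apply: squeeze_null vu Tg => n; first exact: sqint_ge0.
exact: sqint_triangle (mTv n) (mT n) (proj1 gi).
Qed.

Lemma is_transform2_exists f : sq_integrable m1 f -> exists g : T2 -> R[i], is_transform2 f g.
Proof.
move=> fi; have [g gi H] := transform2_exists fi; exists g; split => //.
have [u [ui uf]] := sq_integrable_truncation fi; exists u.
by split; [exact: ui|exact: uf|exact: H].
Qed.

Let parseval12 f g : integrable12 f -> integrable12 g ->
  cint m2 (fun y => T f y * conjc (T g y)) =
  c%:C * cint m1 (fun x => f x * conjc (g x)).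
Proof.
have parsevalRe f1 g1 : integrable12 f1 -> integrable12 g1 ->
    Re (cint m2 (fun y => T f1 y * conjc (T g1 y))) =
    c * Re (cint m1 (fun x => f1 x * conjc (g1 x))).
  move=> fi gi; have [fi1 fi2] := fi; have [gi1 gi2] := gi.
  rewrite !Re_inner_polar//; [|exact: sq_integrable_transform..].
  have -> : (fun y => T f1 y + T g1 y) = T (fun x => f1 x + g1 x).
    by apply/funext => y; rewrite transformD.
  have -> : (fun y => T f1 y - T g1 y) = T (fun x => f1 x - g1 x).
    by apply/funext => y; rewrite transformB.
  have [_ s1] := sq_integrableD fi2 gi2; have [_ s2] := sq_integrableB fi2 gi2.
  rewrite kP; last exact: cintegrableD.
  rewrite kP; last exact: cintegrableB.
  by rewrite !fineM// ?ge0_fin_numE ?sqint_ge0// -mulrBr mulrCA.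
move=> fi gi; have [fi1 fi2] := fi; have [gi1 gi2] := gi.
apply: complex_ext; rewrite [RHS]ReImE /= mul0r ?subr0 ?addr0; first exact: parsevalRe.
(* the imaginary part is the real part of the pairing with [i * g] *)
pose j : R[i] := 0 +i* 1.
have jgi : integrable12 (fun x => j * g x).
  split; first exact: cintegrableZ.
  split; first by apply: cmeasurableM (proj1 gi2); exact: cmeasurable_cst.
  rewrite sqintZ; last exact: (proj1 gi2).
  by rewrite normc_sqr /= expr0n expr1n add0r mul1e; case: gi2.
have := parsevalRe _ _ fi jgi.
have Imj d (U : measurableType d) (mu : {measure set U -> \bar R}) (a b : U -> R[i]) :
    cintegrable mu (fun x => a x * conjc (b x)) ->
    Re (cint mu (fun x => a x * conjc (j * b x))) = Im (cint mu (fun x => a x * conjc (b x))).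
  move=> abi; have -> : (fun x => a x * conjc (j * b x)) = (fun x => (- j) * (a x * conjc (b x))).
    by apply/funext => x; apply: complex_ext; rewrite !ReImE /=; ring.
  by rewrite cintZ// !ReImE /=; ring.
have -> : T (fun x => j * g x) = (fun y => j * T g y).
  apply/funext => y; rewrite /transform -cintZ; last exact: cintegrable_transform.
  by apply: eq_cint => x; rewrite mulrA.
rewrite !Imj//; [exact: sq_integrableM|].
by apply: sq_integrableM; exact: sq_integrable_transform.
Qed.

(** Polarization proves it for functions that are moreover integrable, and both
    inner products are continuous. *)
Lemma parseval f g (f' g' : T2 -> R[i]) : sq_integrable m1 f -> sq_integrable m1 g ->
  is_transform2 f f' -> is_transform2 g g' ->
  cint m2 (fun y => f' y * conjc (g' y)) = c%:C * cint m1 (fun x => f x * conjc (g x)).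
Proof.
move=> fi gi [f'i [u [ui uf Tu]]] [g'i [v [vi vg Tv]]].
have h1 := sq_cvg_inner (fun n => proj2 (ui n)) (fun n => proj2 (vi n)) fi gi uf vg.
have h2 := sq_cvg_inner (fun n => sq_integrable_transform (ui n))
  (fun n => sq_integrable_transform (vi n)) f'i g'i Tu Tv.
set a := cint m2 _; set b := cint m1 _.
have : normc (a - c%:C * b) @[n --> \oo] --> (0 + c * 0 : R).
  have t : normc (cint m2 (fun x => T (u n) x * conjc (T (v n) x)) - a) +
      c * normc (cint m1 (fun x => u n x * conjc (v n x)) - b) @[n --> \oo] --> (0 + c * 0 : R).
    by apply: cvgD h2 _; apply: cvgMr.
  apply: (@squeeze_cvgr _ _ _ _ (fun=> 0) _ _ _ _ _ t); last first.
    by rewrite mulr0 addr0; exact: cvg_cst.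
  apply: nearW => n; rewrite normc_ge0 andTb parseval12//.
  set z := cint m1 _.
  have -> : c * normc (z - b) = normc (c%:C * (z - b)).
    by rewrite normc_mul normc_real ger0_norm// ltW.
  rewrite -(normc_opp (c%:C * z - a)).
  apply: le_trans (normc_add _ _).
  by rewrite [X in _ <= normc X](_ : _ = a - c%:C * b)//; ring.
rewrite mulr0 addr0 => H.
have : normc (a - c%:C * b) = 0.
  by rewrite -(cvg_lim (@Rhausdorff R) H); apply/esym/cvg_lim => //; exact: cvg_cst.
by move/eqP; rewrite normc_eq0 subr_eq0 => /eqP.
Qed.

Lemma sqint_transform2 f (f' : T2 -> R[i]) : sq_integrable m1 f -> is_transform2 f f' ->
  sqint m2 f' = (c%:E * sqint m1 f)%E.
Proof.
move=> fi ff'; have := parseval fi fi ff' ff'; have [f'i _] := ff'.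
have sqE d (U : measurableType d) (mu : {measure set U -> \bar R}) (h : U -> R[i]) :
    sq_integrable mu h -> cint mu (fun x => h x * conjc (h x)) = (fine (sqint mu h))%:C.
  by move=> hi; under eq_cint do rewrite mulc_conj; rewrite cint_real.
rewrite !sqE// => /(congr1 (@complex.Re R)); rewrite ReM /= mul0r subr0 => E.
have ffin : sqint m1 f \is a fin_num by rewrite ge0_fin_numE ?sqint_ge0//; case: fi.
have f'fin : sqint m2 f' \is a fin_num by rewrite ge0_fin_numE ?sqint_ge0//; case: f'i.
by rewrite -(fineK ffin) -(fineK f'fin) E EFinM.
Qed.

End extension.

(** * Lebesgue measure and the Fourier transform on the Euclidean space *)

Section euclidean.
Context {R : realType}.
Local Notation L := (measurableTypeR R).
Local Notation leb := (@lebesgue_measure R).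

Lemma measurable_coord n (i : 'I_n) : measurable_fun setT (fun x : Rn R n => coord x i).
Proof. exact: measurable_tnth. Qed.

Lemma measurable_mktuple d (T : measurableType d) n (f : T -> 'I_n -> L) :
  (forall i, measurable_fun setT (fun x => f x i)) ->
  measurable_fun setT (fun x => [tuple f x i | i < n] : Rn R n).
Proof.
move=> mf; apply/measurable_fun_tnthP => i.
rewrite (_ : _ \o _ = f^~ i)//.
by apply/funext => x; rewrite /comp tnth_mktuple.
Qed.

Lemma measurable_inner n : measurable_fun setT (fun z : Rn R n * Rn R n => inner z.1 z.2).
Proof.
apply: measurable_sum => i; apply: measurable_funM.
- exact: (measurableT_comp (measurable_coord i) measurable_fst).
- exact: (measurableT_comp (measurable_coord i) measurable_snd).
Qed.

Lemma enorm_sqr n (x : Rn R n) : enorm x ^+ 2 = inner x x.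
Proof.
rewrite /enorm sqr_sqrtr; last by apply: sumr_ge0 => i _; exact: sqr_ge0.
by apply: eq_bigr => i _; rewrite expr2.
Qed.

Lemma measurable_enorm_sqr n : measurable_fun setT (fun x : Rn R n => enorm x ^+ 2).
Proof.
under eq_fun do rewrite enorm_sqr.
have mp : measurable_fun setT (fun x : Rn R n => (x, x)).
  by apply/measurable_fun_pairP; split; exact: measurable_id.
exact: (measurableT_comp (measurable_inner (n := n)) mp).
Qed.

Lemma absprod_ge0 n (x : Rn R n) : 0 <= absprod x.
Proof. exact: normr_ge0. Qed.

Lemma measurable_absprod n : measurable_fun setT (@absprod R n).
Proof.
apply: measurableT_comp => //.
apply: (measurable_prod (h := fun i (x : Rn R n) => coord x i)) => i _.
exact: measurable_coord.
Qed.

Lemma inner_consn n (x y : L) (t u : Rn R n) :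
  inner (consn (x, t)) (consn (y, u)) = (x : R) * y + inner t u.
Proof.
rewrite /inner big_ord_recl /coord /consn; congr (_ + _).
by apply: eq_bigr => i _; rewrite !tnthS.
Qed.

Lemma absprod_consn n (x : L) (t : Rn R n) :
  absprod (consn (x, t)) = `|x : R| * absprod t.
Proof.
rewrite /absprod big_ord_recl normrM; congr (_ * `| _ |).
by apply: eq_bigr => i _; rewrite /coord tnthS.
Qed.

(** The factor 1 gives this the form of the change-of-variables formulas. *)
Lemma ge0_integral_lebnS n (f : Rn R n.+1 -> \bar R) :
  measurable_fun setT f -> (forall x, 0 <= f x)%E ->
  (\int[prodm leb (lebn R n)]_z f (consn z) = 1%:E * \int[lebn R n.+1]_x f x)%E.
Proof.
move=> mf f0; rewrite mul1e.
pose m : {measure set (Rn R n.+1) -> \bar R} :=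
  measure_function_pushforward__canonical__measure_function_Measure
    (prodm leb (lebn R n)) (@measurable_consn R n).
transitivity (\int[m]_x f x)%E; last by apply: eq_measure_integral.
by rewrite [RHS](ge0_integral_pushforward (@measurable_consn R n)).
Qed.

Lemma integral_lebn0 (f : Rn R 0 -> \bar R) : measurable_fun setT f ->
  (\int[lebn R 0]_x f x = f [tuple])%E.
Proof.
move=> mf.
transitivity (\int[dirac ([tuple] : Rn R 0)]_x f x)%E; first by apply: eq_measure_integral.
by rewrite integral_dirac// diracT mul1e.
Qed.

Definition affn n (a b x : Rn R n) : Rn R n := divv (subv x b) a.

Lemma coord_affn n (a b x : Rn R n) i : coord (affn a b x) i = (coord x i - coord b i) / coord a i.
Proof. by rewrite /affn /divv /subv /coord !tnth_mktuple. Qed.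

Lemma measurable_affn n (a b : Rn R n) : measurable_fun setT (affn a b).
Proof.
apply: measurable_mktuple => i.
rewrite (_ : (fun x => _) = affine (coord a i) (coord b i) \o (fun x => tnth x i)).
  by apply: measurableT_comp; [exact: measurable_affine|exact: measurable_tnth].
by apply/funext => x; rewrite /affine /subv /coord tnth_mktuple.
Qed.

Lemma affn_consn n (a0 b0 x : L) (a b t : Rn R n) :
  affn (consn (a0, a)) (consn (b0, b)) (consn (x, t)) =
  consn (affine a0 b0 x, affn a b t).
Proof.
apply: eq_from_tnth => i; rewrite -[LHS]/(coord _ i) coord_affn /coord.
case: (unliftP ord0 i) => [j|] -> //.
by rewrite !tnthS -[RHS]/(coord _ j) coord_affn.
Qed.

Lemma ge0_integral_affn n (a b : Rn R n) (f : Rn R n -> \bar R) : Rn0 a ->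
  measurable_fun setT f -> (forall x, 0 <= f x)%E ->
  (\int[lebn R n]_x f (affn a b x) = (absprod a)%:E * \int[lebn R n]_x f x)%E.
Proof.
elim: n a b f => [|n IH] a b f.
  move=> _ mf _; rewrite !integral_lebn0//; last first.
    exact: (measurableT_comp mf (measurable_affn a b)).
  by rewrite /absprod big_ord0 normr1 mul1e; congr f; exact: tuple0.
case/tupleP: a => a0 a; case/tupleP: b => b0 b.
rewrite -[[tuple of a0 :: a]]/(consn (a0, a)) -[[tuple of b0 :: b]]/(consn (b0, b)).
rewrite /Rn0 /= absprod_consn mulf_eq0 negb_or normr_eq0 => /andP[a00 an0] mf f0.
have mfa : measurable_fun setT (fun x => f (affn (consn (a0, a)) (consn (b0, b)) x)).
  exact: (measurableT_comp mf (measurable_affn _ _)).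
rewrite -[LHS]mul1e -ge0_integral_lebnS//.
rewrite -[in RHS](mul1e (\int[lebn R n.+1]_x f x)%E) -ge0_integral_lebnS//.
have mfc : measurable_fun setT (fun z => f (consn z)).
  exact: (measurableT_comp mf (@measurable_consn R n)).
have mfac := measurableT_comp mfa (@measurable_consn R n).
have I1 := integral_prodm leb (lebn R n) mfac (fun=> f0 _).
have I2 := integral_prodm leb (lebn R n) mfc (fun=> f0 _).
apply: etrans I1 _; apply: etrans (congr1 (fun z => _ * z)%E (esym I2)).
have mg := ge0_measurable_integral1 (lebn R n) mfc (fun=> f0 _).
pose g x := (\int[lebn R n]_t f (consn (x, t)))%E.
have E x : (\int[lebn R n]_t f (affn (consn (a0, a)) (consn (b0, b)) (consn (x, t))) =
    (absprod a)%:E * g (affine a0 b0 x))%E.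
  rewrite /g -(IH a b)//; first by apply: eq_integral => t _; rewrite affn_consn.
  by apply: (measurableT_comp mfc); exact: pair1_measurable.
under eq_integral do rewrite E.
have g0 x : (0 <= g x)%E by apply: integral_ge0.
have mga : measurable_fun setT (fun x => g (affine a0 b0 x)).
  by apply: (measurableT_comp mg); exact: measurable_affine.
transitivity ((absprod a)%:E * \int[leb]_x g (affine a0 b0 x))%E.
  by apply: ge0_integralZl => //; rewrite lee_fin absprod_ge0.
rewrite (ge0_integral_affine b0 a00 mg g0) muleA -EFinM mulrC.
by [].
Qed.

Definition fourier_kernel_n n (s : R) (x xi : Rn R n) : R[i] := expi (- (s * inner x xi)).

(** The kernel on R^(n+1) is the product of those on R and on R^n. *)
Lemma plancherel_fourier_n n (s : R) : s != 0 ->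
  plancherel_kernel (lebn R n) (lebn R n) (@fourier_kernel_n n s) (fourier_const s ^+ n).
Proof.
move=> s0.
have mker m : kernel_measurable (@fourier_kernel_n m s).
  apply: cmeasurable_expi; apply: measurableT_comp => //.
  by apply: measurable_funM => //; exact: measurable_inner.
elim: n => [|n IH]; split; [exact: mker|by move=> x y; exact: normc_expi| |
  exact: mker|by move=> x y; exact: normc_expi|].
  move=> w [mw wi]; rewrite expr0 mul1e; congr sqint; apply/funext => y.
  rewrite /transform.
  have E0 : (fun x => w x * fourier_kernel_n s x y) = w.
    by apply/funext => x; rewrite /fourier_kernel_n /inner big_ord0 mulr0 oppr0 expi0 mulr1.
  have mE (u : Rn R 0 -> R) : measurable_fun setT u -> \int[lebn R 0]_x u x = u y.
    move=> mu; rewrite /Rintegral integral_lebn0/=; last exact/measurable_EFinP.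
    by congr u; apply/esym/tuple0.
  rewrite E0; apply: complex_ext => /=; rewrite mE//; by case: mw.
move=> w wi; have mw := proj1 wi.
have phiE := @ge0_integral_lebnS n.
have wci := cintegrable_comp (@measurable_consn R n) phiE wi.
have TE z : transform (lebn R n.+1) (fourier_kernel_n s) w (consn z) =
    transform (prodm leb (lebn R n))
      (fun p q => fourier_kernel s p.1 q.1 * fourier_kernel_n s p.2 q.2)
      (fun p => w (consn p)) z.
  rewrite /transform -[LHS]mul1r.
  have ki : cintegrable (lebn R n.+1) (fun x => w x * fourier_kernel_n s x (consn z)).
    by apply: cintegrable_transform => // x y; rewrite normc_expi.
  rewrite -(cint_comp phiE ki); apply: eq_cint => -[x t]; case: z {ki} => y u.
  congr (_ * _); rewrite /fourier_kernel_n /fourier_kernel -expiD inner_consn /=.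
  by congr expi; ring.
have [_ _ PP] := plancherel_kernel_prod (ltW (fourier_const_gt0 s0))
  (exprn_ge0 n (ltW (fourier_const_gt0 s0))) (plancherel_fourier_line s0) IH.
rewrite -[LHS]mul1e -(sqint_comp phiE); last exact: cmeasurable_transform.
rewrite [LHS](_ : _ = sqint (prodm leb (lebn R n)) (transform (prodm leb (lebn R n))
      (fun p q => fourier_kernel s p.1 q.1 * fourier_kernel_n s p.2 q.2)
      (fun p => w (consn p)))); last by congr sqint; apply/funext => z; exact: TE.
by rewrite PP// (sqint_comp phiE)// mul1e exprS.
Qed.

End euclidean.

(** * The fractional Fourier transform *)

Section lebesgue_spaces.
Context {R : realType} {n : nat}.
Local Notation lb := (lebn R n).
Implicit Types (f g : Rn R n -> R[i]) (u : nat -> Rn R n -> R[i]).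

Lemma cLp1P f : cLp 1%:E f <-> cintegrable lb f.
Proof.
have E : cLnorm 1%:E f = (\int[lb]_x (normc (f x))%:E)%E.
  rewrite /cLnorm Lnorm1; apply: eq_integral => x _.
  by rewrite gee0_abs// lee_fin normc_ge0.
by rewrite /cLp E; split=> [[mr mi fi]|[[mr mi] fi]].
Qed.

Lemma cLnorm2_poweR f : (cLnorm 2%:E f `^ 2 = sqint lb f)%E.
Proof.
rewrite /cLnorm poweR_Lnorm ?pnatr_eq0//; apply: eq_integral => x _.
rewrite gee0_abs ?lee_fin ?normc_ge0// poweR_EFin powR_mulrn//; exact: normc_ge0.
Qed.

Lemma cLnorm2E f : (cLnorm 2%:E f = sqint lb f `^ 2^-1)%E.
Proof.
rewrite -cLnorm2_poweR -poweRrM divff ?pnatr_eq0// poweRe1//.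
exact: Lnorm_ge0.
Qed.

Lemma cLp2P f : cLp 2%:E f <-> sq_integrable lb f.
Proof.
split=> [[mr mi fi]|[[mr mi] fi]]; split => //.
  by rewrite -cLnorm2_poweR poweR_lty.
by rewrite cLnorm2E poweR_lty.
Qed.

Lemma L2_cvgP u f : L2_cvg u f <-> sq_cvg lb u f.
Proof.
have mono (r : R) (x y : \bar R) : 0 <= r -> (0 <= x)%E -> (0 <= y)%E -> (x <= y)%E ->
    (x `^ r <= y `^ r)%E.
  by move=> r0 x0 y0; apply: gt0_ler_poweR => //; rewrite in_itv/= ?x0 ?y0 leey.
split => H; apply: null_eventuallyP => [m|e e0]; [exact: sqint_ge0| |exact: Lnorm_ge0|].
- have se : 0 < Num.sqrt e by rewrite sqrtr_gt0.
  have [N NP] := null_eventually_le H se; exists N => m Nm.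
  rewrite -cLnorm2_poweR -[e](sqr_sqrtr (ltW e0)) -powR_mulrn ?sqrtr_ge0//.
  by rewrite -poweR_EFin mono ?lee_fin ?sqrtr_ge0//; [exact: Lnorm_ge0|exact: NP].
- have e2 : 0 < e ^+ 2 by exact: exprn_gt0.
  have [N NP] := null_eventually_le H e2; exists N => m Nm.
  have -> : e%:E = ((e ^+ 2)%:E `^ 2^-1)%E.
    by rewrite poweR_EFin -powR_mulrn ?ltW// -powRrM divff ?pnatr_eq0// powRr1// ltW.
  by rewrite cLnorm2E mono ?lee_fin ?invr_ge0 ?ler0n ?(ltW e2)//; [exact: sqint_ge0|exact: NP].
Qed.

End lebesgue_spaces.

Section frft.
Context {R : realType} {n : nat} (alpha : R) (sin_neq0 : sin alpha != 0).
Local Notation lb := (lebn R n).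
Local Notation ct := (cot alpha).
Local Notation sc := (csc alpha).
Local Notation C := (fourier_const sc ^+ n).
Local Notation Ca := (@Calpha R n alpha).
Implicit Types (f g : Rn R n -> R[i]).

(** [Kalpha] divided by its constant [Calpha], hence of modulus 1. *)
Definition frft_kernel (x xi : Rn R n) : R[i] :=
  expi ((enorm x ^+ 2 + enorm xi ^+ 2) * ct / 2 - inner x xi * sc).
Local Notation K := frft_kernel.

Lemma csc_neq0 : sc != 0. Proof. by rewrite invr_neq0. Qed.

Lemma frft_const_gt0 : 0 < C.
Proof. by rewrite exprn_gt0// fourier_const_gt0// csc_neq0. Qed.

Lemma plancherel_frft : plancherel_kernel lb lb K C.
Proof.
have mq : measurable_fun setT (fun x : Rn R n => enorm x ^+ 2 * (ct / 2)).
  by apply: measurable_funM => //; exact: measurable_enorm_sqr.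
have := plancherel_kernel_modulation mq mq (plancherel_fourier_n n csc_neq0).
congr plancherel_kernel; apply/funext => x; apply/funext => xi.
by rewrite /fourier_kernel_n -!expiD; congr expi; ring.
Qed.

Lemma Calpha_neq0 : Ca != 0.
Proof.
rewrite -normc_eq0 /Calpha /cpow normc_mul normc_expi mulr1 normc_real normr_eq0.
rewrite gt_eqF// powR_gt0// lt_neqAle eq_sym normc_ge0 normc_eq0 andbT.
rewrite mulf_neq0 ?invr_eq0//.
  by apply/eqP => /(congr1 (@complex.Re R))/=/eqP; rewrite oner_eq0.
apply/eqP => /(congr1 (@complex.Re R))/=/eqP.
by apply/negP; rewrite mulf_neq0 ?pnatr_eq0//; exact: lt0r_neq0 (pi_gt0 R).
Qed.

Let mK : kernel_measurable K. Proof. by case: plancherel_frft. Qed.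
Let K1 x y : normc (K x y) <= 1. Proof. by rewrite normc_expi. Qed.

Lemma frft1E f : cintegrable lb f -> frft1 alpha f = (fun xi => Ca * transform lb K f xi).
Proof.
move=> fi; apply/funext => xi; rewrite /transform -cintZ; last exact: cintegrable_transform.
by apply: eq_cint => x; rewrite /Kalpha -/(K x xi) mulrCA.
Qed.

(** [is_frft2] quantifies over all approximating sequences, and so does
    [transform2_exists]. *)
Lemma is_frft2_exists f : sq_integrable lb f -> exists g, is_frft2 alpha f g.
Proof.
move=> fi; have [g gi gP] := transform2_exists plancherel_frft frft_const_gt0 fi.
have mg := proj1 gi.
exists (fun xi => Ca * g xi); split.
  apply/cLp2P; split; first by apply: cmeasurableM mg; exact: cmeasurable_cst.
  by rewrite sqintZ// lte_mul_pinfty// ?lee_fin ?sqr_ge0//; case: gi.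
move=> u ui /L2_cvgP uf; apply/L2_cvgP.
have ui' m : integrable12 lb (u m) by have [/cLp1P ? /cLp2P ?] := ui m.
have Tg := gP u ui' uf.
have mT m := cmeasurable_transform lb mK (proj1 (proj1 (ui' m))).
rewrite /sq_cvg (_ : (fun m => _) = (fun m => (normc Ca ^+ 2)%:E *
    sqint lb (fun x => (transform lb K (u m) x - g x)%R))%E).
  by rewrite -[X in _ --> X](mule0 (normc Ca ^+ 2)%:E); apply: cvgeZl.
apply/funext => m; rewrite -sqintZ; last exact: cmeasurableB.
congr sqint; apply/funext => x; rewrite (frft1E (proj1 (ui' m))).
by rewrite mulrBr.
Qed.

Lemma is_frft2_transform2 f g : sq_integrable lb f -> is_frft2 alpha f g ->
  is_transform2 lb lb K f (fun xi => Ca^-1 * g xi).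
Proof.
move=> fi [/cLp2P gi gP]; have mg := proj1 gi.
split.
  split; first by apply: cmeasurableM mg; exact: cmeasurable_cst.
  by rewrite sqintZ// lte_mul_pinfty// ?lee_fin ?sqr_ge0//; case: gi.
have [u [ui uf]] := sq_integrable_truncation fi; exists u; split => //.
have ui' m : cLp 1%:E (u m) /\ cLp 2%:E (u m) by split; [apply/cLp1P|apply/cLp2P]; case: (ui m).
have /L2_cvgP Tg := gP u ui' (proj2 (L2_cvgP u f) uf).
have mT m := cmeasurable_transform lb mK (proj1 (proj1 (ui m))).
rewrite /sq_cvg (_ : (fun m => _) = (fun m => (normc Ca^-1 ^+ 2)%:E *
    sqint lb (fun x => (frft1 alpha (u m) x - g x)%R))%E).
  by rewrite -[X in _ --> X](mule0 (normc Ca^-1 ^+ 2)%:E); apply: cvgeZl.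
apply/funext => m; rewrite (frft1E (proj1 (ui m))) -sqintZ; last first.
  by apply: cmeasurableB => //; apply: cmeasurableM => //; exact: cmeasurable_cst.
congr sqint; apply/funext => x.
by rewrite mulrBr mulKf// Calpha_neq0.
Qed.

Lemma frft2_transform2 f : sq_integrable lb f ->
  is_transform2 lb lb K f (fun xi => Ca^-1 * frft2 alpha f xi).
Proof.
move=> fi; apply: is_frft2_transform2 => //.
exact: (xgetPex (fun=> 0) (is_frft2_exists fi)).
Qed.

End frft.

(** * Wavelets seen from the Fourier side *)

Section dilation.
Context {R : realType} {n : nat}.
Implicit Types (a b x y xi : Rn R n).

Definition mulv a x : Rn R n := [tuple coord a i * coord x i | i < n].

Lemma coord_mulv a x i : coord (mulv a x) i = coord a i * coord x i.
Proof. by rewrite /coord /mulv tnth_mktuple. Qed.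

Lemma mulvC a x : mulv a x = mulv x a.
Proof. by apply: eq_from_tnth => i; rewrite !tnth_mktuple mulrC. Qed.

Lemma measurable_mulv :
  measurable_fun setT (fun z : Rn R n * Rn R n => mulv z.1 z.2).
Proof.
apply: measurable_mktuple => i; apply: measurable_funM.
- exact: (measurableT_comp (measurable_coord i) measurable_fst).
- exact: (measurableT_comp (measurable_coord i) measurable_snd).
Qed.

Lemma measurable_mulv1 a : measurable_fun setT (mulv a).
Proof. exact: (measurableT_comp measurable_mulv (pair1_measurable a)). Qed.

Lemma absprodM a x : absprod (mulv a x) = absprod a * absprod x.
Proof.
rewrite /absprod -normrM -big_split/=; congr (`| _ |).
by apply: eq_bigr => i _; rewrite coord_mulv.
Qed.

Lemma Rn0P a : Rn0 a <-> forall i, coord a i != 0.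
Proof.
rewrite /Rn0 /= /absprod normr_eq0.
by split=> [/prodf_neq0 H i|H]; [exact: H|apply/prodf_neq0 => i _; exact: H].
Qed.

Lemma ge0_integral_mulv a (f : Rn R n -> \bar R) : Rn0 a ->
  measurable_fun setT f -> (forall x, 0 <= f x)%E ->
  (\int[lebn R n]_x f (mulv a x) = (absprod a)^-1%:E * \int[lebn R n]_x f x)%E.
Proof.
move=> a0 mf f0.
pose a' : Rn R n := [tuple (coord a i)^-1 | i < n].
have a'E i : coord a' i = (coord a i)^-1 by rewrite /coord tnth_mktuple.
have -> : (absprod a)^-1 = absprod a'.
  rewrite /absprod -normfV -prodfV; congr (`| _ |).
  by apply: eq_bigr => i _; rewrite a'E.
pose o : Rn R n := [tuple 0 | i < n].
rewrite -(ge0_integral_affn o) //; last first.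
  by apply/Rn0P => i; rewrite a'E invr_neq0//; move/Rn0P : a0.
apply: eq_integral => x _; congr f; apply: eq_from_tnth => i.
rewrite -[LHS]/(coord _ i) -[RHS]/(coord _ i) coord_mulv coord_affn a'E invrK.
have -> : coord o i = 0 by rewrite /coord tnth_mktuple.
by rewrite subr0 mulrC.
Qed.

Lemma inner_mulv_affn a b t xi : Rn0 a ->
  inner t xi = inner (affn a b t) (mulv a xi) + inner b xi.
Proof.
move=> /Rn0P a0; rewrite /inner -big_split/=; apply: eq_bigr => i _.
by rewrite coord_affn coord_mulv; field; rewrite a0.
Qed.

End dilation.

Section wavelet_lift.
Context {R : realType} {n : nat} (alpha : R) (sin_neq0 : sin alpha != 0).
Local Notation lb := (lebn R n).
Local Notation ct := (cot alpha).
Local Notation sc := (csc alpha).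
Local Notation C := (fourier_const sc ^+ n).
Local Notation K := (@frft_kernel R n alpha).
Local Notation T := (transform lb K).
Implicit Types (f g phi psi : Rn R n -> R[i]).

Let q (x : Rn R n) : R := enorm x ^+ 2 * ct / 2.

Let mq : measurable_fun setT q.
Proof.
rewrite (_ : q = fun x => enorm x ^+ 2 * (ct / 2)); last by apply/funext => x; rewrite /q mulrA.
by apply: measurable_funM => //; exact: measurable_enorm_sqr.
Qed.

Section fixed_parameters.
Context (a b : Rn R n) (a0 : Rn0 a).
Local Notation sa := (Num.sqrt (absprod a)).

Let aprod_gt0 : 0 < absprod a.
Proof. by rewrite lt_neqAle eq_sym absprod_ge0 andbT. Qed.

Let sa2 : sa ^+ 2 = absprod a. Proof. by rewrite sqr_sqrtr// absprod_ge0. Qed.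

Let sa_gt0 : 0 < sa. Proof. by rewrite sqrtr_gt0. Qed.

Let maff : measurable_fun setT (affn a b). Proof. exact: measurable_affn. Qed.

Let affE (h : Rn R n -> \bar R) : measurable_fun setT h -> (forall x, 0 <= h x)%E ->
  (\int[lb]_x h (affn a b x) = (absprod a)%:E * \int[lb]_x h x)%E.
Proof. exact: ge0_integral_affn. Qed.

Let mulE (h : Rn R n -> \bar R) : measurable_fun setT h -> (forall x, 0 <= h x)%E ->
  (\int[lb]_x h (mulv a x) = (absprod a)^-1%:E * \int[lb]_x h x)%E.
Proof. exact: ge0_integral_mulv. Qed.

(** The operator that produces the wavelets, see [wavelet_liftE], and its
    conjugate under the transform. *)
Definition wavelet_lift phi (t : Rn R n) : R[i] :=
  sa^-1%:C * expi (q (affn a b t) - q t + q b) * phi (affn a b t).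

Definition wavelet_lift_hat g (xi : Rn R n) : R[i] :=
  sa%:C * expi (q b + q xi - q (mulv a xi) - inner b xi * sc) * g (mulv a xi).

Lemma cmeasurable_wavelet_lift phi : cmeasurable phi -> cmeasurable (wavelet_lift phi).
Proof.
move=> mphi; apply: cmeasurableM; last exact: cmeasurable_comp mphi maff.
apply: cmeasurableM; first exact: cmeasurable_cst.
apply: cmeasurable_expi; apply: measurable_funD => //; apply: measurable_funB => //.
exact: measurableT_comp mq maff.
Qed.

Lemma cmeasurable_wavelet_lift_hat g : cmeasurable g -> cmeasurable (wavelet_lift_hat g).
Proof.
have mm := measurable_mulv1 a.
move=> mg; apply: cmeasurableM; last exact: cmeasurable_comp mg mm.
apply: cmeasurableM; first exact: cmeasurable_cst.
apply: cmeasurable_expi; apply: measurable_funB.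
  apply: measurable_funB; first exact: measurable_funD.
  exact: measurableT_comp mq mm.
apply: measurable_funM => //.
exact: (measurableT_comp (@measurable_inner R n) (pair1_measurable b)).
Qed.

Lemma sqint_wavelet_lift phi : cmeasurable phi ->
  sqint lb (wavelet_lift phi) = sqint lb phi.
Proof.
move=> mphi.
transitivity (sqint lb (fun t => sa^-1%:C * phi (affn a b t))).
  by apply: eq_integral => t _; rewrite /wavelet_lift !normc_mul normc_expi mulr1.
rewrite sqintZ; last exact: cmeasurable_comp mphi maff.
rewrite (sqint_comp affE mphi) muleA -EFinM normc_real ger0_norm ?invr_ge0 ?sqrtr_ge0//.
by rewrite exprVn sa2 mulVf ?mul1e// gt_eqF.
Qed.

Lemma sqint_wavelet_lift_hat g : cmeasurable g ->
  sqint lb (wavelet_lift_hat g) = sqint lb g.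
Proof.
move=> mg.
transitivity (sqint lb (fun xi => sa%:C * g (mulv a xi))).
  by apply: eq_integral => t _; rewrite /wavelet_lift_hat !normc_mul normc_expi mulr1.
rewrite sqintZ; last exact: cmeasurable_comp mg (measurable_mulv1 a).
rewrite (sqint_comp mulE mg) muleA -EFinM normc_real ger0_norm ?sqrtr_ge0//.
by rewrite sa2 mulfV ?mul1e// gt_eqF.
Qed.

Lemma sq_integrable_wavelet_lift phi : sq_integrable lb phi ->
  sq_integrable lb (wavelet_lift phi).
Proof.
move=> [mphi ?]; split; first exact: cmeasurable_wavelet_lift.
by rewrite sqint_wavelet_lift.
Qed.

Lemma cintegrable_wavelet_lift phi : cintegrable lb phi -> cintegrable lb (wavelet_lift phi).
Proof.
move=> phii; have [_ i1] := cintegrableZ sa^-1%:C (cintegrable_comp maff affE phii).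
split; first by apply: cmeasurable_wavelet_lift; case: phii.
apply: le_lt_trans i1; rewrite le_eqVlt; apply/orP; left; apply/eqP.
by apply: eq_integral => t _; rewrite /wavelet_lift !normc_mul normc_expi mulr1.
Qed.

(** Substitute [t = a u + b]: the chirps in [t] cancel, and [<t, xi>] splits into
    [<u, a xi>] and [<b, xi>]. *)
Lemma transform_wavelet_lift phi : cintegrable lb phi ->
  T (wavelet_lift phi) = wavelet_lift_hat (T phi).
Proof.
move=> phii; apply/funext => xi; rewrite /wavelet_lift_hat.
set A := sa%:C * expi _.
have mK : kernel_measurable K by case: (@plancherel_frft R n alpha sin_neq0).
have K1 x y : normc (K x y) <= 1 by rewrite normc_expi.
pose F x := phi x * K x (mulv a xi).
have Fi : cintegrable lb F by exact: cintegrable_transform.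
transitivity (cint lb (fun t => ((absprod a)^-1%:C * A) * F (affn a b t))).
  apply: eq_cint => t; rewrite /wavelet_lift /A /F /frft_kernel.
  rewrite (inner_mulv_affn b t xi a0).
  (* the determinant [absprod a] of the substitution is displayed *)
  have -> : sa^-1 = (absprod a)^-1 * sa.
    by move: sa2 sa_gt0; set s := Num.sqrt _ => <- s0; field; rewrite gt_eqF.
  rewrite rmorphM /=.
  set s1 := (_^-1)%:C; set s2 := sa%:C.
  set e1 := q _ - q t + q b.
  rewrite (_ : s1 * s2 * expi e1 * phi (affn a b t) *
     expi ((enorm t ^+ 2 + enorm xi ^+ 2) * ct / 2 -
       (inner (affn a b t) (mulv a xi) + inner b xi) * sc) =
     s1 * s2 * phi (affn a b t) * (expi e1 *
     expi ((enorm t ^+ 2 + enorm xi ^+ 2) * ct / 2 -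
       (inner (affn a b t) (mulv a xi) + inner b xi) * sc))); last by ring.
  set e2 := q b + _ - _ - _; set e3 := _ / 2 - _; set e4 := _ / 2 - _.
  rewrite (_ : s1 * (s2 * expi e2) * (phi (affn a b t) * expi e4) =
     s1 * s2 * phi (affn a b t) * (expi e2 * expi e4)); last by ring.
  congr (_ * _); rewrite -!expiD; congr expi.
  by rewrite /e1 /e2 /e3 /e4 /q; ring.
have FAi : cintegrable lb (fun t => F (affn a b t)) := cintegrable_comp maff affE Fi.
rewrite (cintZ _ FAi) (cint_comp affE Fi).
rewrite -[transform lb K phi _]/(cint lb F); set I := cint lb F.
rewrite -mulrA mulrCA; congr (_ * _).
by rewrite mulrA -rmorphM/= mulVf ?mul1r// gt_eqF.
Qed.

Lemma is_transform2_wavelet_lift phi g : sq_integrable lb phi ->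
  is_transform2 lb lb K phi g -> is_transform2 lb lb K (wavelet_lift phi) (wavelet_lift_hat g).
Proof.
move=> [mphi _] [[mg gi] [u [ui uphi Tu]]].
have mK : kernel_measurable K by case: (@plancherel_frft R n alpha sin_neq0).
split.
  by split; [exact: cmeasurable_wavelet_lift_hat|rewrite sqint_wavelet_lift_hat].
exists (fun m => wavelet_lift (u m)); split.
- move=> m; have [u1 u2] := ui m.
  by split; [exact: cintegrable_wavelet_lift|exact: sq_integrable_wavelet_lift].
- rewrite /sq_cvg (_ : (fun m => _) = (fun m => sqint lb (fun x => (u m x - phi x)%R)))//.
  apply/funext => m; apply/esym.
  rewrite -sqint_wavelet_lift; last by apply: cmeasurableB => //; case: (ui m) => -[].
  by congr sqint; apply/funext => x; rewrite /wavelet_lift mulrBr.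
- rewrite /sq_cvg (_ : (fun m => _) = (fun m => sqint lb (fun x => (T (u m) x - g x)%R)))//.
  apply/funext => m; apply/esym; have um := proj1 (proj1 (ui m)).
  rewrite -sqint_wavelet_lift_hat; last first.
    by apply: cmeasurableB => //; exact: cmeasurable_transform.
  congr sqint; apply/funext => x.
  by rewrite transform_wavelet_lift; [rewrite /wavelet_lift_hat mulrBr|case: (ui m)].
Qed.

Lemma wavelet_liftE psi :
  wavelet alpha psi a b = wavelet_lift (fun t => chirp alpha t * psi t).
Proof.
apply/funext => t; rewrite /wavelet /wavelet_lift /chirp -/(affn a b t).
set p := psi _; set s := _%:C; set e1 := q _ - _ + _; set e2 := - (enorm (affn a b t) ^+ 2 * ct / 2).
rewrite (_ : s * expi e1 * (expi e2 * p) = s * p * (expi e1 * expi e2)); last by ring.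
by rewrite -expiD; congr (_ * expi _); rewrite /e1 /e2 /q; ring.
Qed.

End fixed_parameters.

End wavelet_lift.

(** * Admissibility *)

Lemma ae_Rn0 (R : realType) (n : nat) : {ae lebn R n, forall x, Rn0 x}.
Proof.
suff H i : {ae lebn R n, forall x, coord x i != 0}.
  have := @filter_forall _ _ (fun i (x : Rn R n) => coord x i != 0) _ (ae_filter_ringOfSetsType (lebn R n)) H.
  by apply: filterS => x /Rn0P.
pose A j : set (measurableTypeR R) := if j == i then [set 0] else setT.
have mA j : measurable (A j).
  by rewrite /A; case: ifP => _ //; exact: measurable_set1.
exists [set x | forall j, A j (tnth x j)]; split.
- rewrite (_ : [set x | _] = \bigcap_(j in [set: 'I_n])
    ((@tnth n (measurableTypeR R))^~ j @^-1` A j)).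
    apply: fin_bigcap_measurable => // j _.
    by rewrite -[X in measurable X]setTI; exact: measurable_tnth.
  by apply/seteqP; split => x /= h j; [move=> _; exact: h|exact: h].
- rewrite lebn_box// (bigD1 i)//= {1}/A eqxx lebesgue_measure_set1 mul0e.
  by [].
- move=> x /= /negP; rewrite negbK => /eqP xi j; rewrite /A.
  by case: eqP => // ->.
Qed.

Lemma notin_Rn0 (R : realType) (n : nat) (x : Rn R n) : x \notin Rn0 -> absprod x = 0.
Proof. by move=> /negP; rewrite inE /Rn0 /= => /negP; rewrite negbK => /eqP. Qed.

Section admissibility.
Context {R : realType} {n : nat} (alpha : R) (sin_neq0 : sin alpha != 0).
Local Notation lb := (lebn R n).
Local Notation ct := (cot alpha).
Local Notation sc := (csc alpha).
Local Notation C := (fourier_const sc ^+ n).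
Local Notation Ca := (@Calpha R n alpha).
Local Notation K := (@frft_kernel R n alpha).
Local Notation T := (transform lb K).
Context (psi : Rn R n -> R[i]) (psi_sq : sq_integrable lb psi).

Local Notation chpsi := (fun t => chirp alpha t * psi t).

Let mchirp : cmeasurable (@chirp R n alpha).
Proof.
apply: cmeasurable_expi; apply: measurableT_comp => //.
rewrite (_ : (fun x => _) = fun x : Rn R n => enorm x ^+ 2 * (ct / 2)).
  by apply: measurable_funM => //; exact: measurable_enorm_sqr.
by apply/funext => x; rewrite mulrA.
Qed.

Lemma sq_integrable_chirp : sq_integrable lb chpsi.
Proof.
case: psi_sq => mpsi psii; split; first exact: cmeasurableM.
rewrite [X in (X < _)%E](_ : _ = sqint lb psi)//.
by apply: eq_integral => x _; rewrite normc_mul normc_expi mul1r.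
Qed.

Let Phi xi : R[i] := Ca^-1 * frft2 alpha chpsi xi.

Let PhiP : is_transform2 lb lb K chpsi Phi.
Proof. by apply: frft2_transform2 => //; exact: sq_integrable_chirp. Qed.

Let mPhi : cmeasurable Phi. Proof. by case: PhiP => -[]. Qed.

Let Q : \bar R := (\int[lb]_u (normc (Phi u) ^+ 2 / absprod u)%:E)%E.

Let mG : measurable_fun setT (fun u : Rn R n => (normc (Phi u) ^+ 2 / absprod u)%:E).
Proof.
apply/measurable_EFinP; apply: measurable_funM; first exact: measurable_normc_sqr.
by apply: measurableT_comp measurable_invr _; exact: measurable_absprod.
Qed.

Let G0 (u : Rn R n) : (0 <= (normc (Phi u) ^+ 2 / absprod u)%:E)%E.
Proof. by rewrite lee_fin mulr_ge0 ?sqr_ge0 ?invr_ge0 ?absprod_ge0. Qed.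

Let Q0 : (0 <= Q)%E. Proof. by apply: integral_ge0 => u _; exact: G0. Qed.

(** Outside [Rn0] the integrand of [Q] is 0, because [0^-1 = 0]. *)
Lemma CpsiE : Cpsi alpha psi = ((normc Ca ^+ 2)%:E * Q)%E.
Proof.
have Ca0 := Calpha_neq0 (n := n) alpha.
rewrite /Cpsi integral_mkcond /Q -ge0_integralZl//; last by rewrite lee_fin sqr_ge0.
apply: eq_integral => u _; rewrite /patch; case: ifPn => [_|].
  rewrite -EFinM; congr EFin; rewrite mulrA -exprMn -normc_mul /Phi mulrA mulfV ?mul1r//.
move=> /notin_Rn0 u0; rewrite u0 (_ : (normc (Phi u) ^+ 2 / 0)%:E = 0%E) ?mule0//.
by rewrite invr0 mulr0.
Qed.

Context (Psi : Rn R n -> R[i]) (PsiP : is_transform2 lb lb K psi Psi).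

Let mPsi : cmeasurable Psi. Proof. by case: PsiP => -[]. Qed.

Let C0 : 0 < C. Proof. exact: frft_const_gt0. Qed.

Let Ci0 : 0 <= C^-1. Proof. by rewrite invr_ge0 ltW. Qed.

(** Up to constants, the wavelet coefficients at scale [a] are the transform of
    this function.  As a product of two square-integrable functions it is
    integrable. *)
Definition wavelet_spectrum (a xi : Rn R n) : R[i] :=
  chirp alpha (mulv a xi) * Phi (mulv a xi) * conjc (Psi xi).

Let sq_Phi a : Rn0 a -> (sqint lb (fun xi => chirp alpha (mulv a xi) * Phi (mulv a xi))%R < +oo)%E.
Proof.
move=> a0.
rewrite [X in (X < _)%E](_ : _ = sqint lb (fun xi => Phi (mulv a xi))); last first.
  by apply: eq_integral => x _; rewrite normc_mul normc_expi mul1r.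
rewrite (sqint_comp (fun f => @ge0_integral_mulv R n a f a0) mPhi).
rewrite lte_mul_pinfty ?lee_fin ?invr_ge0 ?absprod_ge0//.
by case: PhiP => -[].
Qed.

Lemma cintegrable_wavelet_spectrum a : Rn0 a -> cintegrable lb (wavelet_spectrum a).
Proof.
move=> a0; have mm := measurable_mulv1 a.
apply: cintegrable_mul.
- apply: cmeasurableM; first exact: cmeasurable_comp mchirp mm.
  exact: cmeasurable_comp mPhi mm.
- exact: cmeasurableJ.
- exact: sq_Phi.
- by rewrite sqintJ; case: PsiP => -[].
Qed.

(** Parseval's formula, the wavelet being the lift of the chirped function. *)
Lemma wavelet_coefficient a b : Rn0 a ->
  C%:C * L2_inner (wavelet alpha psi a b) psi =
  (Num.sqrt (absprod a))%:C * T (wavelet_spectrum a) b.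
Proof.
move=> a0.
have P := plancherel_frft sin_neq0 (n := n).
have chi := sq_integrable_chirp.
have Ui := sq_integrable_wavelet_lift alpha b a0 chi.
have UP := is_transform2_wavelet_lift sin_neq0 b a0 chi PhiP.
have H := parseval P C0 Ui psi_sq UP PsiP.
rewrite -[L2_inner _ _]/(cint lb (fun x => wavelet alpha psi a b x * conjc (psi x))).
rewrite wavelet_liftE.
apply: etrans (esym H) _.
have ki : cintegrable lb (fun x => wavelet_spectrum a x * K x b).
  apply: cintegrable_transform; [by case: P|by move=> x y; rewrite normc_expi|].
  exact: cintegrable_wavelet_spectrum.
rewrite /transform -(cintZ _ ki); apply: eq_cint => xi.
rewrite /wavelet_lift_hat /wavelet_spectrum /chirp /frft_kernel.
set s := _%:C; set p := Phi _; set z := conjc _.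
set e1 := _ + _ - _ - _; set e2 := - _; set e3 := _ / 2 - _.
rewrite (_ : s * (expi e2 * p * z * expi e3) = s * (expi e2 * expi e3) * p * z); last by ring.
rewrite -expiD; congr (_ * expi _ * _ * _).
have E : inner b xi = inner xi b by apply: eq_bigr => i _; rewrite mulrC.
by rewrite /e1 /e2 /e3 E; ring.
Qed.

Let h (z : Rn R n * Rn R n) : R := normc (Phi (mulv z.1 z.2)) ^+ 2 * normc (Psi z.2) ^+ 2.

Let h0 z : 0 <= h z. Proof. by rewrite mulr_ge0// sqr_ge0. Qed.

Let mh : measurable_fun setT h.
Proof.
apply: measurable_funM; apply: measurable_normc_sqr.
- exact: cmeasurable_comp mPhi (@measurable_mulv R n).
- exact: cmeasurable_comp mPsi measurable_snd.
Qed.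

(** Plancherel's formula for [wavelet_spectrum a]; either side may be infinite. *)
Lemma wavelet_energy a : Rn0 a ->
  (\int[lb]_b (normc (L2_inner (wavelet alpha psi a b) psi) ^+ 2 / absprod a ^+ 2)%:E =
   (C^-1 * (absprod a)^-1)%:E * \int[lb]_xi (h (a, xi))%:E)%E.
Proof.
move=> a0.
have P := plancherel_frft sin_neq0 (n := n).
have [mK _ PP] := P.
have wi := cintegrable_wavelet_spectrum a0.
have aneq0 : absprod a != 0 by [].
transitivity (\int[lb]_b ((C ^- 2 * (absprod a)^-1)%:E *
    (normc (T (wavelet_spectrum a) b) ^+ 2)%:E))%E.
  apply: eq_integral => b _; rewrite -EFinM; congr EFin.
  have /(congr1 (fun z => normc z ^+ 2)) := wavelet_coefficient b a0.
  have nM (c : R) (z : R[i]) : normc (c%:C * z) ^+ 2 = c ^+ 2 * normc z ^+ 2.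
    by rewrite normc_mul exprMn normc_real real_normK// num_real.
  rewrite 2!nM (sqr_sqrtr (absprod_ge0 a)) => E.
  set l := normc _ ^+ 2 in E *; set r := normc _ ^+ 2 in E *.
  have -> : l = C ^- 2 * (absprod a * r) by rewrite -E mulKf// expf_neq0// gt_eqF.
  by field; rewrite aneq0 gt_eqF.
rewrite ge0_integralZl//; last 3 first.
- by apply: measurable_sqint_integrand; apply: cmeasurable_transform mK _; case: wi.
- by move=> x _; rewrite lee_fin sqr_ge0.
- by rewrite lee_fin mulr_ge0 ?invr_ge0 ?absprod_ge0// exprn_ge0// ltW.
rewrite -/(sqint lb (T (wavelet_spectrum a))) (PP _ wi) muleA -EFinM.
congr (_%:E * _)%E; first by field; rewrite aneq0 gt_eqF.
apply: eq_integral => xi _; rewrite /wavelet_spectrum /h !normc_mul normc_expi mul1r.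
by rewrite exprMn normcJ.
Qed.

(** By [wavelet_energy] and Tonelli's theorem the integral is that of
    [|a|^-1 |Phi (a xi)|^2 |Psi xi|^2] over all [(a, xi)]; integrating in [a]
    first, with [u = a xi], leaves the product of [Q] and of the squared norm of
    [Psi], which is a multiple of that of [psi]. *)
Lemma admissible_integralE :
  (\int[lb]_(a in Rn0) \int[lb]_b
    (normc (L2_inner (wavelet alpha psi a b) psi) ^+ 2 / absprod a ^+ 2)%:E =
   Q * sqint lb psi)%E.
Proof.
pose F (z : Rn R n * Rn R n) : \bar R := (C^-1 * (absprod z.1)^-1 * h z)%:E.
have F0 z : (0 <= F z)%E.
  rewrite lee_fin; apply: mulr_ge0 => //; apply: mulr_ge0 => //.
  by rewrite invr_ge0 absprod_ge0.
have mF : measurable_fun setT F.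
  apply/measurable_EFinP; apply: measurable_funM => //; apply: measurable_funM => //.
  apply: measurableT_comp measurable_invr _.
  exact: (measurableT_comp (@measurable_absprod R n) measurable_fst).
have mh1 a : measurable_fun setT (fun xi => (h (a, xi))%:E).
  by apply/measurable_EFinP; apply: (measurableT_comp mh); exact: pair1_measurable.
transitivity (\int[lb]_a \int[lb]_xi F (a, xi))%E.
  rewrite integral_mkcond; apply: eq_integral => a _; rewrite /patch; case: ifPn => [|].
    rewrite inE => a0; rewrite (wavelet_energy a0) -ge0_integralZl//.
    - by move=> x _; rewrite lee_fin h0.
    - by rewrite lee_fin mulr_ge0// invr_ge0 absprod_ge0.
  move=> /notin_Rn0 a0; apply/esym; transitivity (\int[lb]_xi (cst 0%E xi))%E; last exact: integral0.
  by apply: eq_integral => xi _; rewrite /F /= a0 invr0 mulr0 mul0r.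
apply: etrans (fubini_tonelli F mF F0) _.
transitivity (\int[lb]_xi (Q * (C^-1 * normc (Psi xi) ^+ 2)%:E))%E.
  apply: ge0_ae_eq_integral => //.
  - exact: (ge0_measurable_integral2 lb mF F0).
  - apply: measurable_funeM; apply/measurable_EFinP; apply: measurable_funM => //.
    exact: measurable_normc_sqr.
  - by move=> xi _; apply: integral_ge0 => a _; exact: F0.
  - by move=> xi _; rewrite mule_ge0// lee_fin mulr_ge0 ?sqr_ge0// invr_ge0 ltW.
  apply: filterS (@ae_Rn0 R n) => xi xi0 _.
  have xin0 : absprod xi != 0 by [].
  transitivity (\int[lb]_a ((C^-1 * normc (Psi xi) ^+ 2 * absprod xi)%:E *
      (normc (Phi (mulv xi a)) ^+ 2 / absprod (mulv xi a))%:E))%E.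
    apply: eq_integral => a _; rewrite -EFinM; congr EFin.
    rewrite /h /= absprodM (mulvC xi a) invfM.
    set x := normc (Phi _) ^+ 2; set ai := (absprod a)^-1; set ci := (C)^-1.
    by field; rewrite xin0.
  rewrite ge0_integralZl//; last 2 first.
  - exact: (measurableT_comp mG (measurable_mulv1 xi)).
  - by rewrite lee_fin mulr_ge0 ?absprod_ge0// mulr_ge0// sqr_ge0.
  rewrite (ge0_integral_mulv xi0 mG G0) -/Q muleA -EFinM muleC; congr (_ * _%:E)%E.
  by field; rewrite xin0 gt_eqF.
rewrite ge0_integralZl//; last 2 first.
- apply/measurable_EFinP; apply: measurable_funM => //; exact: measurable_normc_sqr.
- by move=> xi _; rewrite lee_fin mulr_ge0// sqr_ge0.
congr (_ * _)%E.
transitivity (\int[lb]_xi ((C^-1)%:E * (normc (Psi xi) ^+ 2)%:E))%E; first by [].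
rewrite ge0_integralZl//; last 2 first.
- exact: measurable_sqint_integrand.
- by move=> xi _; rewrite lee_fin sqr_ge0.
rewrite -/(sqint lb Psi) (sqint_transform2 (plancherel_frft sin_neq0) C0 psi_sq PsiP).
by rewrite muleA -EFinM mulVf ?mul1e// gt_eqF.
Qed.

End admissibility.

(** Translate [x] by a multiple of pi to the half-open interval from 0 to pi, where
    the sine only vanishes at 0. *)
Lemma sin_eq0_pi (R : realType) (x : R) : sin x = 0 -> exists k : int, x = k%:~R * pi.
Proof.
move=> x0; have pi0 := pi_gt0 R; pose k := Num.floor (x / pi); exists k.
have /andP[kx xk] : k%:~R <= x / pi < (k + 1)%:~R by exact: floor_itv.
rewrite ler_pdivlMr// in kx; rewrite ltr_pdivrMr// intrD mulrDl mul1r in xk.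
pose y := x - k%:~R * pi.
have y0 : sin y = 0.
  rewrite /y; case: {kx xk y} k => m.
  - have := alternatingn (@sinDpi R) m (x - m%:~R * pi).
    rewrite -mulr_natl subrK x0 => /esym/eqP.
    by rewrite mulf_eq0 signr_eq0 => /eqP.
  - have := alternatingn (@sinDpi R) m.+1 x.
    by rewrite x0 mulr0 NegzE mulrNz mulNr opprK -mulr_natl.
have [ygt0|] := ltP 0 y; last first.
  by rewrite /y subr_le0 => xk'; apply/eqP; rewrite eq_le xk' kx.
suff : 0 < sin y by rewrite y0 ltxx.
by apply: sin_gt0_pi; rewrite ygt0 /y ltrBlDl.
Qed.

Theorem theorem2p5 (R : realType) (n : nat) (n_ge1 : (1 <= n)%N)
    (alpha : R) (alpha_notin : forall k : int, alpha <> k%:~R * pi)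
    (psi : Rn R n -> R[i]) (psi_L2 : cLp 2%:E psi)
    (psi_neq0 : ~ {ae lebn R n, forall t, psi t = 0}) :
  wavelet_admissible alpha psi <-> (Cpsi alpha psi < +oo)%E.
Proof.
have sin_neq0 : sin alpha != 0.
  by apply/eqP => /sin_eq0_pi[k]; exact: alpha_notin.
have psi_sq : sq_integrable (lebn R n) psi by apply/cLp2P.
have [Psi PsiP] := is_transform2_exists (plancherel_frft sin_neq0)
  (frft_const_gt0 sin_neq0) psi_sq.
rewrite /wavelet_admissible (admissible_integralE sin_neq0 psi_sq PsiP) (CpsiE sin_neq0 psi_sq).
set Q := integral _ _ _; have Q0 : (0 <= Q)%E.
  by apply: integral_ge0 => u _; rewrite lee_fin mulr_ge0 ?sqr_ge0 ?invr_ge0 ?absprod_ge0.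
have s0 : (0 < sqint (lebn R n) psi)%E.
  rewrite lt_neqAle sqint_ge0 andbT eq_sym; apply/eqP => s0.
  by apply: psi_neq0; apply: sqint0_ae s0; case: psi_sq.
have [_ s1] := psi_sq.
have c0 : 0 < normc (@Calpha R n alpha) ^+ 2.
  by rewrite exprn_gt0// lt_neqAle eq_sym normc_eq0 normc_ge0 Calpha_neq0.
have [Qy|Qfin] := eqVneq Q +oo%E.
  rewrite Qy gt0_mulye// muleC gt0_mulye// ?lte_fin//.
have {}Qfin : (Q < +oo)%E by rewrite ltey.
split=> _.
  by rewrite lte_mul_pinfty// ?lee_fin ?ltW.
by rewrite lte_mul_pinfty// ge0_fin_numE.
Qed.
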